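(* Let $G$ be a sequentially complete minimal Hausdorff topological Abelian group, and let $\widetilde G$ denote its completion. The following are equivalent: (a) the power $G^\kappa$ (with the product topology) is minimal for every cardinal $\kappa$; (b) $G^\omega$ is minimal; (c) $G$ contains $c(\widetilde G)$ (and hence $c(G)=c(\widetilde G)$ is compact).
   Context: A Hausdorff topological group $(G,\tau)$ is minimal if there is no Hausdorff group topology on $G$ strictly coarser than $\tau$. A topological Abelian group $G$ is sequentially complete if $G$ is sequentially closed in its completion $\widetilde G$ (equivalently, every Cauchy sequence in $G$ converges in $G$). For a topological group $H$, $c(H)$ denotes the connected component of the neutral element. *)

(* Defs.v *)
From HB Require Import structures.
From mathcomp Require Import all_boot all_order all_algebra.
From mathcomp Require Import all_classical all_reals all_analysis.

Set Implicit Arguments.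
Unset Strict Implicit.
Unset Printing Implicit Defensive.

Import Order.TTheory GRing.Theory.
Local Open Scope classical_set_scope.
Local Open Scope ring_scope.

(* [t : Topological M] is a bare topology on the carrier [M], as in
   [sup_topology]; the group operations remain those of [M]. *)
Definition group_topology (M : zmodType) (t : Topological M) :=
  let T : topologicalType := Topological.Pack t in
  continuous (fun x : T * T => (x.1 : M) + (x.2 : M) : T) /\
  continuous (fun x : T => - (x : M) : T).

Definition minimal_group (G : topologicalZmodType) :=
  hausdorff_space G /\
  ~ exists t : Topological G,
      [/\ group_topology t, hausdorff_space (Topological.Pack t) &
          @open (Topological.Pack t) `<` @open G].

Definition group_cauchy (G : topologicalZmodType) (F : set_system G) :=
  forall U, nbhs (0 : G) U ->
    exists2 A, F A & forall x y, A x -> A y -> U (x - y).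

Definition complete_group (G : topologicalZmodType) :=
  forall F : set_system G, ProperFilter F -> group_cauchy F ->
    exists x : G, F --> x.

(* A completion is unique up to a unique topological isomorphism under [G],
   so it is characterised here rather than constructed. *)
Definition is_completion (G H : topologicalZmodType) (i : {additive G -> H}) :=
  [/\ hausdorff_space H, complete_group H, injective i,
      @open G = [set i @^-1` B | B in @open H] & dense (range i)].

Definition sequentially_closed (T : topologicalType) (A : set T) :=
  forall (u : nat -> T) (x : T), (forall n, A (u n)) -> u @ \oo --> x -> A x.

Definition sequentially_complete (G H : topologicalZmodType)
  (i : {additive G -> H}) := sequentially_closed (range i).

Definition zero_component (G : topologicalZmodType) : set G :=
  connected_component [set: G] 0.
Arguments zero_component : clear implicits.

Definition group_power (I : Type) (G : Type) : Type := {ptws I -> G}.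

Section group_power.
Context (I : Type) (G : topologicalZmodType).

HB.instance Definition _ := Topological.copy (group_power I G) {ptws I -> G}.
HB.instance Definition _ := GRing.Zmodule.copy (group_power I G) (I -> G).

Let group_power_sub_continuous :
  continuous (fun x : group_power I G * group_power I G => x.1 - x.2).
Proof.
move=> x; apply/cvg_sup => i; apply/cvg_image.
  by rewrite eqEsubset; split=> v // _; exists (cst v).
have pc : continuous (fun f : group_power I G => f i).
  move=> f; have /cvg_sup/(_ i)/cvg_image h : f --> f by exact: cvg_id.
  apply: cvg_trans (h _) => [|].
    by move=> Q /= [W nbdW <-]; apply: filterS nbdW; exact: preimage_image.
  by rewrite eqEsubset; split=> v // _; exists (cst v).
have lim : (fun y : group_power I G * group_power I G => y.1 i - y.2 i) @ x
    --> x.1 i - x.2 i.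
  apply: (@continuous_comp _ _ _
    (fun y : group_power I G * group_power I G => (y.1 i, y.2 i))
    (fun y : G * G => y.1 - y.2)); last exact: sub_continuous.
  have c1 : (fun y : group_power I G * group_power I G => y.1 i) @ x --> x.1 i.
    apply: (cvg_comp fst (fun f : group_power I G => f i)); last exact: pc.
    exact: cvg_fst.
  have c2 : (fun y : group_power I G * group_power I G => y.2 i) @ x --> x.2 i.
    apply: (cvg_comp snd (fun f : group_power I G => f i)); last exact: pc.
    exact: cvg_snd.
  exact: (cvg_pair c1 c2).
move=> A /lim /= xA.
exists ((fun f : group_power I G => f i) @^-1` A); first exact: xA.
by rewrite image_preimage// eqEsubset; split=> v // _; exists (cst v).
Qed.

HB.instance Definition _ :=
  PreTopologicalNmodule_isTopologicalZmodule.Build (group_power I G)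
    group_power_sub_continuous.

End group_power.

(* Main.v *)
Require Import Defs.
From HB Require Import structures.
From mathcomp Require Import Rstruct.
From mathcomp Require Import all_boot all_order all_algebra.
From mathcomp Require Import all_classical all_reals all_analysis.
From mathcomp Require Import zify ring lra.

Set Implicit Arguments.
Unset Strict Implicit.
Unset Printing Implicit Defensive.

Import Order.TTheory GRing.Theory.
Local Open Scope classical_set_scope.
Local Open Scope ring_scope.
Import Num.Theory numFieldNormedType.Exports.

(* A minimal abelian group is precompact (Prodanov and Stoyanov), so its
   completion [K] is compact, and a dense subgroup of a compact group is minimal
   exactly when it is essential, that is, when it meets every nonzero closed
   subgroup. Følner's theorem provides enough continuous characters on [K]; these
   are represented by real functions additive modulo the integers. The component
   of zero of [K] is its divisible part [D].

   If the countable power is minimal, essentiality applied to sequences of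
   [p]-power torsion elements (in the topological sense) bounds the exponent
   modulo [G], so that by divisibility all such elements of [D] lie in [G]; every
   element of [D] is a limit of sequences built from these, and [G] is
   sequentially closed. Conversely, if [G] contains [D], a Baire argument bounds
   the exponent modulo [G] of the torsion elements of [K]; a closed subgroup of a
   power of [K] either meets the power of [D] or consists of torsion elements, so
   that it meets the power of [G]. *)

(** No Haar measure is used and no quotient of a topological group is formed: a character is a real
    lift, and statements about a quotient by [N] are made modulo [N]. Følner's theorem is proved on
    a free abelian group, where any real values on the generators define a character, by finite
    Fourier analysis on boxes and an ultrafilter limit. It is thus available before precompactness
    is known, and precompactness depends on it. There, each failure yields a sequence so independent
    that adding suitable integer combinations of it to the neighbourhoods of zero gives a coarser
    topology which is still Hausdorff, against minimality. This happens twice: with combinations of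
    slowly growing coefficients, to cover some multiple [c G] by finitely many translates of a given
    neighbourhood; then with Bohr sets, to pass from [c G] to [G] one prime at a time. The torsion
    elements that approximate a point [x] of [D] come from additive maps of the line with rational
    values that fix 1 and tend pointwise to the identity: composed with evaluation at [x], they are
    points of [D] by duality. *)

(** * Equalities in abelian groups by reflection *)

Inductive zexp := ZVar of nat | ZZero | ZAdd of zexp & zexp | ZOpp of zexp
  | ZMuln of zexp & nat | ZMulz of zexp & int.

Fixpoint zeval (G : zmodType) (env : seq G) (e : zexp) : G :=
  match e with
  | ZVar i => nth 0 env i
  | ZZero => 0
  | ZAdd e1 e2 => zeval env e1 + zeval env e2
  | ZOpp e1 => - zeval env e1
  | ZMuln e1 n => zeval env e1 *+ n
  | ZMulz e1 z => zeval env e1 *~ z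
  end.

Fixpoint zcoef (e : zexp) (i : nat) : int :=
  match e with
  | ZVar j => if i == j then 1 else 0
  | ZZero => 0
  | ZAdd e1 e2 => zcoef e1 i + zcoef e2 i
  | ZOpp e1 => - zcoef e1 i
  | ZMuln e1 n => zcoef e1 i * n%:Z
  | ZMulz e1 z => zcoef e1 i * z
  end.

Fixpoint zvars_lt (e : zexp) (n : nat) : bool :=
  match e with
  | ZVar j => j < n
  | ZZero => true
  | ZAdd e1 e2 => zvars_lt e1 n && zvars_lt e2 n
  | ZOpp e1 | ZMuln e1 _ | ZMulz e1 _ => zvars_lt e1 n
  end%N.

(** A proposition that [simpl] unfolds to one integer equation per atom: scalars may be variables,
    so coefficients are compared by [ring] or [lia] and not by computation. *)
Fixpoint zcoef_eq (e1 e2 : zexp) (n : nat) : Prop :=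
  if n is m.+1 then zcoef e1 m = zcoef e2 m /\ zcoef_eq e1 e2 m else True.

Lemma zevalE (G : zmodType) (env : seq G) e : zvars_lt e (size env) ->
  zeval env e = \sum_(i < size env) env`_i *~ zcoef e i.
Proof.
elim: e => [j|_|e1 IH1 e2 IH2|e1 IH1|e1 IH1 n|e1 IH1 z] /=.
- move=> js; rewrite (bigD1 (Ordinal js)) //= eqxx mulr1z big1 ?addr0//.
  by move=> i ij; rewrite ifN.
- by rewrite big1// => i _; rewrite mulr0z.
- move=> /andP[/IH1 -> /IH2 ->]; rewrite -big_split; apply: eq_bigr => i _.
  by rewrite mulrzDr.
- by move=> /IH1 ->; rewrite -sumrN; apply: eq_bigr => i _; rewrite mulrNz.
- by move=> /IH1 ->; rewrite -sumrMnl; apply: eq_bigr => i _; rewrite mulrzA -pmulrn.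
- by move=> /IH1 ->; rewrite mulrz_suml; apply: eq_bigr => i _; rewrite mulrzA.
Qed.

Lemma zmod_eq (G : zmodType) (env : seq G) e1 e2 :
  zvars_lt e1 (size env) && zvars_lt e2 (size env) ->
  zcoef_eq e1 e2 (size env) -> zeval env e1 = zeval env e2.
Proof.
move=> /andP[v1 v2] eq12; rewrite !zevalE//; apply: eq_bigr => i _; congr (_ *~ _).
case: i => i /= ilt; elim: (size env) eq12 ilt => //= n IH [e /IH {}IH]; rewrite ltnS leq_eqVlt.
by move=> /orP[/eqP ->|].
Qed.

Ltac zmod_mem x l :=
  match l with
  | nil => constr:(false)
  | x :: _ => constr:(true)
  | _ :: ?l' => zmod_mem x l'
  end.

Ltac zmod_idx x l :=
  match l with
  | x :: _ => constr:(O)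
  | _ :: ?l' => let n := zmod_idx x l' in constr:(S n)
  end.

Ltac zmod_atoms t l :=
  match t with
  | ?a + ?b => let l1 := zmod_atoms a l in zmod_atoms b l1
  | - ?a => zmod_atoms a l
  | ?a *+ _ => zmod_atoms a l
  | ?a *~ _ => zmod_atoms a l
  | 0 => l
  | _ => match zmod_mem t l with true => l | false => constr:(t :: l) end
  end.

Ltac zmod_reify t l :=
  match t with
  | ?a + ?b => let x := zmod_reify a l in let y := zmod_reify b l in
               constr:(ZAdd x y)
  | - ?a => let x := zmod_reify a l in constr:(ZOpp x)
  | ?a *+ ?n => let x := zmod_reify a l in constr:(ZMuln x n)
  | ?a *~ ?z => let x := zmod_reify a l in constr:(ZMulz x z)
  | 0 => constr:(ZZero)
  | _ => let i := zmod_idx t l in constr:(ZVar i)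
  end.

Ltac zmod :=
  match goal with
  | |- @eq ?T ?a ?b =>
    let l0 := constr:(@nil T) in
    let l1 := zmod_atoms a l0 in
    let l := zmod_atoms b l1 in
    let x := zmod_reify a l in
    let y := zmod_reify b l in
    change (zeval l x = zeval l y); apply: zmod_eq; [reflexivity |
    simpl; repeat split; (reflexivity || ring || lia)]
  end.

(** * Group topologies *)

(** A base at zero of a group topology, with no separation required. Continuity of subtraction
    covers sums and opposites. *)
Record group_base (G : zmodType) (B : set_system G) : Prop := GroupBase {
  group_base_ex : exists U, B U;
  group_base0 : forall U, B U -> U 0;
  group_baseI : forall U V, B U -> B V -> exists2 W, B W & W `<=` U `&` V;
  group_baseB : forall U, B U ->
    exists2 V, B V & forall x y, V x -> V y -> U (x - y) }.

Definition subgroup (G : zmodType) (N : set G) :=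
  N 0 /\ forall x y, N x -> N y -> N (x - y).

(** The translates may be centred outside [A]; for [A := setT] this is precompactness at [U]. *)
Definition finitely_covered (G : zmodType) (A U : set G) :=
  exists s : seq G, forall x, A x -> exists2 f, f \in s & U (x - f).

Section subgroups.
Context (G : zmodType) (N : set G) (sN : subgroup N).

Lemma subgroupN x : N x -> N (- x).
Proof. by case: sN => N0 NB Nx; rewrite -sub0r; exact: NB. Qed.

Lemma subgroupD x y : N x -> N y -> N (x + y).
Proof.
by case: sN => N0 NB Nx Ny; rewrite -[y]opprK; apply: NB => //; exact: subgroupN.
Qed.

Lemma subgroupMn x n : N x -> N (x *+ n).
Proof.
by move=> Nx; elim: n => [|n IH]; [case: sN|rewrite mulrS; exact: subgroupD].
Qed.

Lemma subgroupMz x z : N x -> N (x *~ z).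
Proof.
case: z => n Nx; first exact: subgroupMn.
by rewrite NegzE mulrNz; apply: subgroupN; exact: subgroupMn.
Qed.

Lemma subgroup_sum (I : eqType) (s : seq I) (F : I -> G) :
  (forall i, i \in s -> N (F i)) -> N (\sum_(i <- s) F i).
Proof.
elim: s => [|i s IH] H; first by rewrite big_nil; case: sN.
rewrite big_cons; apply: subgroupD; first by apply: H; rewrite inE eqxx.
by apply: IH => j js; apply: H; rewrite inE js orbT.
Qed.

End subgroups.

Section group_base_theory.
Context (G : zmodType) (B : set_system G) (gB : group_base B).

(** Either sign is allowed for each summand, so that one statement serves sums, differences and
    multiples without symmetric neighbourhoods. *)
Lemma group_base_sum U n : B U -> exists2 V, B V & forall s : seq G,
  (size s <= n)%N -> (forall x, x \in s -> V x \/ V (- x)) ->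
  U (\sum_(x <- s) x).
Proof.
elim: n U => [|n IH] U BU.
  by exists U => // -[|//] _ _; rewrite big_nil; exact: group_base0 gB _ BU.
have [V BV VU] := group_baseB gB BU.
have [V' BV' V'V] := group_baseB gB BV.
have [W BW WV] := IH V BV.
have [W' BW' W'E] := group_baseI gB BW BV'.
exists W' => // -[|x s] /= sz xW; first by rewrite big_nil; exact: group_base0 gB _ BU.
rewrite big_cons addrC -[x]opprK; apply: VU.
  apply: WV => // y ys.
  by have [|/W'E[]|/W'E[]] := xW y; rewrite ?inE ?ys ?orbT; auto.
have V'0 := group_base0 gB BV'.
have [/W'E[_ xV]|/W'E[_ xV]] := xW x (mem_head _ _).
  by rewrite -sub0r; exact: V'V.
by rewrite -[- x]subr0; exact: V'V.
Qed.

Lemma group_baseMz U n : B U -> exists2 V, B V & forall x (z : int),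
  (`|z| <= n)%N -> V x -> U (x *~ z).
Proof.
move=> /(group_base_sum n)[V BV VU]; exists V => // x z zn Vx.
have sumE (y : G) m : \sum_(t <- nseq m y) t = y *+ m.
  by elim: m => [|m IH] /=; rewrite ?big_nil// big_cons IH mulrS.
case: z zn => m zn.
  rewrite -pmulrn -sumE; apply: VU => [|y]; first by rewrite size_nseq.
  by rewrite mem_nseq => /andP[_ /eqP ->]; left.
rewrite NegzE mulrNz -pmulrn -mulNrn -sumE.
apply: VU => [|y]; first by rewrite size_nseq.
by rewrite mem_nseq => /andP[_ /eqP ->]; right; rewrite opprK.
Qed.

End group_base_theory.

(** An alias of [G] that mentions [gB], so that the topology is attached as an instance without
    clashing with one already on [G]. *)
Definition base_topology (G : zmodType) (B : set_system G) (gB : group_base B) :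
  Type := G.

Section base_topology.
Context (G : zmodType) (B : set_system G) (gB : group_base B).
Local Notation T := (base_topology gB).

HB.instance Definition _ := Choice.copy T G.

Definition base_nbhs (x : T) : set_system T :=
  [set A | exists2 U, B U & forall y : G, U (y - x) -> A y].

HB.instance Definition _ := hasNbhs.Build T base_nbhs.

Let base_nbhs_filter (x : T) : ProperFilter (nbhs x).
Proof.
apply: Build_ProperFilter_ex.
  by move=> A [U BU UA]; exists x; apply: UA; rewrite subrr; exact: group_base0 BU.
split; first by case: (group_base_ex gB) => U BU; exists U.
- move=> P Q [U BU UP] [V BV VQ]; have [W BW WUV] := group_baseI gB BU BV.
  by exists W => // y /WUV[/UP ? /VQ].
- by move=> P Q PQ [U BU UP]; exists U => // y /UP /PQ.
Qed.

Let base_nbhs_singleton (x : T) (A : set T) : nbhs x A -> A x.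
Proof. by move=> [U BU UA]; apply: UA; rewrite subrr; exact: group_base0 BU. Qed.

Let base_nbhs_nbhs (x : T) (A : set T) : nbhs x A -> nbhs x (nbhs^~ A).
Proof.
move=> [U BU UA]; have [V BV VU] := group_base_sum gB 2 BU.
exists V => // y Vy; exists V => // z Vz; apply: UA.
have := VU [:: (z - y); (y - x)]; rewrite !big_cons big_nil addr0 addrA subrK.
apply=> // t; rewrite !inE => /orP[] /eqP ->; by left.
Qed.

HB.instance Definition _ := Nbhs_isNbhsTopological.Build T
  base_nbhs_filter base_nbhs_singleton base_nbhs_nbhs.

Definition base_top : Topological G := Topological.class T.

Lemma base_top_nbhs (x : G) (A : set G) :
  @nbhs _ (Topological.Pack base_top) x A <->
  exists2 U, B U & forall y, U (y - x) -> A y.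
Proof. by []. Qed.

Lemma base_top_group : group_topology base_top.
Proof.
split=> [[x y] A|x A] /base_top_nbhs/= [U BU UA].
  have [V BV VU] := group_base_sum gB 2 BU.
  exists ([set z : G | V (z - x)], [set z : G | V (z - y)]).
    by split=> /=; exists V.
  move=> [a b] /= [Va Vb]; apply: UA.
  have := VU [:: (a - x); (b - y)]; rewrite !big_cons big_nil addr0 addrACA -opprD.
  apply=> // t; rewrite !inE => /orP[] /eqP ->; by left.
have [V BV VU] := group_base_sum gB 1 BU.
exists V => // y Vy; apply: UA.
have := VU [:: (- y - - x)]; rewrite !big_cons big_nil addr0; apply=> // t.
by rewrite inE => /eqP ->; right; rewrite opprB opprK addrC.
Qed.

Lemma base_top_hausdorff :
  (forall x, (forall U, B U -> U x) -> x = 0) ->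
  hausdorff_space (Topological.Pack base_top).
Proof.
move=> B0 p q pq; apply/eqP; rewrite -subr_eq0; apply/eqP/B0 => U BU.
have [V BV VU] := group_baseB gB BU.
have [] := pq [set y : G | V (- (p - y))] [set y : G | V (- (q - y))].
- by exists V => // y /=; rewrite opprB.
- by exists V => // y /=; rewrite opprB.
by move=> z [/= Vp Vq]; have := VU _ _ Vq Vp; rewrite opprK opprB addrC addrA subrK.
Qed.

End base_topology.

Section topological_group.
Context (G : topologicalZmodType).
Implicit Types (x y : G) (U V : set G).

Lemma group_nbhsE x U : nbhs x U <-> nbhs (0 : G) [set y | U (x + y)].
Proof.
have add_cont (a b : G) : (fun z => a + z) @ b --> a + b.
  apply: (@continuous_comp _ _ _ (fun z => (a, z)) (fun z : G * G => z.1 + z.2)).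
    by apply: cvg_pair => /=; [exact: cvg_cst|exact: cvg_id].
  exact: add_continuous.
split=> [xU|U0]; first by have := add_cont x 0; rewrite addr0; apply.
have := add_cont (- x) x; rewrite addNr => /(_ _ U0) /=.
apply: (@filterS _ (nbhs x)) => y /=; by rewrite addrA subrr add0r.
Qed.

Lemma nbhs0_group_base : group_base (nbhs (0 : G)).
Proof.
split; first by exists setT; exact: filterT.
- by move=> U; exact: nbhs_singleton.
- by move=> U V U0 V0; exists (U `&` V); first exact: filterI.
move=> U U0; have subc : continuous (fun x : G * G => x.1 - x.2).
  move=> z; apply: (@continuous_comp _ _ _ (fun z : G * G => (z.1, - z.2))
    (fun z : G * G => z.1 + z.2)); last exact: add_continuous.
  apply: cvg_pair; first exact: cvg_fst.
  by apply: continuous_comp; [exact: cvg_snd|exact: opp_continuous].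
have := subc (0, 0) U; rewrite /= subrr => /(_ U0) [[P Q] /= [P0 Q0] PQ].
exists (P `&` Q); first exact: filterI.
by move=> x y [Px _] [_ Qy]; have := PQ (x, y); apply.
Qed.

End topological_group.

(** The working form of minimality: if some neighbourhood of zero contained no member of [B], the
    topology with base [B] would be Hausdorff and strictly coarser. *)
Lemma minimal_groupP (G : topologicalZmodType) (B : set_system G) :
  minimal_group G -> group_base B -> (forall U, B U -> nbhs (0 : G) U) ->
  (forall x, (forall U, B U -> U x) -> x = 0) ->
  forall U, nbhs (0 : G) U -> exists2 W, B W & W `<=` U.
Proof.
move=> [_ nex] gB Bn B0 U U0; apply: contrapT => nW; apply: nex.
exists (base_top gB); split; [exact: base_top_group|exact: base_top_hausdorff|].
have topE (A : set G) (x : G) : @nbhs _ (Topological.Pack (base_top gB)) x A -> nbhs x A.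
  move=> /base_top_nbhs[V BV VA]; apply/(group_nbhsE (x : G) A); apply: filterS (Bn _ BV) => y Vy /=.
  by apply: VA; rewrite addrC addKr.
split=> [A|].
  rewrite (@openE (Topological.Pack (base_top gB))) openE => oA x Ax.
  exact/topE/oA.
move=> sub; apply: nW; move: U0; rewrite nbhsE => -[A [oA A0] AU].
have := sub A oA; rewrite (@openE (Topological.Pack (base_top gB))).
move=> /(_ 0 A0) A0n; have [W BW WA] := (base_top_nbhs gB 0 A).1 A0n; exists W => // y Wy; apply/AU/WA.
by rewrite subr0.
Qed.

(** * Bohr sets and Følner's theorem *)

Section bogolyubov.
Context (R : realType) (F : finZmodType) (A : finType) (K : A -> F -> R) (a0 : A).
Hypothesis K0 : forall a, K a 0 = 1.
Hypothesis Ka0 : forall t, K a0 t = 1.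
Hypothesis KM : forall a s t, K a (s + t) + K a (s - t) = 2 * K a s * K a t.
Hypothesis K_le1 : forall a t, `|K a t| <= 1.
Hypothesis K_orth : forall t, t != 0 -> \sum_a K a t = 0.
Hypothesis cardA : #|A| = #|F|.
Context (H : F -> R).
Hypothesis H01 : forall u, 0 <= H u <= 1.

(** The squared modulus of the Fourier coefficient of [H] at [a], not normalised: [K a] is the real
    part of a character, [KM] its cosine functional equation, [a0] the trivial character. Real parts
    keep the argument in [R]. *)
Definition spectrum a := \sum_u \sum_v H u * H v * K a (u - v).

Hypothesis spectrum_ge0 : forall a, 0 <= spectrum a.

Let n : R := #|F|%:R.

Let H0 u : 0 <= H u. Proof. by case/andP: (H01 u). Qed.
Let H1 u : H u <= 1. Proof. by case/andP: (H01 u). Qed.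

Let sumK t : \sum_a K a t = if t == 0 then n else 0.
Proof.
have [->|/K_orth//] := eqVneq t 0.
by under eq_bigr do rewrite K0; rewrite sumr_const cardA.
Qed.

Let sum_spectrum : \sum_a spectrum a <= n ^+ 2.
Proof.
rewrite /spectrum exchange_big /=.
under eq_bigr => u _.
  rewrite exchange_big /=; under eq_bigr => v _ do rewrite -mulr_sumr sumK subr_eq0.
  rewrite (bigD1 u) //= eqxx big1 ?addr0; last first.
    by move=> v; rewrite eq_sym => /negbTE ->; rewrite mulr0.
  over.
rewrite -mulr_suml mulrC expr2; apply: ler_wpM2l; first exact: ler0n.
apply: (@le_trans _ _ (\sum_(u : F) 1)); last by rewrite sumr_const.
by apply: ler_sum => u _; have := H0 u; have := H1 u; nra.
Qed.

Let spectrum_a0 : spectrum a0 = (\sum_u H u) ^+ 2.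
Proof.
rewrite /spectrum expr2 mulr_suml; apply: eq_bigr => u _.
by rewrite mulr_sumr; apply: eq_bigr => v _; rewrite Ka0 mulr1.
Qed.

(** Linearises a product of three cosines so that orthogonality applies. *)
Let K3 a s t z : 4 * (K a s * K a t * K a z) =
  K a (s + t + z) + K a (s + t - z) + K a (s - t + z) + K a (s - t - z).
Proof.
rewrite (KM a (s + t) z) -addrA (KM a (s - t) z).
have := KM a s t => h.
rewrite -mulrDl -mulrDr h; ring.
Qed.

(** Expanding the squares leaves sums over [a] of products of three cosines. By [K3] and
    orthogonality such a sum is non-zero only under one of four signed relations between [u - v],
    [u' - v'] and [z], and each of them writes [z] in the required form. *)
Lemma fourfold_sum z : 0 < \sum_a spectrum a ^+ 2 * K a z ->
  exists u1 u2 u3 u4 : F, [/\ 0 < H u1, 0 < H u2, 0 < H u3, 0 < H u4 &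
    z = u1 + u2 - u3 - u4].
Proof.
move=> pos; apply: contrapT => nex.
suff : \sum_a spectrum a ^+ 2 * K a z = 0 by move=> e; rewrite e ltxx in pos.
have -> : \sum_a spectrum a ^+ 2 * K a z = \sum_u \sum_v \sum_u' \sum_v'
   H u * H v * (H u' * H v') * \sum_a (K a (u - v) * K a (u' - v') * K a z).
  transitivity (\sum_a \sum_u \sum_v \sum_u' \sum_v'
     H u * H v * (H u' * H v') * (K a (u - v) * K a (u' - v') * K a z)).
    apply: eq_bigr => a _; rewrite /spectrum expr2 !mulr_suml.
    apply: eq_bigr => u _; rewrite !mulr_suml; apply: eq_bigr => v _.
    rewrite mulr_sumr mulr_suml; apply: eq_bigr => u' _.
    rewrite mulr_sumr mulr_suml; apply: eq_bigr => v' _; ring.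
  rewrite exchange_big; apply: eq_bigr => u _ /=.
  rewrite exchange_big; apply: eq_bigr => v _ /=.
  rewrite exchange_big; apply: eq_bigr => u' _ /=.
  rewrite exchange_big; apply: eq_bigr => v' _ /=.
  by rewrite mulr_sumr.
rewrite big1// => u _; rewrite big1// => v _; rewrite big1// => u' _.
rewrite big1// => v' _.
have [->|Hu] := eqVneq (H u) 0; first by rewrite !mul0r.
have [->|Hv] := eqVneq (H v) 0; first by rewrite mulr0 !mul0r.
have [->|Hu'] := eqVneq (H u') 0; first by rewrite mul0r mulr0 mul0r.
have [->|Hv'] := eqVneq (H v') 0; first by rewrite !mulr0 mul0r.
have pu : 0 < H u by rewrite lt_neqAle eq_sym Hu H0.
have pv : 0 < H v by rewrite lt_neqAle eq_sym Hv H0.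
have pu' : 0 < H u' by rewrite lt_neqAle eq_sym Hu' H0.
have pv' : 0 < H v' by rewrite lt_neqAle eq_sym Hv' H0.
suff -> : \sum_a K a (u - v) * K a (u' - v') * K a z = 0 by rewrite mulr0.
apply: (@mulfI _ (4 : R)); first by rewrite pnatr_eq0.
rewrite mulr0 mulr_sumr; under eq_bigr do rewrite K3.
rewrite !big_split /= !sumK.
have nz a b c d : 0 < H a -> 0 < H b -> 0 < H c -> 0 < H d -> z != a + b - c - d.
  by move=> *; apply/eqP => e; apply: nex; exists a, b, c, d.
rewrite !ifF ?addr0//; apply/negbTE.
- apply: contraNneq (nz u v' v u' pu pv' pv pu') => e.
  by rewrite -[z]addr0 -e; apply/eqP; zmod.
- apply: contraNneq (nz v u' u v' pv pu' pu pv') => e.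
  by rewrite -[z]subr0 -e; apply/eqP; zmod.
- apply: contraNneq (nz u u' v v' pu pu' pv pv') => e.
  by rewrite -[z]addr0 -e; apply/eqP; zmod.
- apply: contraNneq (nz v v' u u' pv pv' pu pu') => e.
  by rewrite -[z]subr0 -e; apply/eqP; zmod.
Qed.

(** Taking the difference with a shift by [z] multiplies the Fourier coefficient at [a] by the
    character minus 1, whose squared modulus is [2 * (1 - K a z)]. *)
Lemma spectrum_shift a z : 2 * (spectrum a * (1 - K a z)) =
  \sum_u \sum_v (H (u + z) - H u) * (H (v + z) - H v) * K a (u - v).
Proof.
have shift (f : F -> R) : \sum_u f (u + z) = \sum_u f u.
  by rewrite [RHS](reindex_inj (addIr z)).
have e1 : \sum_u \sum_v H (u + z) * H (v + z) * K a (u - v) = spectrum a.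
  rewrite /spectrum -(shift (fun u => \sum_v H u * H v * K a (u - v))).
  apply: eq_bigr => u _; rewrite -(shift (fun v => H (u + z) * H v * K a (u + z - v))).
  by apply: eq_bigr => v _; congr (_ * K a _); zmod.
have e2 : \sum_u \sum_v (H (u + z) * H v * K a (u - v)) =
          \sum_u \sum_v (H u * H v * K a (u - v - z)).
  rewrite -[RHS](shift (fun u => \sum_v H u * H v * K a (u - v - z))).
  apply: eq_bigr => u _; apply: eq_bigr => v _.
  by congr (_ * K a _); zmod.
have e3 : \sum_u \sum_v (H u * H (v + z) * K a (u - v)) =
          \sum_u \sum_v (H u * H v * K a (u - v + z)).
  apply: eq_bigr => u _.
  rewrite -[RHS](shift (fun v => H u * H v * K a (u - v + z))).
  by apply: eq_bigr => v _; congr (_ * K a _); zmod.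
transitivity (spectrum a - \sum_u \sum_v (H u * H v * K a (u - v - z))
  - \sum_u \sum_v (H u * H v * K a (u - v + z)) + spectrum a).
  have -> : \sum_u \sum_v (H u * H v * K a (u - v - z)) =
    2 * K a z * spectrum a - \sum_u \sum_v (H u * H v * K a (u - v + z)).
    apply/eqP; rewrite eq_sym subr_eq; apply/eqP; rewrite -big_split /=.
    rewrite /spectrum mulr_sumr; apply: eq_bigr => u _.
    rewrite -big_split mulr_sumr /=; apply: eq_bigr => v _.
    by rewrite -mulrDr [K a _ + _]addrC KM; ring.
  ring.
rewrite -e3 -e2 -{1}e1 /spectrum -!sumrB -big_split /=; apply: eq_bigr => u _.
rewrite -!sumrB -big_split /=; apply: eq_bigr => v _; ring.
Qed.

Lemma spectrum_osc a z d : (forall u, `|H (u + z) - H u| <= d) ->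
  2 * (spectrum a * (1 - K a z)) <= n ^+ 2 * d ^+ 2.
Proof.
move=> Hd; have d0 : 0 <= d by apply: le_trans (Hd 0); exact: normr_ge0.
rewrite spectrum_shift; apply: (@le_trans _ _ (\sum_(u : F) \sum_(v : F) d ^+ 2)).
  apply: ler_sum => u _; apply: ler_sum => v _.
  apply: (le_trans (ler_norm _)); rewrite !normrM -[leRHS]mulr1 expr2.
  by apply: ler_pM => //; exact: ler_pM.
by rewrite !sumr_const -mulrnA -mulr_natl natrM expr2.
Qed.

(** [L] is the large spectrum of [H], bounded in size by Parseval. In the sum of [fourfold_sum] the
    trivial character contributes at least [(eta * n) ^+ 4], twice [tau * n ^+ 4], and the
    characters outside [L] at least the opposite of [tau * n ^+ 4]; this fixes [tau]. The last
    clause makes almost periods of [H] almost periods of the characters in [L]. *)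
Lemma bogolyubov (eta : R) : 0 < eta -> eta * n <= \sum_u H u ->
  let tau := eta ^+ 4 / 2 in
  exists L : {set A}, [/\ #|L|%:R * tau <= 1,
    (forall z, (forall a, a \in L -> 0 <= K a z) ->
       exists u1 u2 u3 u4 : F, [/\ 0 < H u1, 0 < H u2, 0 < H u3, 0 < H u4 &
         z = u1 + u2 - u3 - u4]) &
    (forall z d, (forall u, `|H (u + z) - H u| <= d) ->
       forall a, a \in L -> 2 * tau * (1 - K a z) <= d ^+ 2)].
Proof.
move=> eta0 etaH tau.
have n0 : 0 < n by rewrite ltr0n; apply/card_gt0P; exists 0.
have n20 : 0 < n ^+ 2 by rewrite exprn_gt0.
have tau0 : 0 < tau by rewrite divr_gt0// exprn_gt0.
exists [set a | tau * n ^+ 2 <= spectrum a]%SET; split.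
- rewrite -(ler_pM2r n20) mul1r -mulrA; apply: le_trans sum_spectrum.
  rewrite (bigID (fun a => tau * n ^+ 2 <= spectrum a)) /= -[leLHS]addr0.
  apply: lerD; last by apply: sumr_ge0 => a _; exact: spectrum_ge0.
  rewrite mulr_natl -(sumr_const (mem [set a | tau * n ^+ 2 <= spectrum a]%SET)).
  have -> : \sum_(i | tau * n ^+ 2 <= spectrum i) spectrum i =
    \sum_(i in [set a | tau * n ^+ 2 <= spectrum a]%SET) spectrum i.
    by apply: eq_bigl => a; rewrite inE.
  by apply: ler_sum => a; rewrite inE.
- move=> z Kz; apply: fourfold_sum.
  rewrite (bigID (mem [set a | tau * n ^+ 2 <= spectrum a]%SET)) /=.
  have a0L : a0 \in [set a | tau * n ^+ 2 <= spectrum a]%SET.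
    have etan : 0 <= eta * n by rewrite mulr_ge0 // ltW.
    have eta1 : eta <= 1.
      rewrite -(ler_pM2r n0) mul1r; apply: (le_trans etaH).
      by rewrite /n -sumr_const; apply: ler_sum.
    rewrite inE spectrum_a0.
    have h : (eta * n) ^+ 2 <= (\sum_u H u) ^+ 2 by rewrite ler_sqr ?nnegrE// ?sumr_ge0.
    apply: le_trans h; rewrite exprMn; apply: ler_wpM2r; first exact: ltW.
    rewrite /tau (_ : eta ^+ 4 = eta ^+ 2 * eta ^+ 2); last by ring.
    have : eta ^+ 2 <= 1 by rewrite expr_le1// ltW.
    have : 0 <= eta ^+ 2 by rewrite sqr_ge0.
    nra.
  have big : (eta * n) ^+ 4 <= \sum_(a in [set a | tau * n ^+ 2 <= spectrum a]%SET)
      spectrum a ^+ 2 * K a z.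
    rewrite (bigD1 a0)//= -[leLHS]addr0; apply: lerD.
      rewrite Ka0 mulr1 spectrum_a0 -exprM.
      by rewrite lerXn2r ?nnegrE// ?sumr_ge0// mulr_ge0// ltW.
    by apply: sumr_ge0 => a /andP[/Kz aL _]; rewrite mulr_ge0// sqr_ge0.
  have small : - (tau * n ^+ 2 * n ^+ 2) <= \sum_(a | a \notin
      [set a | tau * n ^+ 2 <= spectrum a]%SET) spectrum a ^+ 2 * K a z.
    apply: (@le_trans _ _ (\sum_(a | a \notin [set a | tau * n ^+ 2 <= spectrum a]%SET)
       - (tau * n ^+ 2 * spectrum a))).
      rewrite sumrN lerN2 -mulr_sumr; apply: ler_wpM2l; first by rewrite mulr_ge0 ?ltW.
      apply: le_trans sum_spectrum.
      rewrite [leRHS](bigID (mem [set a | tau * n ^+ 2 <= spectrum a]%SET)) /=.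
      by rewrite -[leLHS]add0r; apply: lerD => //; apply: sumr_ge0.
    apply: ler_sum => a; rewrite inE -ltNge => lt.
    have w0 := spectrum_ge0 a; have := K_le1 a z; rewrite ler_norml => /andP[k1 k2].
    have : spectrum a ^+ 2 <= tau * n ^+ 2 * spectrum a by rewrite expr2 ler_wpM2r// ltW.
    have : 0 <= spectrum a ^+ 2 by exact: sqr_ge0.
    nra.
  apply: (@lt_le_trans _ _ ((eta * n) ^+ 4 - tau * n ^+ 2 * n ^+ 2)); last exact: lerD.
  rewrite (_ : _ - _ = tau * (n ^+ 2 * n ^+ 2)).
    by apply: mulr_gt0 => //; exact: mulr_gt0.
  by rewrite /tau; lra.
- move=> z d Hd a; rewrite inE => aL.
  rewrite -(ler_pM2l n20); apply: le_trans (spectrum_osc a Hd).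
  have := K_le1 a z; rewrite ler_norml => /andP[k1 k2].
  have : 0 <= 1 - K a z by rewrite subr_ge0.
  nra.
Qed.

End bogolyubov.

(** * Cosine kernels on finite boxes *)

Definition near_int (R : realType) (e r : R) :=
  exists k : int, `|r - k%:~R| <= e.

Section cosine_turn.
Context (R : realType).
Implicit Types (r s : R).

Definition cost r := cos (pi *+ 2 * r).
Lemma costDz r (k : int) : cost (r + k%:~R) = cost r.
Proof.
have dn (n : nat) s : cost (s + n%:R) = cost s.
  elim: n => [|n IH]; first by rewrite addr0.
  by rewrite -natr1 addrA /cost mulrDr mulr1 cosD2pi -/(cost _) IH.
case: k => n; first exact: dn.
by rewrite NegzE mulrNz -[in RHS](subrK (n.+1%:R) r) dn.
Qed.

Lemma cost_near r : near_int (1 / 4) r -> 0 <= cost r.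
Proof.
case=> k; rewrite ler_norml => /andP[h1 h2].
rewrite -(subrK k%:~R r) costDz /cost; apply: cos_ge0_pihalf.
have p0 := pi_gt0 R; apply/andP; split; nra.
Qed.

Lemma costN r : cost (- r) = cost r.
Proof. by rewrite /cost mulrN cosN. Qed.

(** [1 / 20] is half of the [1 / 10] that suffices to recognise characters; the other half is lost
    in a limit. *)
Lemma cost_eq1_near : exists2 d : R, 0 < d &
  forall r, 1 - cost r <= d -> near_int (1 / 20) r.
Proof.
have p0 := pi_gt0 R.
have lt1 : cost (1 / 20 : R) < 1.
  rewrite -[X in _ < X](@cos0 R) /cost ltr_cos ?in_itv/= ?lexx ?ltW//; try (apply/andP; split); nra.
exists ((1 - cost (1 / 20)) / 2) => [|r rd]; first by lra.
pose k := Num.floor (r + 1 / 2); exists k.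
have := floor_itv (r + 1 / 2); rewrite -/k => /andP[k1 k2].
rewrite intrD in k2.
have h : `|r - k%:~R| <= 1 / 2 by rewrite ler_norml; lra.
rewrite leNgt; apply/negP => lt.
suff : cost r <= cost (1 / 20) by lra.
rewrite -(subrK k%:~R r) costDz.
have -> : cost (r - k%:~R) = cost `|r - k%:~R|.
  by case: ger0P => // _; rewrite costN.
by rewrite ltW// ltr_cos ?in_itv/=; try (apply/andP; split); nra.
Qed.

End cosine_turn.

Section cos_kernel.
Context (R : realType) (n p : nat).
Local Notation N := p.+1.
Local Notation F := 'rV['I_N]_n.
Implicit Types (a u v : F) (z : 'I_n -> int).

Definition zrep u (i : 'I_n) : int := (u 0 i)%:Z.

Definition zred z : F := \row_i inZp `|(z i %% N%:Z)%Z|.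

(** The pairing of the box with itself; modulo 1 it depends only on the residues of [z] modulo
    [N]. *)
Definition angle a z : R :=
  (\sum_i zrep a i * z i)%:~R / N%:R.

Definition ckernel a u : R := cost (angle a (zrep u)).

Lemma angle_cong a z z' :
  (forall i, (N%:Z %| z i - z' i)%Z) -> cost (angle a z) = cost (angle a z').
Proof.
move=> zz'; suff [k ->] : exists k : int, angle a z = angle a z' + k%:~R.
  by rewrite costDz.
have h i : exists k, z i - z' i = k * N%:Z by exact/dvdzP.
exists (\sum_i divz (zrep a i * (z i - z' i)) N%:Z).
have -> : (\sum_i divz (zrep a i * (z i - z' i)) N%:Z)%:~R =
   (\sum_i zrep a i * (z i - z' i))%:~R / N%:R :> R.
  rewrite !rmorph_sum /= mulr_suml; apply: eq_bigr => i _.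
  have [k ->] := h i; rewrite mulrA mulzK//.
  by rewrite [in RHS]rmorphM /= mulfK// pnatr_eq0.
rewrite /angle -mulrDl -rmorphD -big_split /=; congr (_%:~R / _).
by apply: eq_bigr => i _; ring.
Qed.

Lemma angleD a z z' : angle a (fun i => z i + z' i) = angle a z + angle a z'.
Proof.
rewrite /angle -mulrDl -rmorphD -big_split /=; congr (_%:~R / _).
by apply: eq_bigr => i _; ring.
Qed.

Lemma angleN a z : angle a (fun i => - z i) = - angle a z.
Proof.
rewrite /angle -mulNr -rmorphN -sumrN; congr (_%:~R / _).
by apply: eq_bigr => i _; ring.
Qed.

Lemma zrepD u v i : (N%:Z %| zrep (u + v) i - (zrep u i + zrep v i))%Z.
Proof.
rewrite /zrep mxE -PoszD -eqz_mod_dvd; apply/eqP.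
by rewrite !modz_nat modn_mod.
Qed.

Lemma zrep0 i : zrep 0 i = 0.
Proof. by rewrite /zrep mxE. Qed.

Lemma zrepB u v i : (N%:Z %| zrep (u - v) i - (zrep u i - zrep v i))%Z.
Proof.
have := zrepD (u - v) v i; rewrite subrK -rpredN => /=.
by congr (_ %| _)%Z; ring.
Qed.

Lemma zredK z i : (N%:Z %| zrep (zred z) i - z i)%Z.
Proof.
rewrite /zrep mxE -eqz_mod_dvd; apply/eqP.
by rewrite /= modz_nat modn_mod -modz_nat gez0_abs ?modz_ge0// modz_mod.
Qed.

Lemma ckernel0 a : ckernel a 0 = 1.
Proof.
rewrite /ckernel /angle big1 => [|i _]; last by rewrite zrep0 mulr0.
by rewrite mul0r /cost mulr0 cos0.
Qed.

Lemma ckernelC a u : ckernel a u = ckernel u a.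
Proof.
by rewrite /ckernel /angle; under eq_bigr do rewrite mulrC.
Qed.

Lemma ckernelB a u v : ckernel a (u - v) = cost (angle a (zrep u) - angle a (zrep v)).
Proof.
rewrite -angleN -angleD; apply: angle_cong => i; exact: zrepB.
Qed.

Lemma ckernelD a u v : ckernel a (u + v) = cost (angle a (zrep u) + angle a (zrep v)).
Proof. by rewrite -angleD; apply: angle_cong => i; exact: zrepD. Qed.

Lemma ckernel_red a z : ckernel a (zred z) = cost (angle a z).
Proof. by apply: angle_cong => i; exact: zredK. Qed.

Lemma ckernelM a u v :
  ckernel a (u + v) + ckernel a (u - v) = 2 * ckernel a u * ckernel a v.
Proof.
rewrite ckernelD ckernelB /ckernel /cost mulrDr mulrBr cosD cosB; ring.
Qed.

Lemma ckernel_le1 a u : `|ckernel a u| <= 1.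
Proof. exact: cos_max. Qed.

(** Summing the functional equation over all shifts by a unit vector [e] on which [u] is non-trivial
    shows that the sum is equal to itself times [ckernel u e], which is less than 1. *)
Lemma ckernel_orth u : u != 0 -> \sum_a ckernel a u = 0.
Proof.
move=> /eqP u0; have [i ui] : exists i, u 0 i != 0.
  apply: contrapT => h; apply: u0; apply/rowP => i; rewrite mxE.
  by apply/eqP; apply: contrapT => /negP ui; apply: h; exists i.
pose e := zred (fun j => (j == i)%:Z).
have Ke : ckernel u e < 1.
  rewrite /e ckernel_red /angle (bigD1 i)//= eqxx mulr1 big1 ?addr0; last first.
    by move=> j /negbTE ->; rewrite mulr0.
  have p0 := pi_gt0 R; have t0 : 0 < (zrep u i)%:~R / N%:R :> R.
    apply: divr_gt0; last by rewrite ltr0n.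
    by rewrite ltr0z /zrep ltz_nat lt0n.
  have t1 : (zrep u i)%:~R / N%:R < 1 :> R.
    by rewrite ltr_pdivrMr ?ltr0n// mul1r /zrep -pmulrn ltr_nat.
  set t := (zrep u i)%:~R / N%:R in t0 t1 *.
  have lt1 r : 0 < r -> r <= 1 / 2 -> cost r < 1 :> R.
    move=> r0 r1; rewrite -[X in _ < X](@cos0 R) /cost.
    have h1 : 0 < pi * r by rewrite mulr_gt0.
    have h2 : 0 <= pi * (1 / 2 - r) by rewrite mulr_ge0 ?subr_ge0// ltW.
    have i1 : 0 \in `[0, pi : R] by rewrite in_itv/= lexx ltW.
    have i2 : pi *+ 2 * r \in `[0, pi] by rewrite in_itv/=; apply/andP; split; lra.
    by rewrite ltr_cos//; lra.
  have [h|h] := leP t (1 / 2); first exact: lt1.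
  by rewrite -costN -(costDz _ 1); apply: lt1; lra.
have := erefl (\sum_a (ckernel u (a + e) + ckernel u (a - e))).
rewrite {1}big_split /=.
have -> : \sum_a ckernel u (a + e) = \sum_a ckernel u a.
  by rewrite [RHS](reindex_inj (addIr e)).
have -> : \sum_a ckernel u (a - e) = \sum_a ckernel u a.
  by rewrite [RHS](reindex_inj (addIr (- e))).
under [X in _ = X]eq_bigr => a _ do rewrite ckernelM.
rewrite -mulr_suml -mulr_sumr => h.
have -> : \sum_a ckernel a u = \sum_a ckernel u a.
  by apply: eq_bigr => a _; rewrite ckernelC.
have /eqP : (1 - ckernel u e) * \sum_a ckernel u a = 0.
  by move: h; set S := \sum_a _; set k := ckernel u e => h; lra.
by rewrite mulf_eq0 subr_eq0 gt_eqF//= => /eqP.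
Qed.

Lemma ckernel_spectrum_ge0 (H : F -> R) a : 0 <= spectrum ckernel H a.
Proof.
pose x u := pi *+ 2 * angle a (zrep u).
have -> : spectrum ckernel H a = (\sum_u H u * cos (x u)) ^+ 2 +
    (\sum_u H u * sin (x u)) ^+ 2.
  rewrite /spectrum !expr2 !mulr_suml -big_split /=; apply: eq_bigr => u _.
  rewrite !mulr_sumr -big_split /=; apply: eq_bigr => v _.
  by rewrite ckernelB /cost mulrBr cosB -/(x u) -/(x v); ring.
by rewrite addr_ge0// sqr_ge0.
Qed.

Lemma bogolyubov_box (H : F -> R) (eta : R) : (forall u, 0 <= H u <= 1) ->
  0 < eta -> eta * #|{: F}|%:R <= \sum_u H u ->
  let tau := eta ^+ 4 / 2 in
  exists L : {set F}, [/\ #|L|%:R * tau <= 1,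
    (forall u, (forall a, a \in L -> 0 <= ckernel a u) ->
       exists u1 u2 u3 u4, [/\ 0 < H u1, 0 < H u2, 0 < H u3, 0 < H u4 &
         u = u1 + u2 - u3 - u4]) &
    (forall u d, (forall v, `|H (v + u) - H v| <= d) ->
       forall a, a \in L -> 2 * tau * (1 - ckernel a u) <= d ^+ 2)].
Proof.
move=> H01 eta0 etaH; apply: (bogolyubov (a0 := 0)) => //.
- exact: ckernel0.
- by move=> u; rewrite ckernelC ckernel0.
- exact: ckernelM.
- exact: ckernel_le1.
- exact: ckernel_orth.
- exact: ckernel_spectrum_ge0.
Qed.

End cos_kernel.

(** * Følner's theorem on a free abelian group *)

(** Words are unreduced elements of the free abelian group on [I]; this is the homomorphism
    extending [g]. The same words are evaluated in [G] and, by characters, in [R]. *)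
Definition weval (I : Type) (G : zmodType) (g : I -> G) (z : seq (int * I)) : G :=
  \sum_(c <- z) g c.2 *~ c.1.

Lemma le_of_eq (R : realType) (x y : R) : x = y -> x <= y.
Proof. by move=> ->. Qed.

Section layers.
Context (R : realType) (G : zmodType) (W : nat -> set G) (V : set G) (M : nat).
Hypothesis V0 : V 0.
Hypothesis VN : forall x, V x -> V (- x).
Hypothesis WV : forall j x v, W j x -> V v -> W j.+1 (x + v).
Hypothesis M0 : (0 < M)%N.

(** A Lipschitz substitute for an indicator: 1 on [W 0], zero off [W M], and changed by at most
    [1 / M] under a shift by [V]. *)
Definition layer (x : G) : R := (\sum_(j < M) (x \in W j))%:R / M%:R.

Lemma layer_mono j k x : (j <= k)%N -> W j x -> W k x.
Proof.
elim: k => [|k IH]; first by rewrite leqn0 => /eqP ->.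
rewrite leq_eqVlt => /predU1P[->//|jk Wx].
by rewrite -[x]addr0; apply: WV => //; exact: IH.
Qed.

Lemma layer_ge0 x : 0 <= layer x.
Proof. by rewrite divr_ge0. Qed.

Lemma layer_le1 x : layer x <= 1.
Proof.
rewrite ler_pdivrMr ?ltr0n// mul1r ler_nat -[leqRHS]card_ord -sum1_card.
by apply: leq_sum => i _; case: (_ \in _).
Qed.

Lemma layer1 x : W 0 x -> layer x = 1.
Proof.
move=> Wx; rewrite /layer; under eq_bigr => j _.
  rewrite mem_set; last exact: layer_mono Wx.
  over.
by rewrite sum_nat_const card_ord muln1 divff// pnatr_eq0 -lt0n.
Qed.

Lemma layer_gt0 x : 0 < layer x -> W M x.
Proof.
move=> h; apply: contrapT => nW; move: h; rewrite /layer big1 ?mul0r ?ltxx//.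
move=> j _; rewrite memNset// => Wj; apply: nW; apply: layer_mono Wj.
exact/ltnW/ltn_ord.
Qed.

Lemma layer_shift x v : V v -> layer x - M%:R^-1 <= layer (x + v).
Proof.
move=> Vv.
have key : (\sum_(j < M) (x \in W j) <= (\sum_(j < M) ((x + v)%R \in W j)).+1)%N.
  case: M M0 => // m _; rewrite big_ord_recr big_ord_recl /= -addn1.
  apply: leq_add; last by case: (_ \in _).
  apply: leq_trans (leq_addl _ _); apply: leq_sum => i _.
  case: (boolP (x \in W i)) => //; rewrite inE => Wx.
  by rewrite mem_set//; exact: WV.
rewrite lerBlDr /layer -[X in _ <= _ + X]mul1r -mulrDl.
by rewrite ler_pM2r ?invr_gt0 ?ltr0n// natr1 ler_nat.
Qed.

Lemma layer_osc x v : V v -> `|layer (x + v) - layer x| <= M%:R^-1.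
Proof.
move=> Vv; rewrite ler_norml; have h1 := layer_shift x Vv.
have := layer_shift (x + v) (VN Vv); rewrite addrK => h2.
by apply/andP; split; lra.
Qed.

End layers.

Section folner_finite.
Context (R : realType) (I : eqType) (G : zmodType) (g : I -> G).
Context (W : nat -> set G) (V : set G) (M : nat) (f : seq (seq (int * I))).
Context (d0 : R).
Hypothesis V0 : V 0.
Hypothesis VN : forall x, V x -> V (- x).
Hypothesis WV : forall j x v, W j x -> V v -> W j.+1 (x + v).
Hypothesis covW : forall z, exists2 c, c \in f & W 0 (weval g z - weval g c).
Hypothesis recV : forall (s : seq I) (b : nat), exists2 N, (0 < N)%N &
  forall w : I -> int, (forall i, (`|w i| <= b)%N) ->
    V (\sum_(i <- s) g i *~ (w i * N%:Z)).
Hypothesis d0P : forall r, 1 - cost r <= d0 -> near_int (1 / 20) r.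
Hypothesis M2 : (1 < M)%N.
Hypothesis Mf : 64 * (size f)%:R ^+ 4 <= d0 * M%:R ^+ 2.

Definition wbound (z : seq (int * I)) : nat := \sum_(c <- z) `|c.1|%N.

Section box.
Context (s : seq I) (s_uniq : uniq s).
Local Notation n := (size s).
Local Notation gen i := (tnth (in_tuple s) i).

Definition wvec (z : seq (int * I)) (i : 'I_n) : int :=
  \sum_(c <- z | c.2 == gen i) c.1.

Definition vecval (q : 'I_n -> int) : G := \sum_i g (gen i) *~ q i.

Lemma wvec_bound z i : (`|wvec z i| <= wbound z)%N.
Proof.
rewrite /wvec /wbound; elim: z => [|c z IH]; first by rewrite !big_nil.
rewrite !big_cons; case: ifP => _; last exact: leq_trans IH (leq_addl _ _).
apply: leq_trans (leq_add (leqnn _) IH); move: (\sum_(_ <- z | _) _) => t.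
by lia.
Qed.

Lemma wevalE (H : zmodType) (h : I -> H) z : (forall c, c \in z -> c.2 \in s) ->
  weval h z = \sum_i h (gen i) *~ wvec z i.
Proof.
elim: z => [|c z IH] cs.
  by rewrite /weval big_nil big1// => i _; rewrite /wvec big_nil mulr0z.
rewrite /weval big_cons -/(weval h z) IH; last first.
  by move=> c' c'z; apply: cs; rewrite inE c'z orbT.
have /(tnthP (in_tuple s))[i ci] : c.2 \in s by apply: cs; rewrite mem_head.
rewrite [RHS](bigD1 i)//= (bigD1 i)//= addrA; congr (_ + _).
  by rewrite /wvec big_cons ci eqxx mulrzDr.
apply: eq_bigr => j ji; rewrite /wvec big_cons ci ifN//.
by apply: contra ji => /eqP e; apply/eqP/val_inj/esym; apply/eqP;
  rewrite -(nth_uniq c.2 _ _ s_uniq) ?ltn_ord//; apply/eqP;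
  move: e; rewrite !(tnth_nth c.2).
Qed.

Lemma vecvalD q r : vecval (fun i => q i + r i) = vecval q + vecval r.
Proof. by rewrite /vecval -big_split; apply: eq_bigr => i _; rewrite mulrzDr. Qed.

Lemma vecvalB q r : vecval (fun i => q i - r i) = vecval q - vecval r.
Proof. by rewrite /vecval -sumrB; apply: eq_bigr => i _; rewrite mulrzBr. Qed.

(** The side [p.+1] is a common near-period of the generators, so that carries in the box only cost
    an element of [V]. The bound has room for four representatives and one word. *)
Lemma recV_box b : exists2 p, True & forall t : 'I_n -> int,
  (forall i, (p.+1%:Z %| t i)%Z) -> (forall i, (`|t i| <= 4 * p.+1 + b)%N) ->
  V (vecval t).
Proof.
have [[//|p] _ recp] := recV s (b + 4); exists p => // t tN tb.
pose q i := divz (t i) p.+1%:Z.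
have tE i : t i = q i * p.+1%:Z by rewrite /q divzK.
pose w (i : I) := if insub (index i s) is Some j then q j else 0.
have wE (j : 'I_n) : w (gen j) = q j.
  have idx : index (gen j) s = j.
    by rewrite (tnth_nth (gen j)) index_uniq.
  rewrite /w; case: insubP => [k _ /= kE|]; last by rewrite idx ltn_ord.
  by congr q; apply: val_inj; rewrite /= kE idx.
have := recp w; rewrite big_tnth; under eq_bigr do rewrite wE -tE; apply=> i.
rewrite /w; case: insubP => // j _ _; have := tb j; rewrite tE abszM /= => h.
have : (`|q j| * p.+1 <= (b + 4) * p.+1)%N by nia.
by rewrite leq_pmul2r.
Qed.

End box.

(** Bogolyubov's argument for [layer], carried to a box with one coordinate per letter of [X] and
    [f]. The number of characters is [1 / tau] for [eta = 1 / (2 k)] and [k = size f]; it does not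
    depend on [X], which permits a limit over [X]. *)
Lemma folner_finite (X : seq (seq (int * I))) :
  exists th : 'I_(32 * (size f) ^ 4) -> I -> R, [/\
    forall j i, 0 <= th j i <= 1,
    forall z, z \in X -> (forall j, near_int (1 / 4) (weval (th j) z)) ->
      exists x1 x2 x3 x4 v, [/\ W M x1, W M x2, W M x3, W M x4 & V v /\
        weval g z = x1 + x2 - x3 - x4 + v] &
    forall z, z \in X -> V (weval g z) -> forall j, near_int (1 / 20) (weval (th j) z)].
Proof.
pose s := undup [seq c.2 | c <- flatten (X ++ f)].
have s_uniq : uniq s by exact: undup_uniq.
have Xs z : z \in X ++ f -> forall c, c \in z -> c.2 \in s.
  move=> zX c cz; rewrite mem_undup; apply/mapP; exists c => //.
  by apply/flattenP; exists z.
pose b := (\sum_(z <- X ++ f) wbound z)%N.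
have zb z i : z \in X ++ f -> (`|wvec (s := s) z i| <= b)%N.
  move=> zX; apply: (leq_trans (wvec_bound s_uniq z i)).
  by rewrite /b (big_rem z)//= leq_addr.
have [p _ pV] := recV_box s_uniq b.
pose P := vecval (s := s).
pose h := layer R W M.
pose H (u : 'rV['I_p.+1]_(size s)) : R := h (P (zrep u)).
have M0 : (0 < M)%N by exact: ltnW.
have H01 u : 0 <= H u <= 1 by rewrite layer_ge0 layer_le1.
have repb (u : 'rV['I_p.+1]_(size s)) i : 0 <= zrep u i < p.+1%:Z.
  by rewrite /zrep /= ltz_nat ltn_ord.
have Mi : (M%:R^-1 : R) <= 1 / 2.
  by rewrite div1r lef_pV2 ?posrE ?ltr0n// ler_nat.
have k0 : (0 < size f)%N.
  by have [c + _] := covW [::]; case: f.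
have HW c u : c \in f -> W 0 (P (zrep u) - weval g c) ->
    1 / 2 <= H (u - zred _ (wvec (s := s) c)).
  move=> cf Wc; rewrite /H.
  pose t i := zrep (u - zred p (wvec c)) i - (zrep u i - wvec (s := s) c i).
  have cX : c \in X ++ f by rewrite mem_cat cf orbT.
  have Vt : V (P t).
    apply: pV => i; rewrite /t.
      have := rpredB (zrepB u (zred p (wvec c)) i) (zredK p (wvec c) i) => /=.
      by congr (_ %| _)%Z; ring.
    have := repb (u - zred p (wvec c)) i; have := repb u i; have := zb c i cX.
    by lia.
  have -> : P (zrep (u - zred p (wvec c))) = P (zrep u) - weval g c + P t.
    rewrite (wevalE s_uniq g (Xs _ cX)) -/(P _) -vecvalB -vecvalD.
    by apply: eq_bigr => i _; congr (_ *~ _); rewrite /t; ring.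
  have := layer_shift R WV M0 (P (zrep u) - weval g c) Vt.
  by rewrite (layer1 R V0 WV M0 Wc) -/h; lra.
(* Each [u] has a translate by one of the [size f] centres at which [H] is at least [1 - 1 / M],
   hence [1 / 2]; averaging over the centres gives this density. *)
pose eta : R := 1 / (2 * (size f)%:R).
have k0R : 0 < (size f)%:R :> R by rewrite ltr0n.
have eta0 : 0 < eta by rewrite divr_gt0// mulr_gt0.
have etaH : eta * #|{: 'rV['I_p.+1]_(size s)}|%:R <= \sum_u H u.
  have : #|{: 'rV['I_p.+1]_(size s)}|%:R / 2 <= \sum_(c <- f) \sum_u H (u - zred _ (wvec (s := s) c)).
    rewrite exchange_big /= -mulr_natl mulr1 -sumr_const mulr_suml /=.
    apply: ler_sum => u _.
    pose zu := [seq (zrep u i, tnth (in_tuple s) i) | i <- enum 'I_(size s)].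
    have zuE : weval g zu = P (zrep u) by rewrite /weval big_map big_enum.
    have [c cf Wc] := covW zu; rewrite zuE in Wc.
    rewrite (big_rem c)//=; apply: (le_trans (HW c u cf Wc)).
    rewrite lerDl; apply: sumr_ge0 => c' _; by case/andP: (H01 (u - zred p (wvec c'))).
  have shiftH c : \sum_u H (u - c) = \sum_u H u.
    by rewrite [RHS](reindex_inj (addIr (- c))).
  under eq_bigr do rewrite shiftH.
  rewrite big_const_seq count_predT iter_addr_0 -mulr_natr => le.
  by rewrite /eta mulrAC ler_pdivrMr ?mulr_gt0//; lra.
have [L [Lc L4 Losc]] := bogolyubov_box H01 eta0 etaH.
set tau := eta ^+ 4 / 2 in Lc Losc.
have tauE : tau = 1 / (32 * (size f)%:R ^+ 4).
  by rewrite /tau /eta; field; rewrite pnatr_eq0 -lt0n k0.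
have Lm : (#|L| <= 32 * (size f) ^ 4)%N.
  rewrite -(ler_nat R) natrM natrX; move: Lc; rewrite tauE mulrA mulr1.
  by rewrite ler_pdivrMr ?mul1r// mulr_gt0// exprn_gt0.
(* Indices beyond the size of [L] give the zero vector, that is, the trivial character. *)
pose a (j : 'I_(32 * (size f) ^ 4)) := nth 0 (enum L) j.
pose th (j : 'I_(32 * (size f) ^ 4)) (i : I) : R :=
  if insub (index i s) is Some k then (zrep (a j) k)%:~R / p.+1%:R else 0.
have thE j z : z \in X -> weval (th j) z = angle R (a j) (wvec (s := s) z).
  move=> zX; rewrite (wevalE s_uniq (th j) (Xs _ _)) ?mem_cat ?zX//.
  rewrite /angle rmorph_sum /= mulr_suml; apply: eq_bigr => i _.
  rewrite /th; case: insubP => [k _ /= kE|]; last first.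
    by rewrite index_mem mem_tnth.
  have -> : k = i.
    by apply: val_inj; rewrite /= kE (tnth_nth (tnth (in_tuple s) i)) index_uniq.
  by rewrite -mulrzl rmorphM /=; ring.
exists th; split.
- move=> j i; rewrite /th; case: insub => [k|]; last by rewrite lexx ler01.
  have /andP[r0 r1] := repb (a j) k.
  rewrite divr_ge0 ?ler0n ?ler0z//= ler_pdivrMr ?ltr0n// mul1r pmulrn ler_int.
  exact: ltW.
- move=> z zX znear.
  have zXf : z \in X ++ f by rewrite mem_cat zX.
  have [|u1 [u2 [u3 [u4 [h1 h2 h3 h4 zE]]]]] := L4 (zred p (wvec (s := s) z)).
    move=> a' a'L; rewrite ckernel_red; apply: cost_near.
    have jlt : (index a' (enum L) < 32 * size f ^ 4)%N.
      by apply: leq_trans Lm; rewrite cardE index_mem mem_enum.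
    have := znear (Ordinal jlt); rewrite thE// /a /= nth_index// mem_enum//.
  pose t i := wvec (s := s) z i - (zrep u1 i + zrep u2 i - zrep u3 i - zrep u4 i).
  exists (P (zrep u1)), (P (zrep u2)), (P (zrep u3)), (P (zrep u4)), (P t).
  split; [exact: (layer_gt0 V0 WV h1)|exact: (layer_gt0 V0 WV h2)|
     exact: (layer_gt0 V0 WV h3)|exact: (layer_gt0 V0 WV h4)|split].
    apply: pV => i.
      have := zredK p (wvec (s := s) z) i; rewrite zE.
      have := zrepB (u1 + u2 - u3) u4 i; have := zrepB (u1 + u2) u3 i.
      have := zrepD u1 u2 i; rewrite /t => d1 d2 d3 d4.
      have := rpredD (rpredD d1 d2) (rpredB d3 d4) => /=.
      by congr (_ %| _)%Z; ring.
    have := zb z i zXf; have := repb u1 i; have := repb u2 i.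
    by have := repb u3 i; have := repb u4 i; rewrite /t; lia.
  rewrite (wevalE s_uniq g (Xs _ zXf)) /P -vecvalD -!vecvalB -vecvalD.
  by apply: eq_bigr => i _; congr (_ *~ _); rewrite /t; ring.
- move=> z zX Vz j; rewrite thE//.
  have zXf : z \in X ++ f by rewrite mem_cat zX.
  have [jL|jL] := leqP #|L| j.
    rewrite /a nth_default -?cardE// /angle big1 => [|i _]; last by rewrite zrep0 mul0r.
    by exists 0; rewrite mul0r subrr normr0.
  have aL : a j \in L by rewrite -mem_enum mem_nth// -cardE.
  apply: d0P; rewrite -ckernel_red.
  (* Two shifts by [V], one by the value of the word and one by the carry, give [2 / M]; [Mf] turns
     the resulting bound into [d0]. *)
  have : 2 * tau * (1 - ckernel R (a j) (zred p (wvec (s := s) z))) <= (2 / M%:R) ^+ 2.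
    apply: Losc => // u; rewrite /H.
    pose t i := zrep (u + zred p (wvec (s := s) z)) i - (zrep u i + wvec z i).
    have -> : P (zrep (u + zred p (wvec z))) = P (zrep u) + weval g z + P t.
      rewrite (wevalE s_uniq g (Xs _ zXf)) -/(P _) -!vecvalD.
      by apply: eq_bigr => i _; congr (_ *~ _); rewrite /t; ring.
    have Vt : V (P t).
      apply: pV => i; rewrite /t.
        have := rpredD (zrepD u (zred p (wvec z)) i) (zredK p (wvec z) i) => /=.
        by congr (_ %| _)%Z; ring.
      have := repb (u + zred p (wvec z)) i; have := repb u i; have := zb z i zXf.
      by lia.
    have h1 := layer_osc R VN WV M0 (P (zrep u) + weval g z) Vt.
    have h2 := layer_osc R VN WV M0 (P (zrep u)) Vz.
    rewrite (_ : 2 / M%:R = M%:R^-1 + M%:R^-1); last by ring.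
    apply: le_trans (lerD h1 h2); rewrite -/h.
    apply: le_trans (ler_normD _ _); apply: le_of_eq; congr (`|_|); ring.
  set K := 1 - ckernel _ _ _; rewrite tauE exprMn exprVn => le.
  have M20 : 0 < (M%:R : R) ^+ 2 by rewrite exprn_gt0// ltr0n.
  rewrite -(ler_pM2r M20); apply: le_trans Mf.
  have k40 : 0 < (size f)%:R ^+ 4 :> R by rewrite exprn_gt0.
  have -> : K * M%:R ^+ 2 = 2 * (1 / (32 * (size f)%:R ^+ 4)) * K *
      (16 * (size f)%:R ^+ 4 * M%:R ^+ 2).
    by field; rewrite pnatr_eq0 -lt0n.
  apply: le_trans (ler_wpM2r _ le) _; first by rewrite !mulr_ge0// ltW.
  by apply: le_of_eq; field; rewrite pnatr_eq0 -lt0n.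
Qed.

End folner_finite.

Lemma near_int_trans (R : realType) (e e' r s : R) :
  near_int e r -> `|s - r| <= e' -> near_int (e + e') s.
Proof.
move=> [k rk] sr; exists k; rewrite -(subrK r s) addrAC -addrA addrC.
by apply: le_trans (ler_normD _ _) _; apply: lerD => //; rewrite addrC.
Qed.

Lemma ultra_bounded_cvg (R : realType) (T : Type) (F : set_system T) (u : T -> R) :
  UltraFilter F -> (forall t, 0 <= u t <= 1) ->
  exists l : R, forall e, 0 < e -> F [set t | `|u t - l| <= e].
Proof.
move=> FU u01.
have PF : ProperFilter (u @ F) by exact: fmap_proper_filter.
have [|l [_ lcl]] := @segment_compact R 0 1 (u @ F) PF.
  by apply: (filterE (F := F)) => t; have := u01 t; rewrite /= in_itv.
exists l => e e0; have [//|FC] := in_ultra_setVsetC [set t | `|u t - l| <= e] FU.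
have h1 : (u @ F) [set x : R | ~ (`|x - l| <= e)] by exact: FC.
have h2 : nbhs (l : R) (ball (l : R) e) by exact: nbhsx_ballx.
have [x [xC xb]] := lcl _ _ h1 h2.
by exfalso; apply: xC; rewrite /= distrC; apply: ltW; exact: xb.
Qed.

(* A syndetic set is a Bohr neighbourhood up to four-fold sums; the characters
   are produced on the free group over [I], where no relation has to hold. *)
Theorem folner (R : realType) (I : eqType) (G : zmodType) (g : I -> G)
    (W : nat -> set G) (V : set G) (M : nat) (f : seq (seq (int * I))) (d0 : R) :
  V 0 -> (forall x, V x -> V (- x)) ->
  (forall j x v, W j x -> V v -> W j.+1 (x + v)) ->
  (forall z, exists2 c, c \in f & W 0 (weval g z - weval g c)) ->
  (forall (s : seq I) (b : nat), exists2 N, (0 < N)%N &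
     forall w : I -> int, (forall i, (`|w i| <= b)%N) ->
       V (\sum_(i <- s) g i *~ (w i * N%:Z))) ->
  (forall r, 1 - cost r <= d0 -> near_int (1 / 20) r) ->
  (1 < M)%N -> 64 * (size f)%:R ^+ 4 <= d0 * M%:R ^+ 2 ->
  exists m (th : 'I_m -> I -> R),
    (forall z, (forall j, near_int (1 / 8) (weval (th j) z)) ->
      exists x1 x2 x3 x4 v, [/\ W M x1, W M x2, W M x3, W M x4 & V v /\
        weval g z = x1 + x2 - x3 - x4 + v]) /\
    (forall z, V (weval g z) -> forall j, near_int (1 / 10) (weval (th j) z)).
Proof.
move=> V0 VN WV covW recV d0P M2 Mf.
have /choice[th thP] := folner_finite V0 VN WV covW recV d0P M2 Mf.
(* Finite lists of words directed by inclusion: along an ultrafilter finer than [F0] every word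
   eventually belongs to [X], and the bounded values [th X j i] converge. *)
pose F0 : set_system (seq (seq (int * I))) :=
  [set A | exists Z : seq (seq (int * I)), forall X : seq (seq (int * I)),
     {subset Z <= X} -> A X].
have F0F : ProperFilter F0.
  apply: Build_ProperFilter_ex; first by move=> A [Z ZA]; exists Z; exact: ZA.
  split; first by exists [::].
  - move=> A B [Z ZA] [Y YB]; exists (Z ++ Y) => X ZX; split.
      by apply: ZA => z zZ; apply: ZX; rewrite mem_cat zZ.
    by apply: YB => z zZ; apply: ZX; rewrite mem_cat zZ orbT.
  - by move=> A B AB [Z ZA]; exists Z => X /ZA /AB.
have [F [FU F0F']] := ultraFilterLemma F0F.
have FP : ProperFilter F by exact: ultra_proper.
have FF : Filter F by exact: filter_filter.
have Fin (z : seq (int * I)) : F [set X : seq (seq (int * I)) | z \in X].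
  by apply: F0F'; exists [:: z] => X; apply; rewrite mem_head.
have lims (ji : 'I_(32 * size f ^ 4) * I) : exists l : R,
    forall e, 0 < e -> F [set X | `|th X ji.1 ji.2 - l| <= e].
  by apply: ultra_bounded_cvg => X; case: (thP X).
have [t tP] := choice lims.
exists (32 * size f ^ 4)%N, (fun j i => t (j, i)).
have cvgw j z e : 0 < e ->
    F [set X | `|weval (th X j) z - weval (fun i => t (j, i)) z| <= e].
  elim: z e => [|c z IH] e e0.
    by apply: filterE => X /=; rewrite /weval !big_nil subrr normr0 ltW.
  have c0 : 0 < (`|c.1|%N.+1)%:R :> R by rewrite ltr0n.
  have e2 : 0 < e / 2 by rewrite divr_gt0.
  have hF := @filterI _ F FF _ _ (IH _ e2) (tP (j, c.2) _ (divr_gt0 e2 c0)).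
  apply: (@filterS _ F FF _ _ _ hF) => X /= [h1 h2]; rewrite /weval !big_cons.
  rewrite opprD addrACA -mulrzBl -/(weval (th X j) z) -/(weval (fun i => t (j, i)) z).
  apply: le_trans (ler_normD _ _) _; rewrite [leRHS](splitr e); apply: lerD => //.
  rewrite -mulrzr normrM -intr_norm -abszE.
  apply: (@le_trans _ _ (e / 2 / (`|c.1|%N.+1)%:R * (`|c.1|%N.+1)%:R)).
    by apply: ler_pM => //; rewrite -pmulrn ler_nat.
  by rewrite divfK// gt_eqF.
split=> [z zn|z Vz j].
  (* The limit costs [1 / 8] of the available [1 / 4] here, and [1 / 20] in the second clause, which
     ends with [1 / 10]. *)
  pose A (j : 'I_(32 * size f ^ 4)) :=
    [set X | `|weval (th X j) z - weval (fun i => t (j, i)) z| <= 1 / 8].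
  have FA : F [set X | forall j, A j X] by apply: filter_forall => j; exact: cvgw.
  have [X [XA Xz]] := filter_ex (filterI FA (Fin z)).
  have [_ X1 _] := thP X; apply: X1 => // j.
  have := near_int_trans (zn j) (XA j); congr (near_int _ _); lra.
have e20 : 0 < 1 / 20 :> R by [].
have [X [XA Xz]] := filter_ex (filterI (cvgw j z _ e20) (Fin z)).
have [_ _ X2] := thP X; have := near_int_trans (X2 z Xz Vz j).
move=> /(_ (1 / 20) (weval (fun i => t (j, i)) z)); rewrite distrC => /(_ XA).
congr (near_int _ _); lra.
Qed.

(** * Characters of precompact groups *)

Section near_int_theory.
Context (R : realType).
Implicit Types (r e : R).

Lemma near_int_le e e' r : e <= e' -> near_int e r -> near_int e' r.
Proof. by move=> ee' [k rk]; exists k; exact: le_trans ee'. Qed.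

Lemma near_intD r e (s : R) : s \is a Num.int -> near_int e r -> near_int e (r + s).
Proof.
move=> /intrP[m ->] [k rk]; exists (k + m); rewrite intrD opprD addrACA subrr addr0//.
Qed.

Lemma near_int_int r e : 0 <= e -> r \is a Num.int -> near_int e r.
Proof. by move=> e0 /intrP[k ->]; exists k; rewrite subrr normr0. Qed.

Lemma near_int_cong e r s : r - s \is a Num.int -> near_int e s -> near_int e r.
Proof. by move=> rs /(near_intD rs); rewrite addrC subrK. Qed.

(** The remainder [r - k] cannot wrap around: if its [j]-th multiple is at most [1 / 10], the
    integer near the next multiple of [r] differs from the expected one by at most [3 / 10], hence
    not at all. *)
Lemma near_int_multiples r (n : nat) : (0 < n)%N ->
  (forall j, (j <= n)%N -> near_int (1 / 10) (r *+ j)) -> near_int (1 / (10 * n%:R)) r.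
Proof.
move=> n0 H; have [k rk] := H 1%N n0; exists k; rewrite mulr1n in rk.
have key j : (j <= n)%N -> `|(r - k%:~R) *+ j| <= 1 / 10.
  elim: j => [_|j IH jn]; first by rewrite mulr0n normr0; lra.
  have {IH} := IH (ltnW jn); rewrite (mulrS (r - k%:~R)); set s := (r - _) *+ j => IH.
  have [m rm] := H _ jn.
  have sE : r - k%:~R + s = r *+ j.+1 - (k *+ j.+1)%:~R.
    by rewrite /s -mulrS mulrnBl rmorphMn.
  have : `|(m - k *+ j.+1)%:~R : R| <= 3 / 10.
    rewrite rmorphB /= (_ : m%:~R - _ = (r - k%:~R + s) - (r *+ j.+1 - m%:~R)); last first.
      by rewrite sE; ring.
    apply: le_trans (ler_normB _ _) _.
    apply: le_trans (lerD (le_trans (ler_normD _ _) (lerD rk IH)) rm) _; lra.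
  have [e|/eqP ne] := eqVneq (m - k *+ j.+1) 0.
    move=> _; rewrite sE; suff -> : k *+ j.+1 = m by [].
    by apply/esym/eqP; rewrite -subr_eq0 e.
  move=> lt; suff : 1 <= `|(m - k *+ j.+1)%:~R : R| by lra.
  by rewrite -intr_norm -[1]/(1%:~R) ler_int; move: ne; lia.
have := key n (leqnn n); rewrite normrMn -mulr_natl => h.
by rewrite ler_pdivlMr ?mulr_gt0 ?ltr0n//; lra.
Qed.

(** The circle has no non-trivial subgroup inside the arc of radius [1 / 10]. *)
Lemma near_int_all r : (forall j : nat, near_int (1 / 10) (r *+ j)) ->
  r \is a Num.int.
Proof.
move=> H; have Hn n : near_int (1 / (10 * n.+1%:R)) r.
  by apply: near_int_multiples => // j _; exact: H.
apply/intrP; exists (Num.floor (r + 1 / 2)); set k := Num.floor _.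
have := floor_itv (r + 1 / 2); rewrite -/k intrD => /andP[k1 k2].
apply/eqP; rewrite -subr_eq0 -normr_le0 leNgt; apply/negP => pos.
pose n := Num.truncn (`|r - k%:~R|^-1).
have nP : `|r - k%:~R|^-1 < n.+1%:R by exact: truncnS_gt.
have [m rm] := Hn n.
have n0 : 0 < n.+1%:R :> R by rewrite ltr0n.
have n1 : 1 <= n.+1%:R :> R by rewrite ler1n.
have rm' : `|r - m%:~R| * (10 * n.+1%:R) <= 1.
  by rewrite -ler_pdivlMr// mulr_gt0.
have lt1 : 1 < n.+1%:R * `|r - k%:~R| by rewrite -ltr_pdivrMr// div1r.
have rm10 : `|r - m%:~R| <= 1 / 10.
  have := normr_ge0 (r - m%:~R); nra.
have mk : m = k.
  have : `|(m - k)%:~R : R| < 1.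
    rewrite rmorphB /= (_ : m%:~R - k%:~R = (r - k%:~R) - (r - m%:~R)); last by ring.
    rewrite ltr_norml; move: rm10; rewrite ler_norml => /andP[]; lra.
  by rewrite -intr_norm -[1]/(1%:~R) ltr_int; lia.
rewrite mk in rm'; have := normr_ge0 (r - k%:~R); nra.
Qed.

End near_int_theory.

Lemma finite_coloringP (A : finType) (P : nat -> A -> Prop) :
  (forall q, (q <= #|A|)%N -> exists a, P q a) ->
  exists q q' a, [/\ (q < q')%N, (q' <= #|A|)%N, P q a & P q' a].
Proof.
move=> H; have /choice[f fP] : forall q : 'I_#|A|.+1, exists a, P q a.
  by move=> q; apply: H; rewrite -ltnS.
apply: contrapT => nex.
have /leq_card : injective f.
  move=> q q' e; have [lt|lt|/ord_inj//] := ltngtP q q'; exfalso; apply: nex.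
    by exists q, q', (f q); split => //; [rewrite -ltnS|rewrite e].
  by exists q', q, (f q); split => //; [rewrite -ltnS|rewrite e].
by rewrite card_ord ltnn.
Qed.

Lemma finite_coloring (A : finType) (col : nat -> A) :
  exists q q', (q < q')%N /\ col q = col q'.
Proof.
have [q|q [q' [a [qq' _ <- e]]]] := @finite_coloringP A (fun q a => col q = a).
  by exists (col q).
by exists q, q'.
Qed.

(** Pigeonhole on [q]: record, for each letter, a translate containing the multiple of its generator
    by [c * q]; two equal records give [N = c * (q' - q)]. It suffices that some multiple of [G] is
    covered, so that the lemma can be used before precompactness is known. *)
Lemma recurrence (I : eqType) (G : zmodType) (B : set_system G) (g : I -> G) :
  group_base B ->
  (forall U, B U -> exists2 c, (0 < c)%N & finitely_covered [set x *+ c | x in setT] U) ->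
  forall U, B U -> forall (s : seq I) (b : nat), exists2 N, (0 < N)%N &
    forall w : I -> int, (forall i, (`|w i| <= b)%N) ->
      U (\sum_(i <- s) g i *~ (w i * N%:Z)).
Proof.
move=> gB HA U BU s b.
have [V1 BV1 V1U] := group_base_sum gB (size s) BU.
have [V2 BV2 V2V1] := group_baseMz gB b BV1.
have [V3 BV3 V3V2] := group_baseB gB BV2.
have [c c0 [t tP]] := HA _ BV3.
have /choice[cf cfP] : forall x : G, exists j : 'I_(size t), V3 (x *+ c - t`_j).
  move=> x; have [|f ft Vf] := tP (x *+ c); first by exists x.
  move: (ft); rewrite -index_mem => lt; exists (Ordinal lt); by rewrite nth_index.
pose col (q : nat) : {ffun 'I_(size s) -> 'I_(size t)} :=
  [ffun i => cf (g (tnth (in_tuple s) i) *+ q)].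
have [q [q' [qq' colE]]] := finite_coloring col.
exists (c * (q' - q))%N; first by rewrite muln_gt0 c0 subn_gt0.
move=> w wb.
have Vi i : i \in s -> V2 (g i *+ (c * (q' - q))).
  move=> /(tnthP (in_tuple s))[j ->].
  move/ffunP: colE => /(_ j); rewrite !ffunE => e.
  have := V3V2 _ _ (cfP (g (tnth (in_tuple s) j) *+ q')) (cfP (g (tnth (in_tuple s) j) *+ q)).
  rewrite e; congr V2; rewrite mulnC mulrnA mulrnBr ?(ltnW qq')// mulrnBl; zmod.
have := V1U [seq g i *~ (w i * (c * (q' - q))%N%:Z) | i <- s]; rewrite big_map; apply.
  by rewrite size_map.
move=> x /mapP[i si ->]; left; rewrite mulrC mulrzA -pmulrn.
by apply: V2V1 => //; exact: Vi.
Qed.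

Section characters.
Context (R : realType).

(** A homomorphism to [R / Z], given by an arbitrary real lift. *)
Definition pre_character (G : zmodType) (chi : G -> R) :=
  forall x y, chi (x + y) - (chi x + chi y) \is a Num.int.

Lemma exists_layer_number (k : nat) (d0 : R) : 0 < d0 ->
  exists2 M, (1 < M)%N & 64 * k%:R ^+ 4 <= d0 * M%:R ^+ 2.
Proof.
move=> d00; pose x := 64 * k%:R ^+ 4 / d0.
have x0 : 0 <= x by rewrite divr_ge0 ?mulr_ge0 ?exprn_ge0// ltW.
exists (Num.truncn x).+2 => //.
have h : x <= (Num.truncn x).+2%:R.
  apply/ltW/(lt_le_trans (truncnS_gt x)); by rewrite ler_nat.
have h1 : 1 <= (Num.truncn x).+2%:R :> R by rewrite ler1n.
rewrite -ler_pdivrMl// mulrC -/x; nra.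
Qed.

Section pre_character_theory.
Context (G : zmodType) (chi : G -> R) (chiP : pre_character chi).

Lemma pre_character0 : chi 0 \is a Num.int.
Proof.
by have := chiP 0 0; rewrite addr0 -rpredN opprB addrK.
Qed.

Lemma pre_characterN x : chi (- x) + chi x \is a Num.int.
Proof.
have := rpredB pre_character0 (chiP (- x) x).
by rewrite addNr opprB addrCA subrr addr0.
Qed.

Lemma pre_characterB x y : chi (x - y) - (chi x - chi y) \is a Num.int.
Proof.
have := rpredD (chiP x (- y)) (pre_characterN y).
by congr (_ \is a Num.int); ring.
Qed.

Lemma pre_characterMn x n : chi (x *+ n) - chi x *+ n \is a Num.int.
Proof.
elim: n => [|n IH]; first by rewrite !mulr0n subr0 pre_character0.
have := rpredD (chiP x (x *+ n)) IH; rewrite !mulrS.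
by congr (_ \is a Num.int); ring.
Qed.

Lemma pre_characterMz x z : chi (x *~ z) - chi x *~ z \is a Num.int.
Proof.
case: z => n; first exact: pre_characterMn.
rewrite NegzE !mulrNz -!pmulrn.
have := rpredB (pre_characterN (x *+ n.+1)) (pre_characterMn x n.+1).
by congr (_ \is a Num.int); ring.
Qed.

End pre_character_theory.

Definition continuous_at0 (G : zmodType) (B : set_system G) (chi : G -> R) :=
  forall e, 0 < e -> exists2 V, B V & forall v, V v -> near_int e (chi v).

(** Multiples up to [n] of a smaller neighbourhood stay in [V], and [near_int_multiples] then gains
    the factor [n]. *)
Lemma pre_character_continuous (G : zmodType) (B : set_system G) (chi : G -> R) V :
  group_base B -> pre_character chi -> B V ->
  (forall v, V v -> near_int (1 / 10) (chi v)) -> continuous_at0 B chi.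
Proof.
move=> gB chiP BV VP e e0.
pose n := (Num.truncn e^-1).+1.
have [V' BV' V'V] := group_baseMz gB n BV; exists V' => // v Vv.
have n0 : 0 < n%:R :> R by rewrite ltr0n.
have nP : e^-1 < n%:R by exact: truncnS_gt.
apply: (@near_int_le _ (1 / (10 * n%:R))).
  rewrite ler_pdivrMr ?mulr_gt0//; have : 1 < n%:R * e by rewrite -ltr_pdivrMr// div1r.
  lra.
apply: near_int_multiples => // j jn.
apply: near_int_cong (VP _ (V'V v j%:Z jn Vv)); rewrite -rpredN opprB.
exact: pre_characterMn.
Qed.

(** [folner] modulo [N]: an element of [W j] is one of [U1], plus at most [j] signed terms of [V1],
    plus one of [N]. Each of the four elements of [W M] yields two terms of [U1], and the error a
    ninth, up to sign. *)
Lemma folner_base (I : eqType) (G : zmodType) (B : set_system G) (g : I -> G)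
    (N U U1 : set G) (f : seq (seq (int * I))) :
  group_base B ->
  (forall U, B U -> exists2 c, (0 < c)%N & finitely_covered [set x *+ c | x in setT] U) ->
  subgroup N -> B U1 ->
  (forall s : seq G, (size s <= 9)%N -> (forall x, x \in s -> U1 x \/ U1 (- x)) ->
     U (\sum_(x <- s) x)) ->
  (forall z, exists2 c, c \in f & U1 (weval g z - weval g c)) ->
  exists m (th : 'I_m -> I -> R) V1, [/\ B V1,
    forall z, (forall j, near_int (1 / 8) (weval (th j) z)) ->
      exists2 n, N n & U (weval g z - n) &
    forall z n v, N n -> V1 v -> weval g z = v + n ->
      forall j, near_int (1 / 10) (weval (th j) z)].
Proof.
move=> gB HA sN BU1 U1U fP.
have [d0 d00 d0P] := cost_eq1_near R.
have [M M2 Mf] := exists_layer_number (size f) d00.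
have [V1 BV1 V1U] := group_base_sum gB M BU1.
pose sgn (A : set G) x := A x \/ A (- x).
pose W j x := exists n t u, [/\ N n, U1 u, (size t <= j)%N,
   (forall y, y \in t -> sgn V1 y) & x = u + \sum_(y <- t) y + n].
pose V x := exists n v, [/\ N n, sgn V1 v & x = v + n].
have N0 : N 0 by case: sN.
have V10 := group_base0 gB BV1.
have V0 : V 0 by exists 0, 0; split => //; [left|rewrite addr0].
have VN x : V x -> V (- x).
  move=> [n [v [Nn Vv ->]]]; exists (- n), (- v); split; last by rewrite opprD.
    exact: subgroupN.
  by case: Vv; [right; rewrite opprK|left].
have WV j x v : W j x -> V v -> W j.+1 (x + v).
  move=> [n [t [u [Nn Uu tj tV ->]]]] [n' [v' [Nn' Vv' ->]]].
  exists (n + n'), (v' :: t), u; split => //; first exact: subgroupD.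
    by move=> y; rewrite inE => /predU1P[->|/tV].
  rewrite big_cons; move: (\sum_(y <- t) y) => S; zmod.
have covW z : exists2 c, c \in f & W 0 (weval g z - weval g c).
  have [c cs Uc] := fP z; exists c => //.
  by exists 0, [::], (weval g z - weval g c); split => //; rewrite big_nil !addr0.
have recV : forall (r : seq I) (b : nat), exists2 K, (0 < K)%N &
    forall w : I -> int, (forall i, (`|w i| <= b)%N) ->
      V (\sum_(i <- r) g i *~ (w i * K%:Z)).
  move=> r b; have [K K0 KP] := recurrence g gB HA BV1 r b.
  exists K => // w /KP ?; exists 0, (\sum_(i <- r) g i *~ (w i * K%:Z)); split => //.
    by left.
  by rewrite addr0.
have [m [th [th1 th2]]] := folner V0 VN WV covW recV d0P M2 Mf.
exists m, th, V1; split => // [z zn|z n v Nn Vv zE]; last first.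
  by apply: th2; exists n, v; split => //; left.
have [x1 [x2 [x3 [x4 [v [w1 w2 w3 w4 [vV ->]]]]]]] := th1 z zn.
have WE y : W M y -> exists n u u', [/\ N n, U1 u, U1 u' & y = u + u' + n].
  move=> [n [t [u [Nn Uu tM tV ->]]]]; exists n, u, (\sum_(z <- t) z); split => //.
  exact: V1U.
have [n1 [a1 [b1 [N1 A1 B1 ->]]]] := WE _ w1.
have [n2 [a2 [b2 [N2 A2 B2 ->]]]] := WE _ w2.
have [n3 [a3 [b3 [N3 A3 B3 ->]]]] := WE _ w3.
have [n4 [a4 [b4 [N4 A4 B4 ->]]]] := WE _ w4.
have [n5 [v' [N5 Vv' ->]]] := vV.
exists (n1 + n2 - n3 - n4 + n5).
  case: (sN) => _ NB; apply: (subgroupD sN) => //.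
  by apply: (NB) => //; apply: (NB) => //; exact: (subgroupD sN).
have Uv' : sgn U1 v'.
  have V1U1 y : V1 y -> U1 y.
    move=> Vy; have := V1U [:: y]; rewrite big_seq1; apply; first exact: ltnW.
    by move=> y'; rewrite inE => /eqP ->; left.
  by case: Vv' => /V1U1; [left|right].
have := U1U [:: a1; b1; a2; b2; - a3; - b3; - a4; - b4; v'] isT.
rewrite !big_cons big_nil (_ : a1 + _ = a1 + b1 + n1 + (a2 + b2 + n2) -
  (a3 + b3 + n3) - (a4 + b4 + n4) + (v' + n5) - (n1 + n2 - n3 - n4 + n5)); last by zmod.
apply=> y; rewrite !inE.
by repeat (case/orP => [/eqP ->|]); [left|left|left|left|right|right|right|right|
  move/eqP => ->] => //; rewrite opprK.
Qed.

(* For compact groups this is the theorem of Peter and Weyl for the quotient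
   by [N]; no topology on that quotient is needed. *)
Theorem characters_exist (G : zmodType) (B : set_system G) (N U : set G) :
  group_base B -> (forall U, B U -> finitely_covered setT U) -> subgroup N -> B U ->
  exists m (chi : 'I_m -> G -> R), [/\ forall j, pre_character (chi j),
    forall j, continuous_at0 B (chi j),
    forall j x, N x -> chi j x \is a Num.int &
    forall x, (forall j, near_int (1 / 8) (chi j x)) ->
      exists2 n, N n & U (x - n)].
Proof.
move=> gB pB sN BU.
have [U1 BU1 U1U] := group_base_sum gB 9 BU.
have [s sP] := pB _ BU1.
have HA A : B A -> exists2 c, (0 < c)%N & finitely_covered [set x *+ c | x in setT] A.
  by move=> BA; exists 1%N => //; have [l lP] := pB A BA; exists l => y _; exact: lP.
have oneid x : weval id [:: (1%:Z, x)] = x :> G by rewrite /weval big_seq1.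
have covU z : exists2 c, c \in [seq [:: (1%:Z, c)] | c <- s] &
    U1 (weval id z - weval id c).
  have [c cs Uc] := sP (weval id z) I.
  exists [:: (1%:Z, c)]; first by apply/mapP; exists c.
  by rewrite oneid.
have [m [th [V1 [BV1 th1 th2]]]] := folner_base gB HA sN BU1 U1U covU.
have N0 : N 0 by case: sN.
have V10 := group_base0 gB BV1.
(* The characters live on words. On a word of value zero all multiples are near integers, so the
   value is an integer and [th j] descends to [G] modulo 1. *)
have wker j z : weval id z = 0 -> weval (th j) z \is a Num.int.
  move=> z0; apply: near_int_all => k.
  have wk (H : zmodType) (h : G -> H) :
      weval h [seq (c.1 *+ k, c.2) | c <- z] = weval h z *+ k.
    rewrite /weval big_map -sumrMnl; apply: eq_bigr => c _ /=.
    by zmod.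
  by rewrite -wk; apply: (th2 _ 0 0) => //; rewrite wk z0 mul0rn addr0.
have chiP j : pre_character (th j).
  move=> x y; have := wker j [:: (1%:Z, x + y); (-1, x); (-1, y)].
  rewrite /weval !big_cons !big_nil /= !mulrN1z !mulr1z !addr0 opprD; apply.
  by rewrite -opprD subrr.
have one j x : weval (th j) [:: (1%:Z, x)] = th j x by rewrite /weval big_seq1.
exists m, th; split => //.
- move=> j; apply: (pre_character_continuous gB (chiP j) BV1) => v Vv.
  by rewrite -one; apply: (th2 _ 0 v) => //; rewrite oneid addr0.
- move=> j x Nx; apply: near_int_all => k.
  have : near_int (1 / 10) (th j (x *+ k)).
    rewrite -one; apply: (th2 _ (x *+ k) 0) => //; first exact: subgroupMn.
    by rewrite oneid add0r.
  by apply: near_int_cong; rewrite -rpredN opprB; exact: pre_characterMn.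
- move=> x xn; have := th1 [:: (1%:Z, x)]; rewrite oneid; apply=> j.
  by rewrite one.
Qed.

End characters.

(** * Precompactness of minimal groups *)

Lemma prefix_choice (T : Type) (P : seq T -> T -> Prop) :
  (forall s, exists x, P s x) -> exists e : nat -> T, forall k, P (mkseq e k) (e k).
Proof.
move=> /choice[nx nxP].
pose es := fix es k := if k is k'.+1 then rcons (es k') (nx (es k')) else [::].
pose e k := nx (es k); have esE k : es k = mkseq e k.
  by elim: k => // k IH; rewrite mkseqS -IH.
by exists e => k; rewrite -esE; exact: nxP.
Qed.

(** If the differences of [S n] do not cover, some infinite sequence has all its pairwise
    differences outside them. By pigeonhole, any translate of a long enough piece of it leaves the
    chosen translates of [S n]; the remaining sets therefore cover, with more centres. *)
Lemma finite_union_syndetic (G : zmodType) n (S : nat -> set G) (F : nat -> seq G) :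
  (forall x, exists i, (i < n)%N /\ exists2 f, f \in F i & S i (x - f)) ->
  exists2 i, (i < n)%N &
    finitely_covered setT [set d | exists x y, [/\ S i x, S i y & d = x - y]].
Proof.
elim: n F => [|n IH] F cov; first by have [i []] := cov 0.
pose D := [set d | exists x y, [/\ S n x, S n y & d = x - y]].
have [cD|ncD] := pselect (finitely_covered setT D); first by exists n.
have ex (s : seq G) : exists x, forall f, f \in s -> ~ D (x - f).
  apply: contrapT => nex; apply: ncD; exists s => x _.
  apply: contrapT => nf; apply: nex; exists x => f fs Df; apply: nf; by exists f.
have [e eP] := prefix_choice ex.
have eD a b : (a < b)%N -> ~ D (e b - e a).
  by move=> ab; apply: eP; apply/mapP; exists a => //; rewrite mem_iota.
pose E := mkseq e (size (F n)).+1.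
have [|i lt h] := IH (fun i => [seq f - x | f <- F i, x <- E]); last first.
  by exists i => //; exact: ltnW.
move=> g; apply: contrapT => nex.
have [a an|q [q' [f [qq' _ Sq Sq']]]] :=
    @finite_coloringP 'I_(size (F n)) (fun a f => S n (g + e a - (F n)`_f)).
  rewrite card_ord in an; have [i [lt [f fF Sf]]] := cov (g + e a).
  have [e1|ne] := eqVneq i n.
    rewrite e1 in fF Sf; move: (fF); rewrite -index_mem => ltf.
    by exists (Ordinal ltf); rewrite nth_index.
  exfalso; apply: nex; exists i; split; first by rewrite ltn_neqAle ne -ltnS.
  exists (f - e a); last by have -> : g - (f - e a) = g + e a - f by zmod.
  apply/allpairsP; exists (f, e a); split => //=.
  by apply/mapP; exists a => //; rewrite mem_iota.
apply: (eD _ _ qq'); exists (g + e q' - (F n)`_f), (g + e q - (F n)`_f).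
by split => //; zmod.
Qed.

Definition thicken (G : zmodType) (U P : set G) : set G :=
  [set z | exists2 p, P p & U (z - p)].

(** If every [x] failed, finitely many translates of the sets [S i] would cover [G]; one [S i] would
    then have differences that cover, against [ncov]. *)
Lemma avoid_multiples (G : zmodType) n (c : nat -> nat) (P U U1 : nat -> set G) :
  (forall i, (i < n)%N -> subgroup (P i)) ->
  (forall i x1 x2 x3 x4, (i < n)%N -> U1 i x1 -> U1 i x2 -> U1 i x3 -> U1 i x4 ->
     U i (x1 - x2 - (x3 - x4))) ->
  (forall i, (i < n)%N ->
     ~ finitely_covered [set x *+ c i | x in setT] (thicken (U i) (P i))) ->
  forall F : seq G, exists x, forall i f, (i < n)%N -> f \in F ->
    ~ thicken (U1 i) (P i) (x *+ c i - f).
Proof.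
move=> sP U1U ncov F; apply: contrapT => nex.
pose S i := [set x | exists x1 x2 p, [/\ U1 i x1, U1 i x2, P i p & x *+ c i = x1 - x2 + p]].
(* A centre [f] need not be a multiple, so it is replaced by an element whose multiple is near [f],
   if there is one. *)
have /choice[r rP] : forall fi : G * nat, exists x, forall y,
    thicken (U1 fi.2) (P fi.2) (y *+ c fi.2 - fi.1) ->
    thicken (U1 fi.2) (P fi.2) (x *+ c fi.2 - fi.1).
  move=> [f i]; have [[x xP]|nx] :=
    pselect (exists x, thicken (U1 i) (P i) (x *+ c i - f)); first by exists x.
  by exists 0 => y yP; exfalso; apply: nx; exists y.
have [x|i lt [s sE]] := @finite_union_syndetic G n S (fun i => [seq r (f, i) | f <- F]).
  have [i [f [lt fF T]]] : exists i f, [/\ (i < n)%N, f \in F &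
      thicken (U1 i) (P i) (x *+ c i - f)].
    apply: contrapT => h; apply: nex; exists x => i f lt fF T; apply: h.
    by exists i, f.
  exists i; split => //; exists (r (f, i)); first by apply/mapP; exists f.
  have [p Pp Up] := T; have [p' Pp' Up'] := rP (f, i) x T.
  exists (x *+ c i - f - p), (r (f, i) *+ c i - f - p'), (p - p'); split => //.
    by case: (sP i lt) => _; apply.
  by rewrite mulrnBl; zmod.
apply: (ncov i lt); exists [seq f *+ c i | f <- s] => _ [x _ <-].
have [f fs [a [b [[a1 [a2 [p [A1 A2 Pp aE]]]] [b1 [b2 [p' [B1 B2 Pp' bE]]]] e]]]] := sE x I.
exists (f *+ c i); first by apply/mapP; exists f.
exists (p - p'); first by case: (sP i lt) => _; apply.
rewrite -mulrnBl e mulrnBl aE bE.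
have := U1U _ _ _ _ _ lt A1 A2 B1 B2; congr (U i _); zmod.
Qed.

(** * Integer combinations of a sequence *)

Section combinations.
Context (G : zmodType).
Implicit Types (e : nat -> G) (a b : {poly int}).

(** Integer polynomials serve as the free abelian group on [nat], with ['X^j] sent to [e j]. *)
Definition phi e a : G := \sum_(j < size a) e j *~ a`_j.

Lemma phiE e a n : (size a <= n)%N -> phi e a = \sum_(j < n) e j *~ a`_j.
Proof.
move=> an; rewrite -(subnKC an) big_split_ord /= [X in _ + X]big1 ?addr0// => j _.
by rewrite nth_default ?mulr0z// leq_addr.
Qed.

Lemma phiB e a b : phi e (a - b) = phi e a - phi e b.
Proof.
set n := maxn (size (a - b)) (maxn (size a) (size b)).
rewrite !(@phiE e _ n) ?leq_max ?leqnn ?orbT// -sumrB; apply: eq_bigr => j _.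
by rewrite coefB mulrzBr.
Qed.

Lemma phi0 e : phi e 0 = 0.
Proof. by have := phiB e 0 0; rewrite !subrr. Qed.

Lemma phiN e a : phi e (- a) = - phi e a.
Proof. by have := phiB e 0 a; rewrite phi0 !sub0r. Qed.

Lemma phiD e a b : phi e (a + b) = phi e a + phi e b.
Proof. by have := phiB e a (- b); rewrite opprK phiN opprK. Qed.

Lemma phiMn e a n : phi e (a *+ n) = phi e a *+ n.
Proof. by elim: n => [|n IH]; rewrite ?mulr0n ?phi0// !mulrS phiD IH. Qed.

Lemma phiXn e n : phi e 'X^n = e n.
Proof.
rewrite (@phiE e _ n.+1) ?size_polyXn// big_ord_recr /= coefXn eqxx mulr1z.
rewrite big1 ?add0r// => j _; by rewrite coefXn ltn_eqF ?mulr0z.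
Qed.

Lemma phi_weval e a : weval e [seq (a`_j, j) | j <- iota 0 (size a)] = phi e a.
Proof.
rewrite /weval big_map /phi -(big_mkord xpredT (fun j => e j *~ a`_j)).
by rewrite /index_iota subn0.
Qed.

Fixpoint box e (b k : nat) : seq G :=
  if k is k'.+1 then [seq f + e k' *~ c | f <- box e b k',
    c <- [seq i%:Z - b%:Z | i <- iota 0 (2 * b).+1]] else [:: 0].

Lemma mem_box e (b k : nat) (a : nat -> int) : (forall j, (j < k)%N -> (`|a j| <= b)%N) ->
  \sum_(j < k) e j *~ a j \in box e b k.
Proof.
elim: k => [|k IH] ab; first by rewrite big_ord0 inE.
have -> : \sum_(j < k.+1) e j *~ a j = \sum_(j < k) e j *~ a j + e k *~ a k.
  by rewrite big_ord_recr.
apply: (@allpairs_f _ _ _ (fun f c => f + e k *~ c)).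
  by apply: IH => j jk; apply: ab; exact: ltnW.
apply/mapP; exists (absz (a k + b%:Z)); last by have := ab k (ltnSn k); lia.
by rewrite mem_iota; have := ab k (ltnSn k); lia.
Qed.

Lemma eq_box e e' (b k : nat) : (forall j, (j < k)%N -> e j = e' j) -> box e b k = box e' b k.
Proof.
elim: k => //= k IH ee'; rewrite IH => [|j jk]; last by apply: ee'; exact: ltnW.
by rewrite ee'.
Qed.

End combinations.

Definition multiples (G : zmodType) (c : nat) : set G := [set x *+ c | x in setT].

Lemma multiples_subgroup (G : zmodType) c : subgroup (@multiples G c).
Proof.
split; first by exists 0 => //; rewrite mul0rn.
by move=> _ _ [x _ <-] [y _ <-]; exists (x - y) => //; rewrite mulrnBl.
Qed.

Lemma hausdorff_nbhs0 (G : topologicalZmodType) (x : G) : hausdorff_space G ->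
  (forall U, nbhs (0 : G) U -> U x) -> x = 0.
Proof.
move=> hG H; apply/esym/hG => A B A0 Bn; have Bx := (group_nbhsE x B).1 Bn.
exists x; split; first exact: H.
exact: nbhs_singleton Bn.
Qed.

(** Otherwise there is a sequence [e] such that small multiples of [e k] avoid, modulo [U1], all
    bounded combinations of earlier terms. The sets [V + B m] then form a coarser Hausdorff base,
    yet each contains [e (2 ^ m)], which is outside [U1]. *)
Lemma minimal_multiple_covered (G : topologicalZmodType) : minimal_group G ->
  forall U, nbhs (0 : G) U ->
  exists2 c, (0 < c)%N & finitely_covered (@multiples G c) U.
Proof.
move=> Gmin U U0; apply: contrapT => nc.
have gB := @nbhs0_group_base G.
have [U2 U20 U2U] := group_baseB gB U0.
have [U1 U10 U1U2] := group_baseB gB U20.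
pose P0 : set G := [set 0].
have P0s : subgroup P0 by split=> // _ _ -> ->; rewrite subr0.
(* The bound [2 * size s] anticipates differences of two combinations whose [j]-th coefficients are
   at most [j]. *)
have ex (s : seq G) : exists x, forall i f, (i < 2 * size s)%N ->
    f \in box (nth 0 s) (2 * size s) (size s) -> ~ U1 (x *+ i.+1 - f).
  have [i|i x1 x2 x3 x4 _ h1 h2 h3 h4|i _ [t tP]|x xP] := @avoid_multiples G (2 * size s)
    (fun i => i.+1) (fun=> P0) (fun=> U) (fun=> U1) _ _ _
    (box (nth 0 s) (2 * size s) (size s)) => //.
  - by apply: U2U; exact: U1U2.
  - apply: nc; exists i.+1 => //; exists t => y /tP[f ft [p -> Uf]].
    by exists f => //; rewrite subr0 in Uf.
  exists x => i f lt fb Uf; apply: (xP i f lt fb); exists 0 => //; by rewrite subr0.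
have [e eP] := prefix_choice ex.
pose B m : set G := [set y | exists a : {poly int},
   (forall j, (absz (a`_j)%R * 2 ^ m <= j)%N) /\ y = phi e a].
have [V V0 VU1] := group_base_sum gB 2 U10.
(* Otherwise the leading term is a multiple of [e k], by at most [2 * k], that meets a bounded
   combination of earlier terms modulo [U1]. Two signs are assumed because only positive multiples
   of [e k] were avoided. *)
have uniqB (a : {poly int}) : (forall j, (absz (a`_j)%R <= 2 * j)%N) ->
    U1 (phi e a) -> U1 (- phi e a) -> a = 0.
  move=> ab Ua UNa; apply/eqP; rewrite -lead_coef_eq0; apply: contrapT => /negP lc.
  have a0 : a != 0 by rewrite -lead_coef_eq0.
  pose k := (size a).-1.
  have ka : size a = k.+1 by rewrite /k prednK// lt0n size_poly_eq0.
  have ck : lead_coef a = a`_k by rewrite /lead_coef.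
  have ak := ab k; rewrite -ck in ak.
  have lc0 : (0 < `|lead_coef a|)%N by rewrite absz_gt0.
  have kk : (`|lead_coef a|.-1 < 2 * k)%N by lia.
  have bx (s : int) : (`|s| <= 1)%N -> \sum_(j < k) e j *~ (a`_j * s) \in
      box (nth 0 (mkseq e k)) (2 * size (mkseq e k)) (size (mkseq e k)).
    move=> s1; rewrite size_mkseq (@eq_box _ _ e); last by move=> j jk; rewrite nth_mkseq.
    apply: (@mem_box _ e _ k (fun j => a`_j * s)) => j jk.
    by have := ab j; rewrite abszM; nia.
  have Pe : phi e a = \sum_(j < k) e j *~ a`_j + e k *~ lead_coef a.
    by rewrite (@phiE _ e a k.+1) ?ka// big_ord_recr /= ck.
  have sumN s : \sum_(j < k) e j *~ (a`_j * s) = (\sum_(j < k) e j *~ a`_j) *~ s.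
    by rewrite mulrz_suml; apply: eq_bigr => j _; rewrite mulrzA.
  have [lcp|lcn] := lerP 0 (lead_coef a).
    have := eP k _ _ _ (bx (-1) isT); rewrite size_mkseq => /(_ _ kk); apply.
    rewrite prednK// sumN mulrN1z opprK addrC.
    by rewrite pmulrn gez0_abs// -Pe.
  have := eP k _ _ _ (bx 1 isT); rewrite size_mkseq => /(_ _ kk); apply.
  rewrite prednK// sumN mulr1z pmulrn ltz0_abs// mulrNz -opprD addrC -Pe//.
pose Bs : set_system G := [set W | exists2 V, nbhs (0 : G) V &
  exists m, W = [set x | exists2 y, B m y & V (x - y)]].
have Bmono m m' y : (m <= m')%N -> B m' y -> B m y.
  move=> mm' [a [ab ->]]; exists a; split=> // j; apply: leq_trans (ab j).
  by rewrite leq_mul2l leq_exp2l// mm' orbT.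
have B0 m : B m 0 by exists 0; split; [move=> j; rewrite coef0|rewrite phi0].
have gBs : group_base Bs.
  split.
  - by exists [set x | exists2 y, B 0%N y & setT (x - y)], setT => //; [exact: filterT|exists 0%N].
  - move=> W [V' V'0 [m ->]]; exists 0 => //; rewrite subrr; exact: nbhs_singleton.
  - move=> _ _ [A A0 [m ->]] [A' A'0 [m' ->]].
    exists [set x | exists2 y, B (maxn m m') y & (A `&` A') (x - y)].
      by exists (A `&` A'); [exact: filterI|exists (maxn m m')].
    move=> x [y By [Ay A'y]]; split; exists y => //.
      by apply: Bmono By; rewrite leq_maxl.
    by apply: Bmono By; rewrite leq_maxr.
  - move=> _ [A A0 [m ->]]; have [A' A'0 A'A] := group_baseB gB A0.
    exists [set x | exists2 y, B m.+1 y & A' (x - y)]; first by exists A' => //; exists m.+1.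
    move=> x x' [y [a [ab ->]] Ay] [y' [a' [ab' ->]] Ay'].
    exists (phi e a - phi e a').
      exists (a - a'); rewrite phiB; split=> // j; rewrite coefB.
      have := ab j; have := ab' j; rewrite expnS.
      move: (2 ^ m)%N => q; move: (a`_j) (a'`_j) => u v h1 h2.
      have : (`|(u - v)%R| <= `|u| + `|v|)%N by lia.
      nia.
    by have := A'A _ _ Ay Ay'; congr A; zmod.
have [|x xP|W [V' V'0 [m ->]] WU] := minimal_groupP Gmin gBs _ _ (filterI U10 U10).
- move=> _ [A A0 [m ->]]; apply: filterS A0 => x Ax; exists 0 => //; by rewrite subr0.
- have sep (y : G) (a : {poly int}) (A : set G) m : nbhs (0 : G) A ->
      exists b : {poly int}, [/\ forall j, (absz (b`_j)%R * 2 ^ m <= j)%N & A (x - phi e b)].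
    move=> A0; have [|_ [b [bb ->]] Ab] := xP [set x | exists2 y, B m y & A (x - y)].
      by exists A => //; exists m.
    by exists b.
  apply: (hausdorff_nbhs0 (proj1 Gmin)) => A A0.
  have [a [ab [Va Aa]]] := sep 0 0 _ 0%N (filterI V0 A0).
  suff a0 : a = 0 by rewrite a0 phi0 subr0 in Aa.
  apply/polyP => j; rewrite coef0.
  have [b [bb Vb]] := sep 0 0 V j.+1 V0.
  have ab0 : a - b = 0.
    have sgn s : (forall y, y \in s -> V y \/ V (- y)) -> (size s <= 2)%N -> U1 (\sum_(y <- s) y).
      by move=> h1 h2; exact: VU1.
    apply: uniqB.
    - move=> i; rewrite coefB; have := ab i; have := bb i; rewrite expn0 muln1.
      move=> h1 h2; have : (absz (b`_i)%R <= i)%N.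
        by apply: leq_trans h1; rewrite leq_pmulr// expn_gt0.
      by move: (a`_i) (b`_i) h2 => u v; lia.
    - have := sgn [:: - (x - phi e a); x - phi e b]; rewrite !big_cons big_nil phiB.
      rewrite (_ : - (x - _) + _ = phi e a - phi e b); last by zmod.
      by apply=> // y; rewrite !inE => /orP[] /eqP ->; [right; rewrite opprK|left].
    - have := sgn [:: (x - phi e a); - (x - phi e b)]; rewrite !big_cons big_nil phiB.
      rewrite (_ : (x - _) + _ = - (phi e a - phi e b)); last by zmod.
      by apply=> // y; rewrite !inE => /orP[] /eqP ->; [left|right; rewrite opprK].
  have : (a - b)`_j = 0 by rewrite ab0 coef0.
  rewrite coefB; have : b`_j = 0; last by move=> ->; rewrite subr0.
  apply/eqP; rewrite -absz_eq0 -leqn0 leqNgt; apply/negP => bj.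
  have := bb j; have : (j < 2 ^ j.+1)%N by apply: (@ltn_trans (2 ^ j)); [exact: ltn_expl|rewrite ltn_exp2l].
  nia.
(* By construction, with multiplier 1 and the zero combination, [e (2 ^ m)] is not in [U1]. *)
have := eP (2 ^ m)%N 0%N 0; apply.
- by rewrite size_mkseq muln_gt0 expn_gt0.
- have := @mem_box _ (nth 0 (mkseq e (2 ^ m))) (2 * size (mkseq e (2 ^ m))) (size (mkseq e (2 ^ m))) (fun=> 0).
  by rewrite big1 => [|j _]; [apply|rewrite mulr0z].
- rewrite mulr1n subr0; apply: (proj1 (WU (e (2 ^ m)%N) _)).
  exists (e (2 ^ m)%N); last by rewrite subrr; exact: nbhs_singleton.
  exists 'X^(2 ^ m); rewrite phiXn; split=> // j; rewrite coefXn.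
  by case: eqP => [->|]; rewrite ?mul1n.
Qed.

(** Precompactness of [c G] modulo [d G], stated without the quotient. *)
Definition relatively_covered (G : topologicalZmodType) (c d : nat) :=
  forall U, nbhs (0 : G) U ->
    finitely_covered (@multiples G c) (thicken U (@multiples G d)).

Lemma finitely_covered_trans (G : zmodType) (A C : set G) (U V : set G) :
  (forall x y, V x -> V y -> U (x + y)) ->
  finitely_covered A (thicken V C) -> finitely_covered C V -> finitely_covered A U.
Proof.
move=> VU [s sP] [t tP]; exists [seq x + y | x <- s, y <- t] => x /sP[f fs [c Cc Vc]].
have [g gt Vg] := tP c Cc; exists (f + g); first exact: allpairs_f.
have := VU _ _ Vc Vg; congr U; zmod.
Qed.

Lemma relatively_covered_trans (G : topologicalZmodType) c d e :
  relatively_covered G c d -> relatively_covered G d e -> relatively_covered G c e.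
Proof.
move=> cd de U U0; have [V V0 VU] := group_base_sum (@nbhs0_group_base G) 2 U0.
apply: (@finitely_covered_trans _ _ (@multiples G d) _ (thicken V (@multiples G e))).
- move=> x y [p Pp Vp] [q Pq Vq]; exists (p + q).
    exact: (subgroupD (multiples_subgroup _ _)).
  have := VU [:: (x - p); (y - q)]; rewrite !big_cons big_nil.
  rewrite (_ : x - p + _ = x + y - (p + q)); last by zmod.
  by apply=> // z; rewrite !inE => /orP[] /eqP ->; left.
- have [s sP] := cd V V0; exists s => x /sP[f fs [p Pp Vp]].
  exists f => //; exists p => //; exists 0; last by rewrite subr0.
  by case: (multiples_subgroup G e).
- exact: de.
Qed.

(** * Bohr neighbourhoods on integer polynomials *)

Section bohr.
Context (R : realType).

(** Any real sequence is a character here, since no relation constrains the values at the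
    monomials. *)
Definition bohr (ths : seq (nat -> R)) (eps : R) (a : {poly int}) :=
  forall j, (j < size ths)%N -> near_int eps (phi (nth (fun=> 0) ths j) a).

Lemma bohr_cat t1 t2 e e1 e2 a : e <= e1 -> e <= e2 -> bohr (t1 ++ t2) e a ->
  bohr t1 e1 a /\ bohr t2 e2 a.
Proof.
move=> ee1 ee2 H; split=> j jt.
  apply: near_int_le ee1 _; have := H j; rewrite nth_cat jt; apply.
  by rewrite size_cat ltn_addr.
apply: near_int_le ee2 _; have := H (size t1 + j)%N.
have -> : nth (fun=> 0) (t1 ++ t2) (size t1 + j) = nth (fun=> 0) t2 j.
  by rewrite nth_cat ltnNge leq_addr addKn.
by rewrite size_cat ltn_add2l; exact.
Qed.

Lemma bohr0 ths e : 0 <= e -> bohr ths e 0.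
Proof. by move=> e0 j _; rewrite phi0; exists 0; rewrite subrr normr0. Qed.

Lemma bohrB ths e a b : bohr ths (e / 2) a -> bohr ths (e / 2) b -> bohr ths e (a - b).
Proof.
move=> ha hb j jt; have [k hk] := ha j jt; have [l hl] := hb j jt.
exists (k - l); rewrite phiB rmorphB /=.
rewrite (_ : _ - _ - _ = (phi (nth (fun=> 0) ths j) a - k%:~R) -
  (phi (nth (fun=> 0) ths j) b - l%:~R)); last by ring.
by rewrite [leRHS]splitr; apply: le_trans (ler_normB _ _) (lerD hk hl).
Qed.

(** The character with value [1 / n] at ['X^j] and zero at the other monomials reads the coefficient
    of index [j] modulo [n]. *)
Lemma bohr_coef (j n : nat) : (0 < n)%N -> exists ths, forall eps, 0 < eps ->
  eps * n%:R < 1 -> forall a, bohr ths eps a -> (n%:Z %| a`_j)%Z.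
Proof.
move=> n0; have n0R : 0 < n%:R :> R by rewrite ltr0n.
exists [:: fun i => if i == j then n%:R^-1 else 0] => eps eps0 en a /(_ 0%N isT)[k].
have -> : phi (nth (fun=> 0) [:: fun i => if i == j then n%:R^-1 else 0] 0) a =
    (a`_j)%:~R / n%:R :> R.
  rewrite -[nth _ _ _]/(fun i => if i == j then n%:R^-1 else 0).
  rewrite (@phiE _ _ _ (maxn (size a) j.+1)) ?leq_maxl//=.
  have jlt : (j < maxn (size a) j.+1)%N by rewrite leq_max ltnSn orbT.
  rewrite (bigD1 (Ordinal jlt)) //= eqxx -mulrzl big1 ?addr0// => i ij.
  by rewrite ifN ?mul0rz//; apply: contra ij => /eqP e; apply/eqP/val_inj.
move=> h; apply/dvdzP; exists k.
have : `|(a`_j - k * n%:Z)%:~R : R| < 1.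
  rewrite rmorphB rmorphM /= (_ : (a`_j)%:~R - _ = ((a`_j)%:~R / n%:R - k%:~R) * n%:R); last first.
    by rewrite mulrBl divfK ?gt_eqF// -pmulrn.
  rewrite normrM (gtr0_norm n0R); apply: le_lt_trans en.
  by rewrite ler_pM2r.
by rewrite -intr_norm -[1]/(1%:~R) ltr_int; lia.
Qed.

(** The powers of ['X] give infinitely many terms in a torus that is cut into finitely many cells of
    side [1 / K]. *)
Lemma bohr_pigeonhole ths eps : 0 < eps -> exists q q', (q < q')%N /\
  bohr ths eps ('X^q' - 'X^q).
Proof.
move=> eps0; pose K := (Num.truncn eps^-1).+1.
have KP : eps^-1 < K%:R by exact: truncnS_gt.
have K0 : 0 < K%:R :> R by rewrite ltr0n.
pose fr (r : R) : R := r - (Num.floor r)%:~R.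
have fr01 r : 0 <= fr r < 1.
  have := floor_itv r; rewrite /fr intrD => /andP[h1 h2].
  by apply/andP; split; lra.
have trlt r : (Num.truncn (fr r * K%:R) < K)%N.
  have /andP[h1 h2] := fr01 r.
  have /andP[t1 _] := truncn_itv (mulr_ge0 h1 (ltW K0)).
  rewrite -(ltr_nat R); apply: le_lt_trans t1 _.
  by rewrite -[ltRHS]mul1r ltr_pM2r.
pose col q : {ffun 'I_(size ths) -> 'I_K} :=
  [ffun j => Ordinal (trlt (nth (fun=> 0) ths (nat_of_ord j) q))].
have [q [q' [qq' e]]] := finite_coloring col.
exists q, q'; split=> // j jt; rewrite phiB !phiXn.
set r := nth _ ths j q; set r' := nth _ ths j q'.
have tE : Num.truncn (fr r * K%:R) = Num.truncn (fr r' * K%:R).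
  by move/ffunP: e => /(_ (Ordinal jt)); rewrite !ffunE => -[].
exists (Num.floor r' - Num.floor r).
have /andP[a1 a2] := fr01 r; have /andP[b1 b2] := fr01 r'.
have ta : 0 <= fr r * K%:R by exact: mulr_ge0 a1 (ltW K0).
have tb : 0 <= fr r' * K%:R by exact: mulr_ge0 b1 (ltW K0).
have := truncn_itv ta; have := truncn_itv tb; rewrite -tE.
move=> /andP[c1 c2] /andP[d1 d2]; rewrite -natr1 in c2 d2.
have -> : r' - r - (Num.floor r' - Num.floor r)%:~R = fr r' - fr r.
  by rewrite /fr rmorphB /=; ring.
have h : `|fr r' - fr r| * K%:R < 1.
  rewrite -[X in _ * X](gtr0_norm K0) -normrM mulrBl ltr_norml; apply/andP; split; lra.
have eK : 1 < K%:R * eps by rewrite -ltr_pdivrMr// div1r.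
rewrite -(ler_pM2r K0); apply: ltW; apply: (lt_trans h); by rewrite mulrC.
Qed.

End bohr.

Definition obstruction (G : topologicalZmodType) (cp : nat * nat) :=
  [/\ (0 < cp.1)%N, prime cp.2 & ~ relatively_covered G cp.1 (cp.2 * cp.1)].

(* The sequence [e] is independent modulo every obstruction to precompactness,
   so that a combination of the [e k] which is small for the obstruction
   [(c, p)] has all its coefficients divisible by [p]. *)
Lemma obstruction_sequence (G : topologicalZmodType) cp0 : obstruction G cp0 -> exists (e : nat -> G) (V : nat -> set G)
  (cp : nat -> nat * nat), [/\ cp 0%N = cp0, forall i, nbhs (0 : G) (V i),
    forall q, obstruction G q -> exists i, cp i = q,
    forall i, obstruction G (cp i) &
    forall i (a : {poly int}), (forall j, (j < i)%N -> ((cp i).2%:Z %| a`_j)%Z) ->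
      V i (phi e a *+ (cp i).1) -> forall j, ((cp i).2%:Z %| a`_j)%Z].
Proof.
move=> bad0.
(* An enumeration of all obstructions with [cp0] as default. It is also placed at index 0, where the
   condition on lower coefficients is void. *)
pose cp i : nat * nat := if i is i'.+1 then
  (if unpickle i' is Some q then (if pselect (obstruction G q) then q else cp0) else cp0) else cp0.
have gB := @nbhs0_group_base G.
have cpb i : obstruction G (cp i).
  by rewrite /cp; case: i => // i; case: unpickle => // q; case: pselect.
have cps q : obstruction G q -> exists i, cp i = q.
  by move=> bq; exists (pickle q).+1; rewrite /cp pickleK; case: pselect.
have /choice[U UP] : forall i, exists U, nbhs (0 : G) U /\
    ~ finitely_covered (@multiples G (cp i).1)
        (thicken U (@multiples G ((cp i).2 * (cp i).1))).
  move=> i; have [_ _ nr] := cpb i; apply: contrapT => nex; apply: nr => U U0.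
  by apply: contrapT => nU; apply: nex; exists U.
have /choice[U1 U1P] : forall i, exists U1, nbhs (0 : G) U1 /\
    forall x1 x2 x3 x4, U1 x1 -> U1 x2 -> U1 x3 -> U1 x4 -> U i (x1 - x2 - (x3 - x4)).
  move=> i; have [U2 U20 U2U] := group_baseB gB (UP i).1.
  have [U1 U10 U1U2] := group_baseB gB U20; exists U1; split=> //.
  by move=> x1 x2 x3 x4 h1 h2 h3 h4; apply: U2U; exact: U1U2.
have /choice[V VP] : forall i, exists V, nbhs (0 : G) V /\
    forall x (z : int), (`|z| <= (cp i).2)%N -> V x -> U1 i (x *~ z).
  by move=> i; have [V V0 VU] := group_baseMz gB (cp i).2 (U1P i).1; exists V.
(* One coefficient bound for all obstructions of index at most [k]. *)
pose bd k := (\sum_(i < k.+1) (cp i).2 * (cp i).1)%N.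
have ex (s : seq G) : exists x, forall i f, (i < (size s).+1)%N ->
    f \in box (nth 0 s) (bd (size s)) (size s) ->
    ~ thicken (U1 i) (@multiples G ((cp i).2 * (cp i).1)) (x *+ (cp i).1 - f).
  apply: (@avoid_multiples _ _ _ _ U).
  - by move=> i _; exact: multiples_subgroup.
  - by move=> i x1 x2 x3 x4 _; exact: (U1P i).2.
  - by move=> i _; exact: (UP i).2.
have [e eP] := prefix_choice ex.
exists e, V, cp; split => //; first by move=> i; exact: (VP i).1.
move=> i a ai Va; apply: contrapT => nall.
have [_ pp _] := cpb i; set p := (cp i).2 in pp ai nall *; set c := (cp i).1 in Va *.
(* [k] is the last index at which [p] fails to divide. The hypothesis on lower coefficients gives
   [i <= k], so that [e k] was chosen to avoid obstruction [i]. *)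
have [k kP kmax] : exists2 k, ~ (p%:Z %| a`_k)%Z & forall j, (k < j)%N -> (p%:Z %| a`_j)%Z.
  have exk : exists k, ~~ (p%:Z %| a`_k)%Z.
    apply: contrapT => h; apply: nall => j; apply: contrapT => /negP hj; apply: h.
    by exists j.
  have bnd k : ~~ (p%:Z %| a`_k)%Z -> (k <= size a)%N.
    by apply: contraR; rewrite -ltnNge => /ltnW ?; rewrite nth_default ?dvdz0.
  have [k /negP kP km] := ex_maxnP exk bnd; exists k => // j kj.
  apply: contrapT => /negP /km; by rewrite leqNgt kj.
have ik : (i <= k)%N by rewrite leqNgt; apply/negP => /ai.
have cop : coprimez (a`_k) p%:Z.
  rewrite coprimezE coprime_sym /= prime_coprime//.
  by apply/negP => h; apply: kP; rewrite dvdzE.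
have /coprimezP[[u v] /= uv] := cop.
(* [b] inverts the [k]-th coefficient modulo [p]. After multiplication by [b], that coefficient is 1
   modulo [p], those above are absorbed by the multiples of [p * c], and those below are reduced
   modulo [p] into the box. *)
pose b := (u %% p%:Z)%Z.
have p0 : (p%:Z != 0) by rewrite -lt0n prime_gt0.
have b0 : 0 <= b by exact: modz_ge0.
have bp : b < p%:Z by apply: ltz_pmod; rewrite ltz_nat prime_gt0.
have bE : exists w : int, a`_k * b = 1 + p%:Z * w.
  exists (- v - a`_k * (u %/ p%:Z)%Z).
  have := divz_eq u p%:Z; rewrite -/b => ue.
  have -> : b = u - (u %/ p%:Z)%Z * p%:Z by rewrite {1}ue; ring.
  by rewrite -uv; ring.
have [w wE] := bE.
pose r j := modz (a`_j * b) p%:Z.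
pose f := - \sum_(j < k) e j *~ (r j * c%:Z).
have fbox : f \in box (nth 0 (mkseq e k)) (bd (size (mkseq e k))) (size (mkseq e k)).
  rewrite size_mkseq (@eq_box _ _ e); last by move=> j jk; rewrite nth_mkseq.
  have -> : f = \sum_(j < k) e j *~ (- (r j * c%:Z)).
    by rewrite /f -sumrN; apply: eq_bigr => j _; rewrite mulrNz.
  apply: (@mem_box _ e _ k (fun j => - (r j * c%:Z))) => j jk.
  rewrite abszN abszM; have : 0 <= r j < p%:Z by rewrite modz_ge0//= ltz_pmod// ltz_nat prime_gt0.
  move=> rb; apply: (@leq_trans (p * c)); first by apply: leq_mul => //; lia.
  by rewrite /bd (bigD1 (Ordinal (ik : (i < k.+1)%N)))//= leq_addr.
have ik' : (i < (size (mkseq e k)).+1)%N by rewrite size_mkseq ltnS.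
apply: (eP k i f ik' fbox).
have := (VP i).2 (phi e a *+ c) b _ Va => /(_ ltac:(rewrite -/p; lia)) Ub.
exists (e k *+ c - f - phi e a *+ c *~ b); last by rewrite opprB addrCA subrr addr0.
set n := maxn (size a) k.+1.
have kn : (k < n)%N by rewrite leq_max ltnSn orbT.
pose q j := divz (a`_j * b) p%:Z.
have qE j : a`_j * b = q j * p%:Z + r j by exact: divz_eq.
have mulP y : multiples (p * c) (y *~ (p%:Z * c%:Z)).
  by exists y => //; rewrite -PoszM pmulrn.
have sP := multiples_subgroup G (p * c).
have -> : phi e a *+ c *~ b = phi e a *~ (b * c%:Z) by zmod.
rewrite (@phiE _ e a n) ?leq_maxl//.
rewrite (bigD1 (Ordinal kn)) //= mulrzDl.
have -> : (\sum_(j < n | j != Ordinal kn) e j *~ a`_j) *~ (b * c%:Z) =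
   \sum_(j < n | j != Ordinal kn) e j *~ (a`_j * b * c%:Z).
  by rewrite mulrz_suml; apply: eq_bigr => j _; rewrite -mulrzA mulrA.
have -> : \sum_(j < n | j != Ordinal kn) e j *~ (a`_j * b * c%:Z) = - f +
   \sum_(j < n | j != Ordinal kn) (if (j < k)%N then e j *~ (q j) else
        e j *~ (divz (a`_j) p%:Z * b)) *~ (p%:Z * c%:Z).
  have -> : - f = \sum_(j < n | j != Ordinal kn) (if (j < k)%N then e j *~ (r j * c%:Z) else 0).
    rewrite /f opprK -big_mkcondr /= (big_ord_widen_cond n xpredT (fun j => e j *~ (r j * c%:Z))); last exact: ltnW.
    apply: eq_bigl => j /=; rewrite -val_eqE /=; case: ltngtP => //.
  rewrite -big_split /=; apply: eq_bigr => j; rewrite -val_eqE /= => jk.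
  case: ifP => jk'; first by rewrite qE; zmod.
  have kj : (k < j)%N by rewrite ltn_neqAle eq_sym jk leqNgt jk'.
  have /dvdzP[t tE] := kmax j kj; rewrite add0r tE mulzK//; zmod.
set S := \sum_(j < n | _) _.
have SP : multiples (p * c) S.
  by rewrite /S big_mkcond /=; apply: (subgroup_sum sP) => j _; case: ifP => _ //; case: sP.
rewrite (_ : _ - _ = - (e k *~ w) *~ (p%:Z * c%:Z) - S).
  by case: (sP) => _; apply => //; rewrite -mulNrz.
rewrite -[in LHS]mulrzA mulrA wE; zmod.
Qed.

Section prodanov_stoyanov.
Context (R : realType) (G : topologicalZmodType) (Gmin : minimal_group G).

Let gB := @nbhs0_group_base G.

(** The given topology, coarsened by the Bohr topology of the free group pushed forward along
    [phi e]. *)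
Lemma bohr_base (e : nat -> G) : group_base [set W | exists V ths (eps : R),
  [/\ nbhs (0 : G) V, 0 < eps &
      W = [set x | exists2 a, bohr ths eps a & V (x - phi e a)]]].
Proof.
split.
- exists [set x | exists2 a, bohr [::] (1 : R) a & setT (x - phi e a)].
  by exists setT, [::], 1; split => //; exact: filterT.
- move=> _ [V [ths [eps [V0 eps0 ->]]]]; exists 0; first exact/bohr0/ltW.
  by rewrite phi0 subrr; exact: nbhs_singleton.
- move=> _ _ [V [ths [eps [V0 eps0 ->]]]] [V' [ths' [eps' [V'0 eps'0 ->]]]].
  exists [set x | exists2 a, bohr (ths ++ ths') (Num.min eps eps') a &
     (V `&` V') (x - phi e a)].
    exists (V `&` V'), (ths ++ ths'), (Num.min eps eps'); split => //.
      exact: filterI.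
    by rewrite lt_min eps0.
  move=> x [a ba [Va V'a]].
  have [|//|b1 b2] := @bohr_cat R ths ths' _ eps eps' a _ _ ba.
    by rewrite ge_min lexx.
    by rewrite ge_min lexx orbT.
  by split; exists a.
- move=> _ [V [ths [eps [V0 eps0 ->]]]]; have [V' V'0 V'V] := group_baseB gB V0.
  exists [set x | exists2 a, bohr ths (eps / 2) a & V' (x - phi e a)].
    by exists V', ths, (eps / 2); split => //; rewrite divr_gt0.
  move=> x y [a ba Va] [b bb Vb]; exists (a - b); first exact: bohrB.
  by have := V'V _ _ Va Vb; rewrite phiB; congr V; zmod.
Qed.

(** This base does not give back the topology: pigeonhole makes a difference of two monomials Bohr
    small, and no prime divides its coefficients. It remains to see that the base is Hausdorff.
    Combinations approximating a point [x] of all its members have coefficients divisible by some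
    [n] such that [n G] is covered; Følner's theorem for the elements [e j *+ n] then yields
    arbitrarily small approximants, so [x] is zero. *)
Lemma minimal_no_obstruction cp : ~ obstruction G cp.
Proof.
move=> /obstruction_sequence[e [V [cps [_ V0 cps_surj cps_bad det]]]].
have [UV UV0 UVV] := group_baseMz gB (cps 0%N).1 (V0 0%N).
have [||W [A [ths [eps [A0 eps0 ->]]]] WU] := minimal_groupP Gmin (bohr_base e) _ _ UV0.
- move=> _ [A [ths [eps [A0 eps0 ->]]]]; apply: filterS A0 => x Ax.
  by exists 0; [exact/bohr0/ltW|rewrite phi0 subr0].
- move=> x xP; apply: (hausdorff_nbhs0 (proj1 Gmin)) => A A0.
  have xP' A' ths (eps : R) : nbhs (0 : G) A' -> 0 < eps ->
      exists2 a, bohr ths eps a & A' (x - phi e a).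
    by move=> A'0 eps0; apply: (xP [set x | exists2 a, bohr ths eps a & A' (x - phi e a)]);
      exists A', ths, eps.
  pose forced n := exists A' ths (eps : R), [/\ nbhs (0 : G) A', 0 < eps &
    forall a, bohr ths eps a -> A' (x - phi e a) -> forall j, (n%:Z %| a`_j)%Z].
  have forced1 : forced 1%N.
    by exists setT, [::], 1; split; [exact: filterT|exact: ltr01|move=> *; rewrite dvd1z].
  (* Two approximants differ by [n] times a combination [d] to which the obstruction [(n * m, p)]
     applies, so [p] divides the coefficients of [d]. Comparing [a] with an approximant whose [j]-th
     coefficient is known to be divisible by [n * p] settles index [j]. *)
  have forcedM n m p : (0 < n)%N -> forced n -> obstruction G (n * m, p)%N ->
      forced (n * p)%N.
    move=> n0 [A' [ths [eps [A'0 eps0 fA]]]] ob; have [i iE] := cps_surj _ ob.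
    have [_ pp _] := ob; rewrite /= in pp.
    have np0 : (0 < n * p)%N by rewrite muln_gt0 n0 prime_gt0.
    have npR : 0 < (n * p)%:R :> R by rewrite ltr0n.
    have [A1 A10 A1V] := group_baseMz gB m (V0 i).
    have [A2 A20 A2A1] := group_baseB gB A10.
    have /choice[ct ctP] := fun j => bohr_coef R j np0.
    pose eps' : R := Num.min eps (1 / (2 * (n * p)%:R)).
    have eps'0 : 0 < eps' by rewrite lt_min eps0 divr_gt0// mulr_gt0.
    have eps'np : eps' * (n * p)%:R < 1.
      apply: (@le_lt_trans _ _ (1 / (2 * (n * p)%:R) * (n * p)%:R)).
        by rewrite ler_pM2r// ge_min lexx orbT.
      by rewrite invfM mulrA divfK ?gt_eqF//; lra.
    (* The condition on lower coefficients is met by adding the characters that read the first [i]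
       coefficients modulo [n * p]. *)
    pose lows := flatten [seq ct j | j <- iota 0 i].
    have lowsP a : bohr lows eps' a -> forall j, (j < i)%N -> ((n * p)%N%:Z %| a`_j)%Z.
      move=> ba j ji; apply: (ctP j _ eps'0 eps'np).
      have [s1 [s2 sE]] : exists s1 s2, lows = s1 ++ ct j ++ s2.
        have -> : lows = flatten [seq ct j | j <- iota 0 j] ++ ct j ++
            flatten [seq ct j | j <- iota j.+1 (i - j.+1)].
          rewrite /lows -{1}(subnKC (ltnW ji)) iotaD map_cat flatten_cat; congr (_ ++ _).
          by rewrite add0n -(subnSK ji).
        by eexists; eexists.
      move: ba; rewrite sE => /(bohr_cat (lexx _) (lexx _))[_].
      by move=> /(bohr_cat (lexx _) (lexx _))[].
    exists (A' `&` A2), (ths ++ lows), eps'; split => //; first exact: filterI.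
    move=> a ba [A'a A2a] j.
    have epsle : eps' <= eps by rewrite ge_min lexx.
    have [ba1 ba2] := bohr_cat epsle (lexx _) ba.
    have na := fA a ba1 A'a.
    have [b bb [A'b A2b]] := xP' (A' `&` A2) ((ths ++ lows) ++ ct j) eps' (filterI A'0 A20) eps'0.
    have [bb12 bb3] := bohr_cat (lexx _) (lexx _) bb.
    have [bb1 bb2] := bohr_cat epsle (lexx _) bb12.
    have nb := fA b bb1 A'b.
    pose d : {poly int} := \poly_(k < size (a - b)) divz ((a - b)`_k) n%:Z.
    have dE : a - b = d *+ n.
      apply/polyP => k; rewrite coefMn /d coef_poly.
      have [lt|ge] := ltnP k (size (a - b)); last by rewrite nth_default// mul0rn.
      by rewrite -mulr_natr natz divzK// coefB rpredB.
    have ndvd k : ((n * p)%N%:Z %| (a - b)`_k)%Z = (p%:Z %| d`_k)%Z.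
      rewrite dE coefMn -mulr_natr natz mulrC PoszM.
      by rewrite dvdz_mul2l// -lt0n.
    have Vd : V i (phi e d *+ (cps i).1).
      rewrite iE /= mulrnA -phiMn -dE phiB.
      have := A1V (phi e a - phi e b) m%:Z (leqnn _); rewrite -pmulrn; apply.
      by have := A2A1 _ _ A2b A2a; congr A1; zmod.
    have dl k : (k < i)%N -> ((cps i).2%:Z %| d`_k)%Z.
      move=> ki; rewrite iE /= -ndvd coefB rpredB//; exact: lowsP.
    have := det i d dl Vd j; rewrite iE /= -ndvd coefB => h.
    have := rpredD h (ctP j _ eps'0 eps'np _ bb3) => /=.
    by rewrite subrK.
  have [A1 A10 A1A] := group_base_sum gB 2 A0.
  have [U1 U10 U1A] := group_base_sum gB 9 A10.
  have [U2 U20 U2U1] := group_baseB gB U10.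
  have [U3 U30 U3U2] := group_base_sum gB 2 U20.
  have [c c0 cov] := minimal_multiple_covered Gmin U30.
  (* For the largest forced divisor [n] of [c], [forcedM] leaves no obstruction between [n] and [c],
     so that the covering of [c G] passes to [n G]. *)
  have [n [nc fn nmax]] : exists n, [/\ (n %| c)%N, forced n &
      forall n', (n' %| c)%N -> forced n' -> (n' <= n)%N].
    pose Q n := (n %| c)%N && `[< forced n >].
    have exQ : exists n, Q n by exists 1%N; rewrite /Q dvd1n; apply/asboolP.
    have bQ n : Q n -> (n <= c)%N by move=> /andP[/dvdn_leq ->].
    have [n /andP[nc /asboolP fn] nm] := ex_maxnP exQ bQ.
    by exists n; split => // n' n'c fn'; apply: nm; rewrite /Q n'c; apply/asboolP.
  have n0 : (0 < n)%N by exact: dvdn_gt0 nc.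
  have relc d : (0 < d)%N -> (n * d %| c)%N -> relatively_covered G n (n * d).
    have [k] := ubnP d; elim: k d => // k IH d; rewrite ltnS => dk d0 ndc.
    have [->|d1] := eqVneq d 1%N.
      move=> U U0; exists [:: 0] => y [z _ <-]; exists 0; first by rewrite inE.
      by exists (z *+ n); [exists z => //; rewrite muln1|rewrite subr0 subrr; exact: nbhs_singleton].
    have pp : prime (pdiv d) by rewrite pdiv_prime// ltn_neqAle eq_sym d1.
    have pd := pdiv_dvd d; set p := pdiv d in pp pd.
    have p0 := prime_gt0 pp; have p1 := prime_gt1 pp.
    have dE : (d = d %/ p * p)%N by rewrite divnK.
    have d'0 : (0 < d %/ p)%N by rewrite divn_gt0// dvdn_leq.
    apply: (@relatively_covered_trans _ _ (n * (d %/ p))).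
      apply: IH => //; first by apply: leq_trans dk; rewrite ltn_Pdiv.
      by apply: dvdn_trans ndc; rewrite dvdn_pmul2l// dvdn_div.
    have -> : (n * d = p * (n * (d %/ p)))%N by rewrite mulnCA [(p * _)%N]mulnC divnK.
    apply: contrapT => nrel.
    have fnp : forced (n * p)%N.
      apply: (forcedM n (d %/ p)%N) => //; split => //=.
      by rewrite muln_gt0 n0.
    have : (n * p <= n)%N.
      by apply: nmax => //; apply: dvdn_trans ndc; rewrite dvdn_pmul2l.
    by rewrite -{2}[n]muln1 leq_pmul2l// leqNgt p1.
  have covn : finitely_covered (@multiples G n) U2.
    apply: (@finitely_covered_trans _ _ (@multiples G c) _ U3) => //.
      move=> y z Uy Uz; have := U3U2 [:: y; z]; rewrite !big_cons big_nil addr0.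
      by apply => // t; rewrite !inE => /orP[] /eqP ->; left.
    have := relc (c %/ n)%N; rewrite [(n * _)%N]mulnC divnK//; apply => //.
    by rewrite divn_gt0// dvdn_leq.
  have [s sP] := covn.
  pose g j := e j *+ n.
  have gE (z : seq (int * nat)) : weval g z = weval e z *+ n.
    rewrite /weval -sumrMnl; apply: eq_bigr => t _; rewrite /g; zmod.
  have /choice[wd wdP] : forall f : G, exists z : seq (int * nat), forall z',
      U2 (weval g z' - f) -> U2 (weval g z - f).
    move=> f; have [[z zP]|nz] := pselect (exists z, U2 (weval g z - f)).
      by exists z.
    by exists [::] => z' z'P; exfalso; apply: nz; exists z'.
  have covU z : exists2 t, t \in [seq wd f | f <- s] & U1 (weval g z - weval g t).
    have [|f fs Uf] := sP (weval g z); first by rewrite gE; exists (weval e z).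
    exists (wd f); first by apply/mapP; exists f.
    by have := U2U1 _ _ Uf (wdP f _ Uf); congr U1; zmod.
  have N0s : subgroup ([set 0] : set G) by split=> // _ _ -> ->; rewrite subr0.
  have [m [th [_ [_ th1 _]]]] := folner_base R gB (minimal_multiple_covered Gmin) N0s U10 U1A covU.
  have [A' [ths [eps [A'0 eps0 fA]]]] := fn.
  (* On [a = d *+ n] a character divided by [n] takes the value of the character at [d]. *)
  pose ths' := [seq (fun k => th j k / n%:R) | j <- enum 'I_m].
  have m18 : 0 < Num.min eps (1 / 8) by rewrite lt_min eps0; lra.
  have [a ba [A'a A1a]] := xP' (A' `&` A1) (ths ++ ths') _ (filterI A'0 A10) m18.
  have [|//|ba1 ba2] := @bohr_cat R ths ths' _ eps (1 / 8) a _ _ ba.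
    by rewrite ge_min lexx.
    by rewrite ge_min lexx orbT.
  have na := fA a ba1 A'a.
  pose d : {poly int} := \poly_(k < size a) divz (a`_k) n%:Z.
  have dE : a = d *+ n.
    apply/polyP => k; rewrite coefMn /d coef_poly.
    have [lt|ge] := ltnP k (size a); last by rewrite nth_default// mul0rn.
    by rewrite -mulr_natr natz divzK.
  have [|y -> Uy] := th1 [seq (d`_j, j) | j <- iota 0 (size d)].
    move=> j; rewrite phi_weval.
    have jlt : (index j (enum 'I_m) < size ths')%N by rewrite size_map index_mem mem_enum.
    have := ba2 _ jlt; rewrite (nth_map j) ?index_mem ?mem_enum// nth_index ?mem_enum//.
    have -> : phi (fun k => th j k / n%:R) a = phi (th j) d.
      rewrite dE phiMn /phi -sumrMnl; apply: eq_bigr => k _.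
      have n0R : n%:R != 0 :> R by rewrite pnatr_eq0 -lt0n.
      have key (t : R) (z : int) : t / n%:R *~ z *+ n = t *~ z.
        have -> : t / n%:R *~ z *+ n = t / n%:R * n%:R *~ z.
          by rewrite -[LHS]mulr_natr mulrzAl.
        by rewrite divfK.
      exact: key.
    by [].
  have Ua : A1 (phi e a).
    by move: Uy; rewrite subr0 phi_weval dE phiMn; congr A1; rewrite /phi -sumrMnl;
      apply: eq_bigr => k _; rewrite /g; zmod.
  have := A1A [:: x - phi e a; phi e a]; rewrite !big_cons big_nil addr0 subrK.
  by apply=> // t; rewrite !inE => /orP[] /eqP ->; left.
- have [q [q' [qq' bq]]] := bohr_pigeonhole ths eps0.
  have /WU Uq : exists2 a, bohr ths eps a & A (phi e ('X^q' - 'X^q) - phi e a).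
    by exists ('X^q' - 'X^q) => //; rewrite subrr; exact: nbhs_singleton.
  have Vq := UVV _ (cps 0%N).1%:Z (leqnn _) Uq; rewrite -pmulrn in Vq.
  have [_ pp _] := cps_bad 0%N.
  have /= := det 0%N _ _ Vq q'; rewrite coefB !coefXn eqxx gtn_eqF// subr0.
  move=> /(_ _) /=; rewrite dvdzE /= dvdn1 => h.
  by have := prime_gt1 pp; rewrite (eqP (h _)).
Qed.

Lemma minimal_relatively_covered c : (0 < c)%N -> relatively_covered G 1 c.
Proof.
have [k] := ubnP c; elim: k c => // k IH c; rewrite ltnS => ck c0.
have [->|c1] := eqVneq c 1%N.
  move=> U U0; exists [:: 0] => y yM; exists 0; first by rewrite inE.
  by exists y => //; rewrite subr0 subrr; exact: nbhs_singleton.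
have pp : prime (pdiv c) by rewrite pdiv_prime// ltn_neqAle eq_sym c1.
have pc := pdiv_dvd c; set p := pdiv c in pp pc.
have c'0 : (0 < c %/ p)%N by rewrite divn_gt0 ?prime_gt0// dvdn_leq.
apply: (@relatively_covered_trans _ _ (c %/ p)).
  by apply: IH => //; apply: leq_trans ck; rewrite ltn_Pdiv// prime_gt1.
have cE : (p * (c %/ p) = c)%N by rewrite mulnC divnK.
apply: contrapT => nrel; apply: (@minimal_no_obstruction (c %/ p, p)%N).
by split => //=; rewrite cE.
Qed.

Theorem minimal_precompact U : nbhs (0 : G) U -> finitely_covered setT U.
Proof.
move=> U0; have [V V0 VU] := group_base_sum gB 2 U0.
have [c c0 cov] := minimal_multiple_covered Gmin V0.
have [s sP] : finitely_covered (@multiples G 1) U.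
  apply: (@finitely_covered_trans _ _ (@multiples G c) _ V) => //.
    move=> y z Uy Uz; have := VU [:: y; z]; rewrite !big_cons big_nil addr0.
    by apply => // t; rewrite !inE => /orP[] /eqP ->; left.
  exact: minimal_relatively_covered.
by exists s => x _; apply: sP; exists x.
Qed.

End prodanov_stoyanov.

(** * Duality *)

Lemma fctMn (T : Type) (V : zmodType) (f : T -> V) n x : (f *+ n) x = f x *+ n.
Proof.
by elim: n => [|n IH]; rewrite ?mulr0n// !mulrS -IH.
Qed.

Lemma fctMz (T : Type) (V : zmodType) (f : T -> V) (n : int) x :
  (f *~ n) x = f x *~ n.
Proof.
case: n => k; first exact: fctMn.
by rewrite NegzE !mulrNz -[LHS]/(- ((f *~ k.+1) x)) -!pmulrn fctMn.
Qed.

Section divisible_extension.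
Context (B X : zmodType) (X' Z0 : set X).
Hypothesis sX : subgroup X'.
Hypothesis sZ : subgroup Z0.
Hypothesis divX : forall x n, X' x -> (0 < n)%N ->
  exists2 y, X' y & Z0 (x - y *+ n).

Let graph (Q : set (B * X)) := [/\ subgroup Q, forall b x, Q (b, x) -> X' x &
  forall x, Q (0, x) -> Z0 x].

(** Take the least positive [n] with [b *+ n] in the domain and divide a value there by [n]; if
    there is none, the value 0 is free. *)
Let graph_extend Q b : graph Q -> exists2 y, X' y &
  forall d x (k : int), Q (d, x) -> d + b *~ k = 0 -> Z0 (x + y *~ k).
Proof.
move=> [sQ QX Q0].
have [[n0 /andP[n00 /asboolP[x0 Qx0]]]|nex] :=
    pselect (exists n, (0 < n)%N && `[< exists x, Q (b *+ n, x) >]); last first.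
  exists 0; first by case: sX.
  move=> d x k Qd dk; rewrite mul0rz addr0.
  have [k0|k0] := eqVneq k 0.
    by apply: Q0; rewrite k0 mulr0z addr0 in dk; rewrite -dk.
  exfalso; apply: nex; exists `|k|%N; rewrite absz_gt0 k0; apply/asboolP.
  have kd : b *~ k = - d by apply/eqP; rewrite -addr_eq0 addrC dk.
  have [k1|k1] := lerP 0 k.
    by exists (- x); rewrite pmulrn gez0_abs// kd; exact: (subgroupN sQ Qd).
  by exists x; rewrite pmulrn ltz0_abs// mulrNz kd opprK.
have exn : exists n, (0 < n)%N && `[< exists x, Q (b *+ n, x) >].
  by exists n0; rewrite n00; apply/asboolP; exists x0.
have [n /andP[n1 /asboolP[x Qx]] nmin] := ex_minnP exn.
have [y Xy Zy] := divX (QX _ _ Qx) n1; exists y => // d z k Qd dk.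
have nk : (n%:Z %| k)%Z.
  have n0z : n%:Z != 0 by rewrite -lt0n.
  have r0 : 0 <= (k %% n%:Z)%Z by exact: modz_ge0.
  have rn : (k %% n%:Z)%Z < n%:Z by rewrite ltz_pmod// ltz_nat.
  suff : (k %% n%:Z)%Z = 0 by move=> h; apply/dvdz_mod0P.
  apply/eqP; apply: contrapT => /negP rne.
  have : (n <= `|(k %% n%:Z)%Z|)%N.
    apply: nmin; rewrite absz_gt0 rne; apply/asboolP.
    exists (- z - x *~ (k %/ n%:Z)%Z); rewrite pmulrn gez0_abs//.
    have -> : (k %% n%:Z)%Z = k - (k %/ n%:Z)%Z * n%:Z by rewrite {2}(divz_eq k n%:Z) addrAC subrr add0r.
    have -> : b *~ (k - (k %/ n%:Z)%Z * n%:Z) = - d - (b *+ n) *~ (k %/ n%:Z)%Z.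
      have kd : b *~ k = - d by apply/eqP; rewrite -addr_eq0 addrC dk.
      by rewrite mulrzBr kd mulrC mulrzA -pmulrn.
    have := subgroupD sQ (subgroupN sQ Qd) (subgroupN sQ (subgroupMz sQ (k %/ n%:Z)%Z Qx)).
    have pairMz (u : B) (v : X) (t : int) : (u, v) *~ t = (u *~ t, v *~ t).
      have pairMn (m : nat) : (u, v) *+ m = (u *+ m, v *+ m).
        by elim: m => // m IH; rewrite !mulrS IH.
      case: t => m; first exact: pairMn.
      by rewrite !NegzE !mulrNz -!pmulrn pairMn.
    by rewrite pairMz.
  by move: r0 rn; lia.
have /dvdzP[q qE] := nk.
have pairMz (u : B) (v : X) (t : int) : (u, v) *~ t = (u *~ t, v *~ t).
  have pairMn (m : nat) : (u, v) *+ m = (u *+ m, v *+ m).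
    by elim: m => // m IH; rewrite !mulrS IH.
  case: t => m; first exact: pairMn.
  by rewrite !NegzE !mulrNz -!pmulrn pairMn.
have Zq : Z0 (z + x *~ q).
  apply: Q0; have := subgroupD sQ Qd (subgroupMz sQ q Qx); rewrite pairMz.
  congr (Q (_, _)); rewrite -dk qE /=; zmod.
have := subgroupD sZ Zq (subgroupN sZ (subgroupMz sZ q Zy)).
by congr Z0; rewrite qE; zmod.
Qed.

(** Injectivity of divisible groups, for homomorphisms modulo [Z0]. Partial homomorphisms are
    encoded by their graphs, subgroups of [B * X], and extended by Zorn's lemma. *)
Lemma divisible_extension (Q0 : set (B * X)) :
  subgroup Q0 -> (forall b x, Q0 (b, x) -> X' x) -> (forall x, Q0 (0, x) -> Z0 x) ->
  exists f : B -> X, [/\ forall b, X' (f b),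
    forall a b, Z0 (f (a + b) - (f a + f b)) &
    forall b x, Q0 (b, x) -> Z0 (f b - x)].
Proof.
move=> sQ0 Q0X Q00.
pose P (Q : set (B * X)) := Q = set0 \/ (graph Q /\ Q0 `<=` Q).
have [F FP Ftot|Q [PQ Qmax]] := @Zorn_bigcup _ P.
  have [[Q [FQ Qne]]|nex] := pselect (exists Q, F Q /\ Q <> set0); last first.
    left; rewrite eqEsubset; split=> // z [Q FQ Qz]; apply: nex; exists Q; split=> //.
    by move=> Q0e; rewrite Q0e in Qz.
  have FG Q' z : F Q' -> Q' z -> graph Q' /\ Q0 `<=` Q'.
    by move=> FQ' Q'z; case: (FP _ FQ') => // e; rewrite e in Q'z.
  have [z Qz] : exists z, Q z.
    apply: contrapT => h; apply: Qne; rewrite eqEsubset; split=> // z Qz; apply: h.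
    by exists z.
  have [[sQ QX QZ] Q0Q] := FG _ _ FQ Qz.
  right; split; last by move=> t /Q0Q Qt; exists Q.
  split.
  - split; first by exists Q => //; case: sQ.
    move=> u v [Q1 F1 u1] [Q2 F2 v2].
    have [[sQ1 _ _] _] := FG _ _ F1 u1; have [[sQ2 _ _] _] := FG _ _ F2 v2.
    have [Q12|Q21] := Ftot _ _ F1 F2.
      by exists Q2 => //; case: sQ2 => _; apply => //; exact: Q12.
    by exists Q1 => //; case: sQ1 => _; apply => //; exact: Q21.
  - by move=> b x [Q' F' h]; have [[_ h' _] _] := FG _ _ F' h; exact: h' h.
  - by move=> x [Q' F' h]; have [[_ _ h'] _] := FG _ _ F' h; exact: h' h.
have G0 : graph Q0 by split.
have [Qe|[gQ Q0Q]] := PQ.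
  exfalso; have PQ0 : P Q0 by right; split.
  have lt : Q `<` Q0.
    by split; [rewrite Qe|move=> h; have := h 0 (proj1 sQ0); rewrite Qe].
  by have := Qmax Q0 lt.
have [sQ QX QZ] := gQ.
have dom b : exists x, Q (b, x).
  apply: contrapT => nb; have [y Xy yP] := graph_extend b gQ.
  pose Q' : set (B * X) := [set z | exists d x (k : int), Q (d, x) /\ z = (d + b *~ k, x + y *~ k)].
  apply: (Qmax Q'); last first.
    right; split; last first.
      by move=> [d x] /Q0Q Qd; exists d, x, 0; rewrite !mulr0z !addr0.
    split.
    - split; first by exists 0, 0, 0; rewrite !mulr0z !addr0; split=> //; case: sQ.
      move=> _ _ [d [x [k [Qd ->]]]] [d' [x' [k' [Qd' ->]]]].
      exists (d - d'), (x - x'), (k - k'); split; first exact: (proj2 sQ) _ _ Qd Qd'.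
      by congr (_, _) => /=; zmod.
    - move=> _ _ [d [x [k [Qd [_ ->]]]]].
      by apply: (subgroupD sX); [exact: QX Qd|exact: subgroupMz].
    - by move=> _ [d [x [k [Qd [/esym e ->]]]]]; exact: yP Qd e.
  split.
    by move=> [d x] Qd; exists d, x, 0; rewrite !mulr0z !addr0.
  move=> h; apply: nb; exists y; apply: h; exists 0, 0, 1; split; first by case: sQ.
  by rewrite !mulr1z !add0r.
have [f fP] := choice dom; exists f; split.
- by move=> b; exact: QX (fP b).
- move=> a b; apply: QZ.
  have := (proj2 sQ) _ _ (fP (a + b)) (subgroupD sQ (fP a) (fP b)).
  by congr (Q (_, _)) => /=; zmod.
- move=> b x /Q0Q Qb; apply: QZ; have := (proj2 sQ) _ _ (fP b) Qb.
  by congr (Q (_, _)) => /=; zmod.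
Qed.

End divisible_extension.

(** * The real line and its characters *)

Section real_line.
Context (R : realType).

(** This says that [r] is rational. *)
Definition torsion_mod1 (r : R) := exists2 q, (0 < q)%N & r *+ q \is a Num.int.

Lemma torsion_mod1_subgroup : subgroup torsion_mod1.
Proof.
split; first by exists 1%N => //; rewrite mulr1n rpred0.
move=> r s [q q0 rq] [t t0 st]; exists (q * t)%N; first by rewrite muln_gt0 q0.
by rewrite mulrnBl mulrnA [X in _ - s *+ X]mulnC mulrnA rpredB// rpredMn.
Qed.

(* These maps replace the one-parameter subgroups of a connected group. *)
Lemma rational_approximation : exists rho : nat -> R -> R, [/\
  forall n r s, rho n (r + s) = rho n r + rho n s, forall n, rho n 1 = 1,
  forall n r, torsion_mod1 (rho n r) &
  forall r (e : R), 0 < e -> exists n0, forall n, (n0 <= n)%N -> `|rho n r - r| <= e].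
Proof.
(* Rational null sequences form a torsion-free divisible group, hence a direct summand of all
   sequences; the complement can be chosen to contain the constant sequence 1. *)
pose E : set (nat -> R) := [set u | (forall n, torsion_mod1 (u n)) /\
  forall e : R, 0 < e -> exists n0, forall n, (n0 <= n)%N -> `|u n| <= e].
have sE : subgroup E.
  split.
    split; first by move=> n; case: torsion_mod1_subgroup.
    by move=> e e0; exists 0%N => n _; rewrite normr0 ltW.
  move=> u v [u1 u2] [v1 v2]; split.
    by move=> n; case: torsion_mod1_subgroup => _; apply; [exact: u1|exact: v1].
  move=> e e0; have e20 : 0 < e / 2 by rewrite divr_gt0.
  have [n1 h1] := u2 _ e20; have [n2 h2] := v2 _ e20.
  exists (maxn n1 n2) => n; rewrite geq_max => /andP[/h1 a1 /h2 a2].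
  by rewrite [leRHS]splitr; apply: le_trans (ler_normB _ _) (lerD a1 a2).
have s0 : subgroup ([set 0] : set (nat -> R)) by split=> // _ _ -> ->; rewrite subr0.
have divE (u : nat -> R) m : E u -> (0 < m)%N ->
    exists2 v, E v & ([set 0] : set (nat -> R)) (u - v *+ m).
  move=> [u1 u2] m0; have m0R : 0 < m%:R :> R by rewrite ltr0n.
  have vE : (fun n => u n / m%:R) *+ m = u.
    apply/funext => n; have -> : ((fun n => u n / m%:R) *+ m) n = u n / m%:R *+ m.
      exact: fctMn.
    by rewrite -[LHS]mulr_natr divfK// gt_eqF.
  exists (fun n => u n / m%:R); last by rewrite vE subrr.
  split=> [n|e e0].
    have [q q0 uq] := u1 n; exists (m * q)%N; first by rewrite muln_gt0 m0.
    by rewrite mulrnA -[_ *+ m]mulr_natr divfK ?gt_eqF.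
  have [n0 h] := u2 e e0; exists n0 => n /h a1; rewrite normrM normfV (gtr0_norm m0R).
  rewrite ler_pdivrMr//; apply: (le_trans a1); rewrite -[leLHS]mulr1.
  by apply: ler_wpM2l; [exact: ltW|rewrite ler1n].
pose one : nat -> R := fun=> 1.
pose Q0 : set ((nat -> R) * (nat -> R)) :=
  [set z | exists (k : int), E z.2 /\ z.1 = z.2 + one *~ k].
have oneMz (k : int) n : (one *~ k) n = k%:~R.
  have oneMn (m : nat) : (one *+ m) n = m%:R by elim: m => // m IH; rewrite !mulrSr -IH.
  by case: k => m; rewrite ?NegzE ?mulrNz -!pmulrn ?oneMn// -[LHS]/(- (one *+ m.+1) n) oneMn.
have [] := @divisible_extension (nat -> R) (nat -> R) E [set 0] sE s0 divE Q0.
- split; first by exists 0; split; [case: sE|rewrite mulr0z addr0].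
  move=> [a u] [b v] [k [Eu ka]] [l [Ev lb]]; exists (k - l).
  split; first by case: sE => _; apply.
  by move: ka lb => /= -> ->; zmod.
- by move=> b x [k []].
- move=> x [k [[_ Ex] /= e]].
  have k0 : k = 0.
    have [n0 h] := Ex (1 / 2) ltac:(lra).
    have := h n0 (leqnn _); rewrite /=; have -> : x n0 = - k%:~R.
      have /(congr1 (fun u : nat -> R => u n0)) := e.
      rewrite -[RHS]/(x n0 + (one *~ k) n0) oneMz => /esym/eqP.
      by rewrite addr_eq0 => /eqP.
    rewrite normrN -intr_norm => lt; apply/eqP; rewrite -absz_eq0.
    suff : (`|k| < 1)%R by lia.
    by rewrite -(ltr_int R); lra.
  by move: e; rewrite k0 mulr0z addr0.
move=> f [fE fD fQ].
have fD' a b : f (a + b) = f a + f b by apply/eqP; rewrite -subr_eq0 fD.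
(* [qs r] tends to [r] through rationals but is additive only modulo [E]. Removing its component in
   [E] makes it additive without changing the limit. *)
pose qs (r : R) (n : nat) : R := (Num.floor (r * n.+1%:R))%:~R / n.+1%:R.
have qsint r n : torsion_mod1 (qs r n).
  exists n.+1 => //; rewrite -[_ *+ _]mulr_natr divfK ?pnatr_eq0//; exact: intr_int.
have qsb r n : `|qs r n - r| <= n.+1%:R^-1.
  have n0 : 0 < n.+1%:R :> R by rewrite ltr0n.
  have := floor_itv (r * n.+1%:R); rewrite intrD => /andP[h1 h2].
  have -> : qs r n - r = ((Num.floor (r * n.+1%:R))%:~R - r * n.+1%:R) / n.+1%:R.
    by rewrite /qs mulrBl mulfK ?gt_eqF.
  rewrite normrM normfV (gtr0_norm n0) -[leRHS]mul1r ler_pM2r ?invr_gt0//.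
  by rewrite ler_norml; apply/andP; split; lra.
have archi (e : R) : 0 < e -> exists n0, forall n, (n0 <= n)%N -> n.+1%:R^-1 <= e :> R.
  move=> e0; exists (Num.truncn e^-1) => n hn.
  rewrite -[e]invrK lef_pV2 ?posrE ?ltr0n ?invr_gt0//.
  by apply/ltW/(lt_le_trans (truncnS_gt _)); rewrite ler_nat ltnS.
have qsE r s : E (qs (r + s) - qs r - qs s).
  split=> [n|e e0].
    have sT := torsion_mod1_subgroup.
    by apply: (proj2 sT); [apply: (proj2 sT)|]; exact: qsint.
  have e30 : 0 < e / 3 by rewrite divr_gt0.
  have [n0 h] := archi _ e30; exists n0 => n /h nb.
  have -> : (qs (r + s) - qs r - qs s) n =
     (qs (r + s) n - (r + s)) - (qs r n - r) - (qs s n - s).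
    by rewrite -[LHS]/(qs (r + s) n - qs r n - qs s n); ring.
  have := qsb (r + s) n; have := qsb r n; have := qsb s n.
  move: nb (qs s n - s) (qs r n - r) (qs (r + s) n - (r + s)); move: (n.+1%:R^-1 : R).
  move=> d db a b c; rewrite !ler_norml => /andP[? ?] /andP[? ?] /andP[? ?].
  by apply/andP; split; lra.
have ffix u : E u -> f u = u.
  move=> Eu; apply/eqP; rewrite -subr_eq0; apply/eqP; apply: fQ.
  by exists 0; split=> //=; rewrite mulr0z addr0.
have f1 : f one = 0.
  have := fQ one 0; rewrite subr0; apply; exists 1; split; first by case: sE.
  by rewrite /= mulr1z add0r.
exists (fun n r => qs r n - f (qs r) n); split.
- move=> n r s; have := ffix _ (qsE r s).
  have -> : f (qs (r + s) - qs r - qs s) = f (qs (r + s)) - f (qs r) - f (qs s).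
    have -> : f (qs (r + s)) = f ((qs (r + s) - qs r - qs s) + (qs r + qs s)).
      by congr f; zmod.
    rewrite !fD'; zmod.
  move=> /(congr1 (fun u : nat -> R => u n)).
  rewrite -[LHS]/(f (qs (r + s)) n - f (qs r) n - f (qs s) n).
  by rewrite -[RHS]/(qs (r + s) n - qs r n - qs s n) => h; lra.
- move=> n; have -> : qs 1 = one.
    by apply/funext => m; rewrite /qs mul1r -[m.+1%:R]/(m.+1%:Z%:~R) intrKfloor divff// pnatr_eq0.
  by rewrite f1 -[one n]/(1 : R) subr0.
- move=> n r; apply: (proj2 torsion_mod1_subgroup); first exact: qsint.
  by have [h _] := fE (qs r); exact: h.
- move=> r e e0; have e20 : 0 < e / 2 by rewrite divr_gt0.
  have [_ h] := fE (qs r); have [n1 h1] := h _ e20; have [n2 h2] := archi _ e20.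
  exists (maxn n1 n2) => n; rewrite geq_max => /andP[/h1 a1 /h2 a2].
  rewrite addrAC [leRHS]splitr; apply: le_trans (ler_normB _ _) (lerD _ a1).
  exact: le_trans (qsb r n) a2.
Qed.

Lemma near_int_small (r : R) : (forall e, 0 < e -> near_int e r) -> r \is a Num.int.
Proof.
move=> H; apply: near_int_all => j.
have [|k rk] := H (1 / (10 * j.+1%:R)); first by rewrite divr_gt0 ?mulr_gt0 ?ltr0n.
exists (k *+ j); rewrite rmorphMn /= -mulrnBl normrMn -[leLHS]mulr_natr.
have j0 : 0 < j.+1%:R :> R by rewrite ltr0n.
apply: (@le_trans _ _ (1 / (10 * j.+1%:R) * j.+1%:R)).
  by apply: ler_pM => //; rewrite ler_nat.
by rewrite invfM mulrA divfK ?gt_eqF//; lra.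
Qed.

(** The small lift [c] at [1 / K] determines the small lifts at all [1 / (K * r)], since these do
    not wrap around. As [f 1] is an integer, [c *+ K] is an integer [n]; density and continuity do
    the rest. *)
Lemma real_character (f : R -> R) : pre_character f -> f 1 \is a Num.int ->
  (forall e, 0 < e -> exists2 d, 0 < d & forall s, `|s| <= d -> near_int e (f s)) ->
  exists n : int, forall s, f s - s *~ n \is a Num.int.
Proof.
move=> fP f1 fc.
have [d d0 dP] := fc (1 / 10) ltac:(lra).
pose K := (Num.truncn d^-1).+1.
have K0 : 0 < K%:R :> R by rewrite ltr0n.
have Kd : K%:R^-1 <= d.
  by rewrite -[d]invrK lef_pV2 ?posrE ?invr_gt0//; exact/ltW/truncnS_gt.
have fK s : `|s| <= K%:R^-1 -> near_int (1 / 10) (f s).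
  by move=> h; apply: dP; exact: le_trans Kd.
have [k kP] : near_int (1 / 10) (f K%:R^-1) by apply: fK; rewrite gtr0_norm// invr_gt0.
pose c := f K%:R^-1 - k%:~R.
have /intrP[n nE] : c *+ K \is a Num.int.
  have h : f 1 - f K%:R^-1 *+ K \is a Num.int.
    have := pre_characterMn fP K%:R^-1 K.
    by rewrite -[_ *+ K in X in f X]mulr_natr mulVf ?gt_eqF.
  have -> : c *+ K = f 1 - (f 1 - f K%:R^-1 *+ K) - k%:~R *+ K.
    by rewrite /c mulrnBl; ring.
  by apply: rpredB; [apply: rpredB|apply: rpredMn; exact: intr_int].
have cE : c = n%:~R / K%:R by rewrite -nE -[c *+ K]mulr_natr mulfK ?gt_eqF.
exists n.
pose h s := f s - s *~ n.
have hP : pre_character h.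
  move=> x y; have := fP x y; congr (_ \is a Num.int); rewrite /h mulrzDl; ring.
have hr r : (0 < r)%N -> h (K%:R * r%:R)^-1 \is a Num.int.
  move=> r0; have r0R : 0 < r%:R :> R by rewrite ltr0n.
  set t := (K%:R * r%:R)^-1.
  have t0 : 0 < t by rewrite invr_gt0 mulr_gt0.
  have tK : t * r%:R = K%:R^-1 by rewrite /t invfM divfK ?gt_eqF.
  have [l lP] : near_int (1 / (10 * r%:R)) (f t).
    apply: near_int_multiples => // j jr.
    have : near_int (1 / 10) (f (t *+ j)).
      apply: fK; rewrite -[t *+ j]mulr_natr ger0_norm; last by apply: mulr_ge0 => //; exact: ltW.
      by rewrite -tK ler_pM2l// ler_nat.
    by apply: near_int_cong; rewrite -rpredN opprB; exact: pre_characterMn.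
  pose c' := f t - l%:~R.
  have c'r : c' *+ r = c.
    have h1 : c' *+ r - c \is a Num.int.
      have := pre_characterMn fP t r; rewrite -[t *+ r]mulr_natr tK => h1.
      have -> : c' *+ r - c = k%:~R - (f K%:R^-1 - f t *+ r) - l%:~R *+ r.
        by rewrite /c' /c mulrnBl; ring.
      apply: rpredB; last by apply: rpredMn; exact: intr_int.
      by apply: rpredB => //; exact: intr_int.
    have h2 : `|c' *+ r - c| <= 2 / 10.
      have h2a : `|c' *+ r| <= 1 / 10.
        rewrite normrMn -[leLHS]mulr_natr -ler_pdivlMr//; apply: le_trans lP _.
        by rewrite invfM mulrA.
      by apply: le_trans (ler_normB _ _) _; move: kP h2a; rewrite -/c; lra.
    have /intrP[m mE] := h1; rewrite mE in h2.
    have m0 : m = 0.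
      apply/eqP; rewrite -absz_eq0; suff : (`|m| < 1)%R by lia.
      by rewrite -(ltr_int R) intr_norm; lra.
    by apply/eqP; rewrite -subr_eq0 mE m0.
  have -> : h t = l%:~R + (c' - t *~ n) by rewrite /h /c'; ring.
  have -> : c' = t *~ n.
    have -> : c' = c / r%:R by rewrite -c'r -[c' *+ r]mulr_natr mulfK ?gt_eqF.
    by rewrite cE -[t *~ n]mulrzl /t invfM mulrA.
  by rewrite subrr addr0 intr_int.
move=> s; rewrite -/(h s).
suff near s' : near_int (1 / 10) (h s').
  apply: near_int_all => j; apply: near_int_cong (near (s *+ j)).
  by rewrite -rpredN opprB; exact: pre_characterMn.
have [d2 d20 d2P] := fc (1 / 20) ltac:(lra).
pose d3 := Num.min d2 (1 / (20 * (`|n|%N.+1)%:R)).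
have n10 : 0 < (`|n|%N.+1)%:R :> R by rewrite ltr0n.
have d30 : 0 < d3 by rewrite lt_min d20 divr_gt0 ?mulr_gt0.
pose r := (Num.truncn d3^-1).+1.
have r0 : 0 < r%:R :> R by rewrite ltr0n.
have rd : (K%:R * r%:R)^-1 <= d3.
  rewrite -[d3]invrK lef_pV2 ?posrE ?invr_gt0 ?mulr_gt0//.
  apply: (@le_trans _ _ r%:R); first exact/ltW/truncnS_gt.
  by rewrite -[leLHS]mul1r ler_pM2r// ler1n.
set t := (K%:R * r%:R)^-1 in rd.
have t0 : 0 < t by rewrite invr_gt0 mulr_gt0.
pose j := Num.floor (s' / t).
have := floor_itv (s' / t); rewrite -/j intrD => /andP[j1 j2].
pose s2 := s' - t *~ j.
have s2b : `|s2| <= t.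
  rewrite ler_pdivlMr// in j1; rewrite ltr_pdivrMr// in j2.
  have -> : s2 = s' - j%:~R * t by rewrite /s2 mulrzl.
  by rewrite ler_norml; apply/andP; split; lra.
have hs : h s' - h s2 \is a Num.int.
  have := hP s2 (t *~ j); rewrite /s2 subrK -/s2 => h1.
  have h2 := pre_characterMz hP t j.
  have h3 : h t *~ j \is a Num.int by rewrite rpredMz// hr.
  have -> : h s' - h s2 = h s' - (h s2 + h (t *~ j)) + (h (t *~ j) - h t *~ j) + h t *~ j by ring.
  by apply: rpredD => //; exact: rpredD.
apply: near_int_cong hs _.
have [k2 k2P] : near_int (1 / 20) (f s2).
  by apply: d2P; apply: le_trans s2b _; apply: le_trans rd _; rewrite ge_min lexx.
exists k2; rewrite /h addrAC; apply: le_trans (ler_normB _ _) _.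
have : `|s2 *~ n| <= 1 / 20.
  rewrite -mulrzr normrM -intr_norm -abszE.
  have s2d : `|s2| <= 1 / (20 * (`|n|%N.+1)%:R).
    by apply: le_trans s2b _; apply: le_trans rd _; rewrite ge_min lexx orbT.
  apply: (@le_trans _ _ (1 / (20 * (`|n|%N.+1)%:R) * (`|n|%N.+1)%:R)).
    by apply: ler_pM => //; rewrite -pmulrn ler_nat.
  by rewrite invfM mulrA divfK ?gt_eqF//; lra.
move: k2P; lra.
Qed.

End real_line.

Lemma closed_groupP (L : topologicalZmodType) (N : set L) :
  (forall y, (forall U, nbhs (0 : L) U -> exists2 z, N z & U (z - y)) -> N y) ->
  closed N.
Proof.
move=> H y cy; apply: H => U U0.
have [|z [Nz Uz]] := cy [set z | U (z - y)]; last by exists z.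
by apply/group_nbhsE; apply: filterS U0 => z Uz /=; rewrite addrAC subrr add0r.
Qed.

Lemma closed_groupE (L : topologicalZmodType) (N : set L) y : closed N ->
  (forall U, nbhs (0 : L) U -> exists2 z, N z & U (z - y)) -> N y.
Proof.
move=> clN H; apply: clN => V /group_nbhsE V0; have [z Nz Vz] := H _ V0.
by exists z; split=> //; rewrite -[z](subrK y) addrC.
Qed.

Lemma nbhs_translate (L : topologicalZmodType) (x : L) U :
  nbhs (0 : L) U -> nbhs x [set y | U (y - x)].
Proof.
move=> U0; apply/group_nbhsE; apply: filterS U0 => z Uz /=.
by rewrite addrAC subrr add0r.
Qed.

Lemma group_nbhs0N (L : topologicalZmodType) (U : set L) :
  nbhs (0 : L) U -> nbhs (0 : L) [set y | U (- y)].
Proof.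
move=> /(group_baseB (nbhs0_group_base L))[V V0 VU].
have Vz := nbhs_singleton V0.
by apply: filterS V0 => y Vy /=; rewrite -sub0r; exact: VU.
Qed.

Lemma sequentially_closedP (L : topologicalZmodType) (S : set L) (u : nat -> L) l :
  sequentially_closed S -> (forall n, S (u n)) ->
  (forall U, nbhs (0 : L) U -> exists n0, forall n, (n0 <= n)%N -> U (u n - l)) ->
  S l.
Proof.
move=> Sc Su H; apply: (Sc u l Su) => W /group_nbhsE/H[n0 h].
by exists n0 => // n /h /=; rewrite addrC subrK.
Qed.

(** Otherwise there is a sequence with all pairwise differences outside [U], and it has no cluster
    point. *)
Lemma compact_finitely_covered (L : topologicalZmodType) (U : set L) :
  compact [set: L] -> nbhs (0 : L) U -> finitely_covered setT U.
Proof.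
move=> cL U0; apply: contrapT => ncov.
have ex (s : seq L) : exists x, forall f, f \in s -> ~ U (x - f).
  apply: contrapT => nex; apply: ncov; exists s => x _.
  apply: contrapT => nf; apply: nex; exists x => f fs Df; apply: nf; by exists f.
have [e eP] := prefix_choice ex.
have eD a b : (a < b)%N -> ~ U (e b - e a).
  by move=> ab; apply: eP; apply/mapP; exists a => //; rewrite mem_iota.
have [z [_ zc]] := cL (e @ \oo) _ filterT.
have [V V0 VU] := group_baseB (nbhs0_group_base L) U0.
have tail n : (e @ \oo) [set y | exists2 k, (n <= k)%N & y = e k].
  by exists n => // k /= nk; exists k.
have [_ [[a _ ->] Va]] := zc _ _ (tail 0%N) (nbhs_translate z V0).
have [_ [[b ab ->] Vb]] := zc _ _ (tail a.+1) (nbhs_translate z V0).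
apply: (eD _ _ ab); have := VU _ _ Vb Va; congr U; zmod.
Qed.

(** * Pontryagin duality by finite approximation *)

Section dual.
Context (R : realType).

Lemma near_int_add e e' (r s : R) :
  near_int e r -> near_int e' s -> near_int (e + e') (r + s).
Proof.
move=> [k kP] [l lP]; exists (k + l); rewrite intrD.
have -> : r + s - (k%:~R + l%:~R) = (r - k%:~R) + (s - l%:~R) by ring.
exact: le_trans (ler_normD _ _) (lerD kP lP).
Qed.

Lemma near_intN e (r : R) : near_int e r -> near_int e (- r).
Proof.
move=> [k kP]; exists (- k).
have -> : - r - (- k)%:~R = - (r - k%:~R) by rewrite rmorphN /=; ring.
by rewrite normrN.
Qed.

Lemma pre_character_sum (G : zmodType) (chi : G -> R) (I : Type) (s : seq I)
    (F : I -> G) : pre_character chi ->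
  chi (\sum_(i <- s) F i) - \sum_(i <- s) chi (F i) \is a Num.int.
Proof.
move=> cP; elim: s => [|i s IH].
  by rewrite !big_nil subr0; exact: pre_character0.
rewrite !big_cons; move: IH; set S := \sum_(j <- s) F j; set T := \sum_(j <- s) _.
by move=> IH; have := rpredD (cP (F i) S) IH; congr (_ \is a Num.int); ring.
Qed.

(** The topology of the torus pulled back to real vectors. [group_base] asks for no separation, so
    Følner's theorem applies to it directly. *)
Definition int_boxes l : set_system ('I_l -> R) :=
  [set W | exists2 e, 0 < e & W = [set v | forall i, near_int e (v i)]].

Lemma int_boxes_base l : group_base (@int_boxes l).
Proof.
split.
- by exists [set v | forall i, near_int 1 (v i)]; exists 1.
- by move=> _ [e e0 ->] i; apply: near_int_int (ltW e0) (rpred0 _).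
- move=> _ _ [e e0 ->] [d d0 ->].
  exists [set v | forall i, near_int (Num.min e d) (v i)].
    by exists (Num.min e d) => //; rewrite lt_min e0.
  by move=> v h; split=> i; apply: near_int_le (h i); rewrite ge_min lexx ?orbT.
- move=> _ [e e0 ->]; exists [set v | forall i, near_int (e / 2) (v i)].
    by exists (e / 2) => //; rewrite divr_gt0.
  move=> v w hv hw i; rewrite [e]splitr.
  exact: near_int_add (hv i) (near_intN (hw i)).
Qed.

Lemma int_boxes_covered l U :
  int_boxes U -> finitely_covered (setT : set ('I_l -> R)) U.
Proof.
move=> [e e0 ->]; pose k := (Num.truncn e^-1).+1.
have k0 : 0 < k%:R :> R by rewrite ltr0n.
have kn0 : k%:R != 0 :> R by rewrite gt_eqF.
have ke : k%:R^-1 <= e.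
  by rewrite -[e]invrK lef_pV2 ?posrE ?invr_gt0//; exact/ltW/truncnS_gt.
pose g (f : {ffun 'I_l -> 'I_k}) : 'I_l -> R := fun i => (f i : nat)%:R / k%:R.
exists [seq g f | f <- enum {: {ffun 'I_l -> 'I_k}}] => x _.
have ex i : exists m : 'I_k, near_int e (x i - (m : nat)%:R / k%:R).
  pose z := Num.floor (x i * k%:R).
  have r0 : 0 <= (z %% k%:Z)%Z by exact: modz_ge0.
  have rk : (z %% k%:Z)%Z < k%:Z by exact: ltz_pmod.
  have zk : (`|(z %% k%:Z)%Z| < k)%N by rewrite -ltz_nat gez0_abs.
  exists (Ordinal zk); exists (z %/ k%:Z)%Z => /=.
  have -> : x i - `|(z %% k%:Z)%Z|%N%:R / k%:R - (z %/ k%:Z)%Z%:~R =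
      (x i * k%:R - z%:~R) / k%:R.
    have -> : `|(z %% k%:Z)%Z|%N%:R = (z %% k%:Z)%Z%:~R :> R.
      by rewrite -[LHS]/((Posz `|(z %% k%:Z)%Z|%N)%:~R) gez0_abs.
    have := congr1 (fun t : int => t%:~R : R) (divz_eq z k%:Z).
    rewrite rmorphD rmorphM /= => ->; rewrite -[(k%:Z)%:~R]/(k%:R : R).
    by move: kn0; move: (_ %% _)%Z%:~R (_ %/ _)%Z%:~R => a b ?; field.
  rewrite normrM normfV (gtr0_norm k0); apply: le_trans ke.
  rewrite -[leRHS]mul1r ler_pM2r ?invr_gt0//.
  have := floor_itv (x i * k%:R); rewrite intrD -/z => /andP[z1 z2].
  by rewrite ler_norml; apply/andP; split; lra.
have [m mP] := choice ex.
exists (g (finfun m)); first by apply/mapP; exists (finfun m) => //; rewrite mem_enum.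
by move=> i; have := mP i; rewrite -[(x - _) i]/(x i - g (finfun m) i) /g ffunE.
Qed.

(** Kronecker's approximation theorem. The characters of the torus that are trivial on the image of
    [D] are integer vectors by [real_character]; by hypothesis they are trivial at [lam], which is
    therefore close to the image. *)
Lemma dual_finite (G0 : zmodType) (D : set G0) l (psi : 'I_l -> G0 -> R)
    (lam : 'I_l -> R) e :
  subgroup D -> (forall i, pre_character (psi i)) ->
  (forall n : 'I_l -> int,
     (forall t, D t -> \sum_i psi i t *~ n i \is a Num.int) ->
     \sum_i lam i *~ n i \is a Num.int) ->
  0 < e -> exists2 t, D t & forall i, near_int e (psi i t - lam i).
Proof.
move=> sD psiP H e0.
pose N : set ('I_l -> R) :=
  [set v | exists2 t, D t & forall i, v i - psi i t \is a Num.int].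
have sN : subgroup N.
  split.
    exists 0; first by case: sD.
    by move=> i; rewrite -[X in X \is a _]/(0 - psi i 0) sub0r rpredN; exact: pre_character0.
  move=> v w [t Dt vt] [s Ds ws]; exists (t - s); first by case: sD => _; exact.
  move=> i; have -> : (v - w) i - psi i (t - s) = (v i - psi i t) -
      (w i - psi i s) - (psi i (t - s) - (psi i t - psi i s)).
    by rewrite -[(v - w) i]/(v i - w i); ring.
  by apply: rpredB; [exact: rpredB|exact: pre_characterB].
have BU : int_boxes [set v : 'I_l -> R | forall i, near_int e (v i)] by exists e.
have [m [chi [c1 c2 c3 c4]]] :=
  characters_exist R (int_boxes_base l) (@int_boxes_covered l) sN BU.
pose ev i (s : R) : 'I_l -> R := fun i' => if i' == i then s else 0.
have evD i r s : ev i (r + s) = ev i r + ev i s.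
  by apply/funext => i'; rewrite -[RHS]/(ev i r i' + ev i s i') /ev; case: eqP; rewrite ?addr0.
have evint i (s : R) : s \is a Num.int -> N (ev i s).
  move=> si; exists 0; first by case: sD.
  move=> i'; apply: rpredB; last exact: pre_character0.
  by rewrite /ev; case: eqP => // _; exact: rpred0.
have chn j i : exists n : int, forall s, chi j (ev i s) - s *~ n \is a Num.int.
  apply: (@real_character R (fun s => chi j (ev i s))).
  - by move=> r s; rewrite evD; exact: c1.
  - by apply: c3; apply: evint; exact: rpred1.
  - move=> d d0; have [_ [d' d'0 ->] h] := c2 j d d0; exists d' => // s sd.
    apply: h => i'; exists 0; rewrite subr0 /ev.
    by case: eqP => // _; rewrite normr0 ltW.
have chE j (v : 'I_l -> R) (n : 'I_l -> int) :
    (forall i s, chi j (ev i s) - s *~ n i \is a Num.int) ->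
    chi j v - \sum_i v i *~ n i \is a Num.int.
  move=> nP; have vE : v = \sum_i ev i (v i).
    apply/funext => i; rewrite fct_sumE (bigD1 i)//= big1 ?addr0 /ev ?eqxx// => k.
    by rewrite eq_sym => /negPf ->.
  have h1 := pre_character_sum (index_enum 'I_l) (fun i => ev i (v i)) (c1 j).
  have h2 : \sum_i chi j (ev i (v i)) - \sum_i v i *~ n i \is a Num.int.
    by rewrite -sumrB; apply: rpred_sum => i _; exact: nP.
  by have := rpredD h1 h2; rewrite addrA subrK -vE.
have chi_lam j : chi j lam \is a Num.int.
  have [n nP] := choice (chn j).
  have hl := chE j lam n nP.
  have hs : \sum_i lam i *~ n i \is a Num.int.
    apply: H => t Dt.
    have hN : chi j (fun i => psi i t) \is a Num.int.
      by apply: c3; exists t => // i; rewrite subrr rpred0.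
    by have := rpredB hN (chE j (fun i => psi i t) n nP); rewrite subKr.
  by have := rpredD hl hs; rewrite subrK.
have [|v [t Dt vt] Uv] := c4 lam.
  by move=> j; apply: near_int_int => //; lra.
exists t => // i; have := near_intN (Uv i); apply: near_int_cong.
have -> : psi i t - lam i - - (lam - v) i = - (v i - psi i t).
  by rewrite -[(lam - v) i]/(lam i - v i); ring.
by rewrite rpredN.
Qed.

Definition cchar (K : topologicalZmodType) (chi : K -> R) :=
  pre_character chi /\ continuous_at0 (nbhs (0 : K)) chi.

Section compact_dual.
Context (K : topologicalZmodType).

Lemma cchar_subgroup : subgroup (@cchar K).
Proof.
split.
  split; first by move=> x y; rewrite -[X in X \is a _]/((0 : R) - (0 + 0)) addr0 subr0 rpred0.
  move=> e e0; exists setT; first exact: filterT.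
  by move=> v _; apply: near_int_int (ltW e0) (rpred0 _).
move=> chi psi [c1 c2] [p1 p2].
have subE z : (chi - psi) z = chi z - psi z by [].
split.
  move=> x y; rewrite !subE; have := rpredB (c1 x y) (p1 x y).
  by congr (_ \is a Num.int); ring.
move=> e e0; have e20 : 0 < e / 2 by rewrite divr_gt0.
have [V V0 Vc] := c2 _ e20; have [W W0 Wp] := p2 _ e20.
exists (V `&` W); first exact: filterI.
move=> v [/Vc h1 /Wp h2]; rewrite subE [e]splitr.
exact: near_int_add h1 (near_intN h2).
Qed.

(** Characters of the dual are evaluations: [dual_finite] meets finitely many conditions inside [D],
    and compactness meets them all at once. *)
Lemma dual_point (D : set K) (lam : (K -> R) -> R) :
  compact [set: K] -> subgroup D -> closed D -> pre_character lam ->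
  (forall chi, cchar chi -> (forall t, D t -> chi t \is a Num.int) ->
     lam chi \is a Num.int) ->
  exists2 t, D t & forall chi, cchar chi -> chi t - lam chi \is a Num.int.
Proof.
move=> cK sD clD lamP H.
pose I := [set z : seq (K -> R) * R |
  (forall chi, chi \in z.1 -> cchar chi) /\ 0 < z.2].
pose A (z : seq (K -> R) * R) : set K :=
  [set t | D t /\ forall chi, chi \in z.1 -> near_int z.2 (chi t - lam chi)].
have Ane z : I z -> A z !=set0.
  move=> [zc z0].
  have [|||t Dt tP] := @dual_finite K D (size z.1) (fun i => nth 0 z.1 i)
    (fun i => lam (nth 0 z.1 i)) z.2 sD.
  - by move=> i; have [] := zc _ (mem_nth 0 (ltn_ord i)).
  - move=> n hn; pose chi : K -> R := \sum_(i < size z.1) nth 0 z.1 i *~ n i.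
    have cc : cchar chi.
      apply: (subgroup_sum cchar_subgroup) => i _.
      by apply: (subgroupMz cchar_subgroup); exact: zc (mem_nth 0 (ltn_ord i)).
    have chiE t : chi t = \sum_i nth 0 z.1 (i : 'I_(size z.1)) t *~ n i.
      by rewrite /chi fct_sumE; apply: eq_bigr => i _; rewrite fctMz.
    have lc : lam chi \is a Num.int by apply: H => // t Dt; rewrite chiE; exact: hn.
    have h1 := pre_character_sum (index_enum 'I_(size z.1))
      (fun i => nth 0 z.1 i *~ n i) lamP.
    have h2 : \sum_i lam (nth 0 z.1 (i : 'I_(size z.1)) *~ n i) -
        \sum_(i < size z.1) lam (nth 0 z.1 i) *~ n i \is a Num.int.
      by rewrite -sumrB; apply: rpred_sum => i _; exact: pre_characterMz.
    by have := rpredB lc (rpredD h1 h2); rewrite addrA subrK subKr.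
  - exact: z0.
  exists t; split=> // chi chiz.
  have ltc : (index chi z.1 < size z.1)%N by rewrite index_mem.
  by have := tP (Ordinal ltc); rewrite /= nth_index.
pose F := filter_from I A.
have FF : ProperFilter F.
  apply: filter_from_proper => //; apply: filter_from_filter.
    by exists ([::], 1); split=> //=.
  move=> z z' [zc z0] [zc' z0']; exists (z.1 ++ z'.1, Num.min z.2 z'.2).
    split=> [chi|] /=; last by rewrite lt_min z0.
    by rewrite mem_cat => /orP[/zc|/zc'].
  move=> t [Dt tP]; split; split=> // chi cz.
    apply: near_int_le (tP chi _); first by rewrite /= ge_min lexx.
    by rewrite mem_cat cz.
  apply: near_int_le (tP chi _); first by rewrite /= ge_min lexx orbT.
  by rewrite mem_cat cz orbT.
have FI z : I z -> F (A z) by move=> Iz; exists z.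
have [t [_ tF]] := cK F FF filterT.
have I1 chi e : cchar chi -> 0 < e -> I ([:: chi], e).
  by move=> cc e0; split=> //= psi; rewrite inE => /eqP ->.
exists t.
  apply: clD => V Vt; have I0 : I ([::], 1) by split.
  by have [s [[Ds _] Vs]] := tF _ _ (FI _ I0) Vt; exists s.
move=> chi cc; apply: near_int_small => e e0; have e20 : 0 < e / 2 by rewrite divr_gt0.
have [V V0 VP] := cc.2 (e / 2) e20.
have [s [[Ds sP] Vs]] := tF _ _ (FI _ (I1 chi _ cc e20)) (nbhs_translate t V0).
have h1 := sP chi (mem_head _ _); have h2 := VP _ Vs.
have := near_int_add h1 (near_intN h2); rewrite -splitr; apply: near_int_cong.
have := pre_characterB cc.1 s t; congr (_ \is a Num.int); ring.
Qed.

Hypothesis Kpc : forall U, nbhs (0 : K) U -> finitely_covered setT U.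

Lemma chars_base U : nbhs (0 : K) U -> exists m (chi : 'I_m -> K -> R),
  (forall j, cchar (chi j)) /\
  forall x, (forall j, near_int (1 / 8) (chi j x)) -> U x.
Proof.
move=> U0.
have s0 : subgroup ([set 0] : set K) by split=> // _ _ -> ->; rewrite subr0.
have [m [chi [h1 h2 h3 h4]]] := characters_exist R (nbhs0_group_base K) Kpc s0 U0.
exists m, chi; split=> [j|x /h4[_ ->]]; first by split.
by rewrite subr0.
Qed.

Lemma chars_closed (N : set K) x : subgroup N -> closed N -> ~ N x ->
  exists chi, [/\ cchar chi, forall y, N y -> chi y \is a Num.int &
    chi x \isn't a Num.int].
Proof.
move=> sN clN Nx.
have : nbhs x (~` N) by apply: open_nbhs_nbhs; split=> //; exact: closed_openC.
move=> /group_nbhsE/group_nbhs0N U0.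
have [m [chi [h1 h2 h3 h4]]] := characters_exist R (nbhs0_group_base K) Kpc sN U0.
apply: contrapT => nex; have [j|n Nn] := h4 x.
  apply: near_int_int; first lra.
  apply: contrapT => /negP nj; apply: nex; exists (chi j); split=> //.
  exact: h3.
by rewrite /= opprB addrC subrK.
Qed.

Lemma chars_separate (x : K) : hausdorff_space K ->
  (forall chi : K -> R, cchar chi -> chi x \is a Num.int) -> x = 0.
Proof.
move=> hK H; apply: (hausdorff_nbhs0 hK) => U /chars_base[m [chi [c1 c2]]].
by apply: c2 => j; apply: near_int_int; [lra|exact: H].
Qed.

(** Finitely many characters control a neighbourhood, so the index may depend on the character. *)
Lemma chars_cvg (S : set K) (u : nat -> K) l : sequentially_closed S ->
  (forall n, S (u n)) ->
  (forall chi : K -> R, cchar chi -> exists n0, forall n, (n0 <= n)%N ->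
     near_int (1 / 8) (chi (u n) - chi l)) -> S l.
Proof.
move=> Sc Su H; apply: (sequentially_closedP Sc Su) => U /chars_base[m [chi [c1 c2]]].
have [n0 n0P] := choice (fun j => H _ (c1 j)).
exists (\max_j n0 j)%N => n hn; apply: c2 => j.
have := n0P j n (leq_trans (leq_bigmax j) hn); apply: near_int_cong.
by have [cj _] := c1 j; exact: pre_characterB.
Qed.

End compact_dual.

Definition pi_torsion (pi : nat_pred) (r : R) :=
  exists2 q, pi.-nat q & r *+ q \is a Num.int.

Lemma pi_torsion_int pi r : r \is a Num.int -> pi_torsion pi r.
Proof. by exists 1%N. Qed.

Lemma pi_torsion_subgroup pi : subgroup (pi_torsion pi).
Proof.
split; first by apply: pi_torsion_int; exact: rpred0.
move=> r s [q q0 rq] [t t0 st]; exists (q * t)%N; first by rewrite pnatM q0.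
rewrite mulrnBl mulrnA [X in _ - s *+ X]mulnC mulrnA.
by apply: rpredB; exact: rpredMn.
Qed.

Lemma pi_torsion_cong pi r s : r - s \is a Num.int -> pi_torsion pi s -> pi_torsion pi r.
Proof.
move=> rs ps; rewrite -[r](subrK s).
by apply: (subgroupD (pi_torsion_subgroup pi)) => //; exact: pi_torsion_int.
Qed.

Lemma int_gcd (r : R) a b : (0 < a)%N -> r *+ a \is a Num.int ->
  r *+ b \is a Num.int -> r *+ gcdn a b \is a Num.int.
Proof.
move=> a0 ra rb; case: (egcdnP b a0) => km kn e _.
have -> : r *+ gcdn a b = r *+ a *+ km - r *+ b *+ kn.
  by rewrite -!mulrnA [(a * km)%N]mulnC e mulrnDr [(b * kn)%N]mulnC addrC addKr.
by apply: rpredB; exact: rpredMn.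
Qed.

Lemma pi_torsion_trivial pi r : pi_torsion pi r -> pi_torsion (negn pi) r -> r \is a Num.int.
Proof.
move=> [q q0 rq] [t t0 rt]; have /andP[q1 _] := q0.
have := int_gcd q1 rq rt.
by have /eqP -> := pnat_coprime q0 t0.
Qed.

Lemma torsion_split pi r : torsion_mod1 r ->
  exists2 s, pi_torsion pi s & pi_torsion (negn pi) (r - s).
Proof.
move=> [q q0 rq]; have qE := partnC pi q0.
have a0 : (0 < q`_pi)%N by exact: part_gt0.
have /eqP cop := coprime_partC pi q q.
case: (egcdnP q`_(negn pi) a0) => km kn; rewrite cop => e _.
exists (- (r *+ (kn * q`_(negn pi)))).
  exists (q`_pi)%N; first exact: part_pnat.
  rewrite mulNrn rpredN -mulrnA -mulnA [(q`_(negn pi) * _)%N]mulnC qE mulnC mulrnA.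
  exact: rpredMn.
exists (q`_(negn pi))%N; first exact: part_pnat.
rewrite opprK -{1}[r]mulr1n -mulrnDr addnC -e -mulrnA -mulnA qE mulnC mulrnA.
exact: rpredMn.
Qed.

(** [y] is the [pi]-component of [x]. The projection of the rationals modulo 1 to their [pi]-part
    extends by divisibility to a map [f] on the reals, additive modulo 1, and duality gives the
    point of [T] with characters [f (chi x)]. *)
Lemma torsion_decomposition (K : topologicalZmodType) (T : set K) x pi :
  compact [set: K] -> subgroup T -> closed T -> T x ->
  (forall chi, cchar chi -> torsion_mod1 (chi x)) ->
  exists y, [/\ T y, forall chi, cchar chi -> pi_torsion pi (chi y) &
    forall chi, cchar chi -> pi_torsion (negn pi) (chi x - chi y)].
Proof.
move=> cK sT clT Tx xt.
pose Q0 := [set z : R * R | pi_torsion pi z.2 /\ pi_torsion (negn pi) (z.1 - z.2)].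
pose Z0 := [set r : R | r \is a Num.int].
have sX : subgroup [set: R] by [].
have sZ : subgroup Z0 by split=> [|r s rZ sZ]; [exact: rpred0|exact: rpredB].
have [r n _ n0||||f [_ fD fQ]] := @divisible_extension R R setT Z0 sX sZ _ Q0.
- exists (r / n%:R) => //; rewrite -[_ *+ n]mulr_natr divfK ?pnatr_eq0 -?lt0n//.
  by rewrite subrr; exact: rpred0.
- split.
    by split=> /=; [|rewrite subr0]; case: (pi_torsion_subgroup pi); case: (pi_torsion_subgroup (negn pi)).
  move=> [a b] [c d] [/= h1 h2] [/= h3 h4]; split=> /=.
    exact: (pi_torsion_subgroup pi).2.
  have -> : a - c - (b - d) = (a - b) - (c - d) by ring.
  exact: (pi_torsion_subgroup (negn pi)).2.
- by [].
- move=> r [/= h1]; rewrite sub0r => h2; apply: (pi_torsion_trivial h1).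
  by rewrite -[r]opprK; exact: (subgroupN (pi_torsion_subgroup (negn pi))).
have [||y Ty yP] := @dual_point K T (fun chi => f (chi x)) cK sT clT.
- by move=> chi psi; exact: fD.
- move=> chi cc /(_ x Tx) cx; have := fQ (chi x) 0; rewrite subr0; apply.
  split=> /=; first by case: (pi_torsion_subgroup pi).
  by rewrite subr0; exact: pi_torsion_int.
exists y; split=> // chi cc; have [s s1 s2] := torsion_split pi (xt _ cc).
  have h := fQ (chi x) s (conj s1 s2); apply: pi_torsion_cong s1.
  by have := rpredD (yP _ cc) h; rewrite addrA subrK.
have h := fQ (chi x) s (conj s1 s2); apply: pi_torsion_cong s2.
have := rpredD (yP _ cc) h; rewrite addrA subrK -rpredN.
by congr (_ \is a Num.int); ring.
Qed.

End dual.

(** * Essential subgroups and closures of cyclic groups *)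

Definition essential (L : topologicalZmodType) (S : set L) :=
  forall N : set L, subgroup N -> closed N -> (exists2 x, N x & x <> 0) ->
    exists y, [/\ N y, S y & y <> 0].

Section cyclic_closure.
Context (L : topologicalZmodType) (x : L) (p : nat).

(** The closure of the cyclic group generated by [x *+ p ^ n]. *)
Definition multiple_closure n : set L := [set y | forall U, nbhs (0 : L) U ->
  exists b : int, U (y - x *~ (b * (p ^ n)%N%:Z))].
Local Notation C := multiple_closure.

Lemma multiple_closure_subgroup n : subgroup (C n).
Proof.
split; first by move=> U /nbhs_singleton U0; exists 0; rewrite mul0r mulr0z subr0.
move=> y z Cy Cz U /(group_baseB (nbhs0_group_base L))[V V0 VU].
have [b Vb] := Cy _ V0; have [c Vc] := Cz _ V0; exists (b - c).
have := VU _ _ Vb Vc; congr U; rewrite mulrBl; move: (b * _) (c * _) => b' c'; zmod.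
Qed.

Lemma multiple_closure_closed n : closed (C n).
Proof.
apply: closed_groupP => y H U /(group_baseB (nbhs0_group_base L))[V V0 VU].
have [z Cz Vz] := H _ V0; have [b Vb] := Cz _ V0; exists b.
by have := VU _ _ Vb Vz; congr U; move: (b * _) => b'; zmod.
Qed.

Lemma multiple_closure_mem n (b : int) : C n (x *~ (b * (p ^ n)%N%:Z)).
Proof. by move=> U /nbhs_singleton U0; exists b; rewrite subrr. Qed.

Lemma multiple_closureS m n : (m <= n)%N -> C n `<=` C m.
Proof.
move=> mn y Cy U U0; have [b Ub] := Cy U U0; exists (b * (p ^ (n - m))%N%:Z).
by rewrite -mulrA -PoszM -expnD subnK.
Qed.

(** The closure of index [v] is a finite union of cosets of that of index [n]: otherwise each of the
    [p ^ (n - v)] residues is excluded by a neighbourhood, and the intersection of these contradicts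
    [C v y]. *)
Lemma multiple_closure_residue v n y : (0 < p)%N -> (v <= n)%N -> C v y ->
  exists b : int, C n (y - x *~ (b * (p ^ v)%N%:Z)).
Proof.
move=> p0 vn Cy; apply: contrapT => nex.
have ex (b : nat) : exists U, nbhs (0 : L) U /\ forall c : int,
    ~ U (y - x *~ (b%:Z * (p ^ v)%N%:Z) - x *~ (c * (p ^ n)%N%:Z)).
  apply: contrapT => h; apply: nex; exists b%:Z => U U0.
  apply: contrapT => h'; apply: h; exists U; split=> // c Uc; apply: h'; by exists c.
have [U UP] := choice ex.
have [W W0 WU] : exists2 W, nbhs (0 : L) W & forall b, (b < p ^ (n - v))%N -> W `<=` U b.
  elim: (p ^ (n - v))%N => [|k [W W0 WU]]; first by exists setT => //; exact: filterT.
  exists (W `&` U k); first by apply: filterI => //; case: (UP k).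
  move=> b; rewrite ltnS leq_eqVlt => /orP[/eqP -> z []//|/WU WUb z [/WUb]//].
have [b Wb] := Cy W W0.
set k := (p ^ (n - v))%N in WU; have k0 : (0 < k)%N by rewrite expn_gt0 p0.
have r0 : 0 <= (b %% k%:Z)%Z by apply: modz_ge0; rewrite eqz_nat -lt0n.
have rk : (b %% k%:Z)%Z < k%:Z by exact: ltz_pmod.
have lt : (`|(b %% k%:Z)%Z| < k)%N by rewrite -ltz_nat gez0_abs.
have [_ /(_ (b %/ k%:Z)%Z)] := UP `|(b %% k%:Z)%Z|%N; apply.
have := WU _ lt _ Wb; congr (U _ _); rewrite gez0_abs//.
have -> : (p ^ n)%N%:Z = k%:Z * (p ^ v)%N%:Z by rewrite -PoszM -expnD subnK.
rewrite {1}(divz_eq b k%:Z) mulrA mulrDl.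
move: ((b %/ k%:Z)%Z * k%:Z * (p ^ v)%N%:Z) ((b %% k%:Z)%Z * (p ^ v)%N%:Z) => b1 b2; zmod.
Qed.

Hypothesis p_prime : prime p.
Hypothesis L_hausdorff : hausdorff_space L.
Hypothesis x_torsion : forall U, nbhs (0 : L) U ->
  exists n, forall b : int, U (x *~ (b * (p ^ n)%N%:Z)).

Lemma multiple_closure_small U : nbhs (0 : L) U -> exists n, C n `<=` U.
Proof.
move=> /(group_base_sum (nbhs0_group_base L) 2)[V V0 VU].
have [n nP] := x_torsion V0; exists n => y /(_ V V0)[b Vb].
have := VU [:: y - x *~ (b * (p ^ n)%N%:Z); x *~ (b * (p ^ n)%N%:Z)].
rewrite !big_cons big_nil addr0 subrK; apply=> // t.
by rewrite !inE => /orP[] /eqP ->; left.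
Qed.

(* The closure of the cyclic group of [x] is a quotient of the [p]-adic
   integers: an element [y] of it is [p ^ v] times a unit times [x], so that
   suitable multiples of [y] converge to [x *+ p ^ v]. *)
Lemma essential_multiple (S : set L) : subgroup S -> sequentially_closed S ->
  essential S -> x <> 0 -> exists m, S (x *+ p ^ m) /\ x *+ p ^ m <> 0.
Proof.
move=> sS Sc Se x0; have p0 := prime_gt0 p_prime.
have Cx : C 0 x by have := multiple_closure_mem 0 1; rewrite expn0 mulr1 mulr1z.
have [|y [Cy Sy y0]] := Se _ (multiple_closure_subgroup 0) (multiple_closure_closed (n := 0%N)).
  by exists x.
have exv : exists v, ~~ `[< C v y >].
  apply: contrapT => h; apply: y0; apply: (hausdorff_nbhs0 L_hausdorff) => U U0.
  have [n CU] := multiple_closure_small U0; apply: CU; apply/asboolP.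
  by apply: contrapT => /negP h'; apply: h; exists n.
have [[|v] /asboolPn nCv vmin] := ex_minnP exv; first by case: (nCv).
have Cv : C v y.
  apply/asboolP; apply: contrapT => /negP h; have := vmin _ h.
  by rewrite ltnn.
(* [b] is prime to [p] because [y] is not in the closure of index [v.+1]. An inverse of [b] modulo a
   high power of [p] turns [y] into [x *+ p ^ v] up to a small error. *)
have w_ex n : exists w : int, C (n + v.+1)%N (y *~ w - x *+ p ^ v).
  have lev : (v <= n + v.+1)%N by lia.
  have [b Cb] := multiple_closure_residue p0 lev Cv.
  have /coprimezP[[u t] /= ut] : coprimez b ((p ^ (n + v.+1))%N%:Z).
    rewrite coprimezE absz_nat coprimeXr// coprime_sym prime_coprime//.
    apply/negP => pb; apply: nCv.
    have /dvdzP[c cE] : (p%:Z %| b)%Z by rewrite dvdzE.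
    have le2 : (v.+1 <= n + v.+1)%N by lia.
    have h1 := multiple_closureS le2 Cb.
    have := subgroupD (multiple_closure_subgroup v.+1) h1 (multiple_closure_mem v.+1 c).
    by rewrite cE -mulrA -PoszM -expnS subrK.
  exists u.
  have h1 := subgroupMz (multiple_closure_subgroup _) u Cb.
  have h2 := multiple_closure_mem (n + v.+1) (- t * (p ^ v)%N%:Z).
  have := subgroupD (multiple_closure_subgroup _) h1 h2; congr (C _ _).
  have -> : x *+ p ^ v = x *~ ((p ^ v)%N%:Z * (u * b + t * (p ^ (n + v.+1))%N%:Z)).
    by rewrite ut mulr1 pmulrn.
  have -> : - t * (p ^ v)%N%:Z * (p ^ (n + v.+1))%N%:Z = u * b * (p ^ v)%N%:Z
    - (p ^ v)%N%:Z * (u * b + t * (p ^ (n + v.+1))%N%:Z) by ring.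
  move: (_ * (_ + _)) => d; rewrite mulrzBl -mulrzA mulrzBr mulrAC -mulrA [u * _]mulrC.
  by rewrite -[b * u * _]mulrA; move: (b * (u * _)) => d'; zmod.
have [w wP] := choice w_ex.
exists v; split.
  apply: (sequentially_closedP Sc (u := fun n => y *~ w n)).
    by move=> n; exact: subgroupMz.
  move=> U U0; have [n CU] := multiple_closure_small U0; exists n => k nk.
  by apply: CU; apply: multiple_closureS (wP k); lia.
move=> xv0; apply: y0; apply: (hausdorff_nbhs0 L_hausdorff) => U U0.
have [b] := Cv U U0; rewrite mulrC mulrzA.
by rewrite -pmulrn xv0 mul0rz subr0.
Qed.

End cyclic_closure.

(** * Essential subgroups of compact groups *)

Lemma hausdorff_groupP (L : topologicalZmodType) :
  (forall x : L, (forall U, nbhs (0 : L) U -> U x) -> x = 0) -> hausdorff_space L.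
Proof.
move=> H p q pq; apply/eqP; rewrite -subr_eq0; apply/eqP/H => U U0.
have [V V0 VU] := group_baseB (nbhs0_group_base L) U0.
have [z [Vp Vq]] := pq _ _ (nbhs_translate p (group_nbhs0N V0)) (nbhs_translate q (group_nbhs0N V0)).
by have := VU _ _ Vp Vq; congr U; zmod.
Qed.

Lemma compact_decreasing (L : topologicalType) (A : nat -> set L) :
  compact [set: L] -> (forall n, closed (A n)) -> (forall n, A n !=set0) ->
  (forall n, A n.+1 `<=` A n) -> exists x, forall n, A n x.
Proof.
move=> cL Acl Ane Adec.
have Am m n : (m <= n)%N -> A n `<=` A m.
  by move=> /subnK <-; elim: (n - m)%N => // k IH x; rewrite addSn => /Adec; exact: IH.
pose F := filter_from [set: nat] A.
have FF : ProperFilter F.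
  apply: filter_from_proper => //; apply: filter_from_filter; first by exists 0%N.
  move=> m n _ _; exists (maxn m n) => // x Ax.
  by split; apply: Am Ax; rewrite ?leq_maxl ?leq_maxr.
have [x [_ xF]] := cL F FF filterT.
exists x => n; apply: Acl => V Vx.
have FA : F (A n) by exists n.
by have [y [Ay Vy]] := xF (A n) V FA Vx; exists y.
Qed.

Lemma mulrn_continuous (L : topologicalZmodType) n :
  continuous (fun y : L => y *+ n).
Proof.
move=> y W /group_nbhsE/(group_baseMz (nbhs0_group_base L) n)[V V0 VU].
apply/group_nbhsE; apply: filterS V0 => z Vz /=; rewrite mulrnDl.
by have := VU z n%:Z (leqnn _) Vz.
Qed.

Definition divisible_part (L : zmodType) : set L :=
  [set x | forall n, (0 < n)%N -> exists y, y *+ n = x].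
Arguments divisible_part : clear implicits.

Lemma divisible_part_subgroup (L : zmodType) : subgroup (divisible_part L).
Proof.
split=> [n _|x y Dx Dy n n0]; first by exists 0; rewrite mul0rn.
have [x' <-] := Dx n n0; have [y' <-] := Dy n n0.
by exists (x' - y'); rewrite mulrnBl.
Qed.

Section compact_group.
Context (L : topologicalZmodType).
Hypothesis cL : compact [set: L].
Hypothesis hL : hausdorff_space L.

Let Lpc U : nbhs (0 : L) U -> finitely_covered setT U.
Proof. exact: compact_finitely_covered. Qed.

Lemma multiples_closed n : closed [set y *+ n | y in [set: L]].
Proof.
apply: compact_closed => //; apply: continuous_compact => //.
exact: continuous_subspaceT (@mulrn_continuous L n).
Qed.

Lemma multiples_of_subgroup n : subgroup [set y *+ n | y in [set: L]].
Proof.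
split; first by exists 0; rewrite ?mul0rn.
by move=> _ _ [y _ <-] [z _ <-]; exists (y - z); rewrite ?mulrnBl.
Qed.

Lemma divisible_part_closed : closed (divisible_part L).
Proof.
move=> y cy n n0; have [|z _ zy] := @multiples_closed n y; last by exists z.
move=> V Vy; have [z [Dz Vz]] := cy V Vy; have [w wz] := Dz n n0.
by exists z; split=> //; exists w.
Qed.

Lemma multiples_fact (y : L) : (forall n, exists z, z *+ n`! = y) -> divisible_part L y.
Proof.
move=> H n n0; have [z <-] := H n.
have /dvdnP[k ->] : (n %| n`!)%N by rewrite dvdn_fact// n0 leqnn.
by exists (z *+ k); rewrite mulrnA.
Qed.

(** Factorials turn divisibility by all integers into a decreasing sequence of closed conditions, so
    that compactness gives one solution meeting all of them. *)
Lemma divisible_part_divisible x p : (0 < p)%N -> divisible_part L x ->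
  exists2 y, divisible_part L y & y *+ p = x.
Proof.
move=> p0 Dx.
have [n|n|n|y yP] := @compact_decreasing L
  (fun n => [set y | y *+ p = x] `&` [set z *+ n`! | z in [set: L]]) cL.
- apply: closedI; last exact: multiples_closed.
  move=> y cy; apply/eqP; rewrite -subr_eq0; apply/eqP.
  apply: (hausdorff_nbhs0 hL) => U /(group_baseMz (nbhs0_group_base L) p)[V V0 VU].
  have [z [zx Vz]] := cy _ (nbhs_translate y (group_nbhs0N V0)).
  rewrite /= in zx Vz; have := VU _ p%:Z (leqnn _) Vz; rewrite -pmulrn opprB mulrnBl.
  by rewrite zx.
- have [|z zx] := Dx (n`! * p)%N; first by rewrite muln_gt0 fact_gt0.
  by exists (z *+ n`!); split; [rewrite /= -mulrnA|exists z].
- move=> y [yx [z _ zy]]; split=> //; exists (z *+ n.+1) => //.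
  by rewrite -mulrnA -factS.
exists y; last by have [] := yP 0%N.
by apply: multiples_fact => n; have [_ [z _ <-]] := yP n; exists z.
Qed.

(** A point outside the multiples of [n] is detected by a character trivial on them. Its values have
    order dividing [n], so its kernel is open and closed, and contains the component. *)
Lemma zero_component_divisible (R : realType) :
  zero_component L `<=` divisible_part L.
Proof.
move=> x cx n n0; apply: contrapT => nx.
have [|chi [[c1 c2] chiN chix]] := @chars_closed R L Lpc _ x
    (multiples_of_subgroup n) (@multiples_closed n).
  by move=> [y _ yx]; apply: nx; exists y.
have chin y : chi y *+ n \is a Num.int.
  have h : chi (y *+ n) \is a Num.int by apply: chiN; exists y.
  by have := rpredB h (pre_characterMn c1 y n); rewrite subKr.
pose E := [set y | chi y \is a Num.int].
have nR : 0 < n%:R :> R by rewrite ltr0n.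
have [U U0 UE] : exists2 U, nbhs (0 : L) U & U `<=` E.
  have [|V V0 VP] := c2 (1 / (10 * n%:R)); first by rewrite divr_gt0 ?mulr_gt0.
  exists V => // v /VP[k kP] /=.
  have /intrP[m mE] : (chi v - k%:~R) *+ n \is a Num.int.
    by rewrite mulrnBl; apply: rpredB => //; apply: rpredMn; exact: intr_int.
  have m0 : m = 0.
    apply/eqP; rewrite -absz_eq0; suff : (`|m| < 1)%R by lia.
    rewrite -(ltr_int R) intr_norm -mE normrMn -[ltLHS]mulr_natr.
    have : `|chi v - k%:~R| * n%:R <= 1 / (10 * n%:R) * n%:R by rewrite ler_pM2r.
    by rewrite invfM mulrA divfK ?gt_eqF//; lra.
  have : chi v - k%:~R = 0.
    by apply/eqP; have := mE; rewrite m0 => /eqP; rewrite mulrn_eq0 eqn0Ngt n0.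
  by move=> /eqP; rewrite subr_eq0 => /eqP e; rewrite /E /= e; exact: intr_int.
have sE : subgroup E.
  split; first exact: pre_character0.
  move=> y z Ey Ez; rewrite /E /= -[chi (y - z)](subrK (chi y - chi z)).
  by apply: rpredD; [exact: pre_characterB|exact: rpredB].
have Eo : open E.
  rewrite openE => y Ey; apply: filterS (nbhs_translate y U0) => z Uz.
  by rewrite -[z](subrK y); apply: (subgroupD sE) => //; exact: UE.
have Ec : closed E.
  apply: closed_groupP => y H; have [z Ez Uz] := H U U0.
  by have := sE.2 _ _ Ez (UE _ Uz); rewrite subKr.
have cE := @component_connected L [set: L] 0 (connected_component [set: L] 0 `&` E).
have /cE : connected_component [set: L] 0 `&` E !=set0.
  exists 0; split; first exact: connected_component_refl.
  by case: sE.
move=> /(_ (ex_intro2 _ _ E Eo erefl) (ex_intro2 _ _ E Ec erefl)) h.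
by move: cx; rewrite /zero_component -h => -[_ Ex]; move: chix; rewrite Ex.
Qed.

(** A clopen [B] is compact, so some neighbourhood of zero moves it only inside [Ob]. By
    precompactness every [d] has a multiple by a positive [k <= size s] in that neighbourhood. An
    element of the divisible part is the factorial of [size s] times some [d'], hence a multiple of
    such a [d' *+ k], and [B] is stable under it. *)
Lemma divisible_part_connected : connected (divisible_part L).
Proof.
set D := divisible_part L; have sD := divisible_part_subgroup L.
move=> B [b0 Bb0] [Ob oO BO] [Cb cC BC].
have BD : B `<=` D by rewrite BO => x [].
have cB : compact B.
  apply: (subclosed_compact _ cL) => //; rewrite BC; apply: closedI => //.
  exact: divisible_part_closed.
have V0 : \forall v \near (0 : L), B `<=` (fun b => Ob (b + v)).
  apply: ((compact_near_coveringP B).1 cB L (nbhs 0) (fun v b => Ob (b + v))) => b Bb.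
  have ObN : nbhs (b + 0) Ob.
    by rewrite addr0; apply: open_nbhs_nbhs; split=> //; move: Bb; rewrite BO => -[].
  exact: (@add_continuous L (b, 0) Ob ObN).
have [V' V'0 V'V] := group_baseB (nbhs0_group_base L) V0.
have [s sP] := Lpc V'0.
have small d : exists2 k, (0 < k <= size s)%N & B `<=` (fun b => Ob (b + d *+ k)).
  have [q _|q [q' [a [qq' q's h h']]]] :=
      @finite_coloringP 'I_(size s) (fun q a => V' (d *+ q - s`_a)).
    have [f fs Vf] := sP (d *+ q) Logic.I; move: (fs); rewrite -index_mem => ltf.
    by exists (Ordinal ltf); rewrite /= nth_index.
  exists (q' - q)%N; first by move: q's; rewrite card_ord; lia.
  have := V'V _ _ h' h; rewrite mulrnBr; last exact: ltnW.
  by have -> : d *+ q' - s`_a - (d *+ q - s`_a) = d *+ q' - d *+ q by zmod.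
have add b d : B b -> D d -> B (b + d).
  move=> Bb Dd; have [d' Dd' <-] := divisible_part_divisible (fact_gt0 (size s)) Dd.
  have [k /andP[k0 ks] kP] := small d'.
  have /dvdnP[t ->] : (k %| (size s)`!)%N by rewrite dvdn_fact// k0.
  rewrite mulnC mulrnA; elim: t => [|t IH]; first by rewrite mulr0n addr0.
  rewrite mulrSr addrA; have := kP _ IH => Ot; rewrite BO; split=> //.
  apply: (subgroupD sD); first exact: BD.
  exact: (subgroupMn sD).
rewrite eqEsubset; split=> // d Dd; rewrite -[d](subrK b0) addrC; apply: add => //.
by apply: (proj2 sD) => //; exact: BD.
Qed.

Lemma divisible_part_component : divisible_part L `<=` zero_component L.
Proof.
apply: connected_component_max => //; last exact: divisible_part_connected.
by case: (divisible_part_subgroup L).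
Qed.

End compact_group.

(** * Dense embeddings and minimality *)

Definition group_embedding (G K : topologicalZmodType) (j : G -> K) :=
  [/\ forall x y, j (x - y) = j x - j y, injective j &
   forall U, nbhs (0 : G) U <-> exists2 V, nbhs (0 : K) V & forall x, V (j x) -> U x].

Definition group_dense (G K : topologicalZmodType) (j : G -> K) :=
  forall y U, nbhs (0 : K) U -> exists g, U (j g - y).

Lemma completion_embedding (G K : topologicalZmodType) (i : {additive G -> K}) :
  is_completion i -> group_embedding i /\ group_dense i.
Proof.
move=> [hK cK inj oE dn]; split.
  split=> // [|U]; first exact: raddfB.
  split=> [|[V V0 VU]].
    rewrite nbhsE => -[A [oA A0] AU]; move: oA; rewrite oE => -[B oB BA].
    exists B; last by move=> x Bx; apply: AU; rewrite -BA.
    by apply: open_nbhs_nbhs; split=> //; move: A0; rewrite -BA /= raddf0.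
  move: V0; rewrite !nbhsE => -[B [oB B0] BV]; exists (i @^-1` B); last by move=> x /BV/VU.
  by split; [rewrite oE; exists B|rewrite /= raddf0].
move=> y U /(nbhs_translate y); rewrite nbhsE => -[B [oB By] BU].
have [|z [Bz [g _ gz]]] := dn B _ oB; first by exists y.
by exists g; rewrite gz; exact: BU.
Qed.

Section embedding.
Context (G K : topologicalZmodType) (j : G -> K).
Hypothesis ej : group_embedding j.

Lemma embedding0 : j 0 = 0.
Proof. by have [jB _ _] := ej; have := jB 0 0; rewrite subr0 subrr. Qed.

Lemma embedding_range_subgroup : subgroup (range j).
Proof.
have [jB _ _] := ej; split; first by exists 0; rewrite ?embedding0.
by move=> _ _ [x _ <-] [y _ <-]; exists (x - y); rewrite ?jB.
Qed.

Lemma embedding_nbhs (V : set K) : nbhs (0 : K) V -> nbhs (0 : G) (j @^-1` V).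
Proof. by have [_ _ jE] := ej; move=> V0; apply/jE; exists V. Qed.

Lemma dense_finitely_covered : group_dense j ->
  (forall U, nbhs (0 : G) U -> finitely_covered setT U) ->
  forall U, nbhs (0 : K) U -> finitely_covered setT U.
Proof.
move=> dj H U /(group_base_sum (nbhs0_group_base K) 2)[V V0 VU].
have [s sP] := H _ (embedding_nbhs V0); exists [seq j f | f <- s] => x _.
have [g Vg] := dj x V V0; have [f fs Vf] := sP g Logic.I.
exists (j f); first exact: map_f.
have [jB _ _] := ej; have := VU [:: x - j g; j g - j f].
rewrite !big_cons big_nil addr0 addrA subrK; apply=> // t.
rewrite !inE => /orP[] /eqP ->; first by right; rewrite opprB.
by left; rewrite -jB.
Qed.

(* If a closed subgroup [N] met [G] trivially, the sets [V + N] would induce a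
   coarser Hausdorff group topology on [G]. *)
Lemma minimal_essential : minimal_group G -> hausdorff_space K -> group_dense j ->
  essential (range j).
Proof.
move=> Gm hK dj N sN clN [x0 Nx0 x00]; apply: contrapT => nex.
have [jB inj jE] := ej; have gK := nbhs0_group_base K.
pose B : set_system G := [set W | exists2 V, nbhs (0 : K) V &
  W = [set g | exists2 n, N n & V (j g - n)]].
have gB : group_base B.
  split.
  - by exists [set g | exists2 n, N n & setT (j g - n)], setT => //; exact: filterT.
  - move=> _ [V V0 ->]; exists 0; first by case: sN.
    by rewrite embedding0 subr0; exact: nbhs_singleton V0.
  - move=> _ _ [V V0 ->] [W W0 ->].
    exists [set g | exists2 n, N n & (V `&` W) (j g - n)].
      by exists (V `&` W) => //; exact: filterI.
    by move=> g [n Nn [Vn Wn]]; split; exists n.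
  - move=> _ [V V0 ->]; have [W W0 WV] := group_baseB gK V0.
    exists [set g | exists2 n, N n & W (j g - n)]; first by exists W.
    move=> g h [n Nn Wn] [m Nm Wm]; exists (n - m); first exact: (proj2 sN).
    by rewrite jB; have := WV _ _ Wn Wm; congr V; zmod.
have Bn W : B W -> nbhs (0 : G) W.
  move=> [V V0 ->]; apply: filterS (embedding_nbhs V0) => g Vg.
  by exists 0; [case: sN|rewrite subr0].
have B0 g : (forall W, B W -> W g) -> g = 0.
  move=> H; apply: inj; rewrite embedding0; apply: contrapT => g0.
  apply: nex; exists (j g); split=> //; apply: (closed_groupE clN) => V /group_nbhs0N V0.
  have BV : B [set g | exists2 n, N n & V (- (j g - n))] by exists [set y | V (- y)].
  by have [n Nn Vn] := H _ BV; exists n => //; rewrite -opprB.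
have [V0 V00 nV0] : exists2 V, nbhs (0 : K) V & ~ V x0.
  apply: contrapT => h; apply: x00; apply: (hausdorff_nbhs0 hK) => V V0.
  by apply: contrapT => nV; apply: h; exists V.
have [V1 V10 V1V] := group_baseB gK V00.
have [_ [V VK ->] WU] := minimal_groupP Gm gB Bn B0 (embedding_nbhs V10).
(* [g] approximates the point [x0] of [N], so it lies in the member of [B] built from [V] and is
   small; then [x0] is a difference of two small elements. *)
have [|g [Vg V1g]] := dj x0 (V `&` V1); first exact: filterI.
apply: nV0; rewrite -[x0](subKr (j g)); apply: V1V => //.
by apply: WU; exists x0.
Qed.

(* A coarser topology is recovered on [K] by the closed subgroup [N] of limits
   of its neighbourhoods; [N] is trivial since it meets [G] trivially. *)
Lemma essential_minimal : compact [set: K] -> hausdorff_space K ->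
  essential (range j) -> minimal_group G.
Proof.
move=> cK hK ess; have [jB inj jE] := ej; split.
  apply: hausdorff_groupP => x H; apply: inj; rewrite embedding0.
  by apply: (hausdorff_nbhs0 hK) => V /embedding_nbhs/H.
move=> [t [[tadd topp] th [tsub tproper]]]; apply: tproper.
pose T : topologicalType := Topological.Pack t.
have tn (x : G) (A : set G) : @nbhs _ T x A -> nbhs x A.
  rewrite (@nbhsE T) nbhsE => -[B [oB Bx] BA]; exists B => //.
  by split=> //; exact: tsub.
have tB (W : set G) : @nbhs _ T (0 : G) W -> exists2 W' : set G,
    @nbhs _ T (0 : G) W' & forall x y, W' x -> W' y -> W (x - y).
  move=> W0; have := tadd ((0 : G), (0 : G)) W; rewrite /= addr0.
  move=> /(_ W0)[[P Q] /= [P0 Q0] PQ].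
  have Q1 : @nbhs _ T (0 : G) [set y : G | Q (- y)].
    by have := topp (0 : G) Q; rewrite oppr0 => /(_ Q0).
  exists (P `&` [set y : G | Q (- y)]); first exact: (@filterI _ (@nbhs _ T (0 : G))).
  by move=> x y [Px _] [_ Qy]; exact: (PQ (x, - y)).
have tT (x : G) (A : set G) : @nbhs _ T (0 : G) [set y : G | A (x + y)] -> @nbhs _ T x A.
  move=> h; have := tadd (x, - x : G) [set y : G | A (x + y)]; rewrite /= subrr.
  move=> /(_ h)[[P Q] /= [P0 Q0] PQ].
  apply: (@filterS _ (@nbhs _ T x) _ _ _ _ P0) => a Pa.
  have := PQ (a, - x) (conj Pa (@nbhs_singleton T _ _ Q0)).
  by rewrite /= addrC subrK.
pose N := [set y : K | forall W : set G, @nbhs _ T (0 : G) W ->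
  forall V, nbhs (0 : K) V -> exists2 w, W w & V (j w - y)].
have sN : subgroup N.
  split.
    move=> W W0 V V0; exists 0; first exact: (@nbhs_singleton T _ _ W0).
    by rewrite embedding0 subrr; exact: nbhs_singleton V0.
  move=> y z Ny Nz W /tB[W' W'0 W'W] V V0.
  have [V' V'0 V'V] := group_baseB (nbhs0_group_base K) V0.
  have [w Ww Vw] := Ny _ W'0 _ V'0; have [v Wv Vv] := Nz _ W'0 _ V'0.
  exists (w - v); first exact: W'W.
  by rewrite jB; have := V'V _ _ Vw Vv; congr V; zmod.
have clN : closed N.
  apply: closed_groupP => y H W W0 V V0.
  have [V' V'0 V'V] := group_base_sum (nbhs0_group_base K) 2 V0.
  have [z Nz Vz] := H _ V'0; have [w Ww Vw] := Nz _ W0 _ V'0; exists w => //.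
  have := V'V [:: j w - z; z - y]; rewrite !big_cons big_nil addr0 addrA subrK.
  by apply=> // u; rewrite !inE => /orP[] /eqP ->; left.
have N0 y : N y -> y = 0.
  move=> Ny; apply: contrapT => y0.
  have [|y' [Ng [g _ gy] g0]] := ess N sN clN; first by exists y.
  rewrite -{y'}gy in Ng g0.
  apply: g0; rewrite -embedding0; congr j; apply/esym; apply: th => A B A0 Bg.
  have /group_nbhsE/(jE _).1[V V0 VB] := tn _ _ Bg.
  have [w Aw Vw] := Ng A A0 V V0; exists w; split=> //.
  by have /= := VB (w - g); rewrite jB [g + _]addrC subrK; apply.
have main (U : set G) : nbhs (0 : G) U -> @nbhs _ T (0 : G) U.
  move=> U0; have [V V0 VU] := (jE U).1 U0.
  move: V0; rewrite (@nbhsE K) => -[Ow [oO O0] OV]; apply: contrapT => nU.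
  have Wne (W : set G) : @nbhs _ T (0 : G) W -> exists w, W w /\ ~ Ow (j w).
    move=> W0; apply: contrapT => h; apply: nU.
    apply: (@filterS _ (@nbhs _ T (0 : G)) _ _ _ _ W0) => w Ww; apply: VU; apply: OV.
    by apply: contrapT => nO; apply: h; exists w.
  (* Every coarser neighbourhood has a point mapped outside [Ow]. A cluster point of these images
     lies in [N], hence is zero, but [Ow] is a neighbourhood of zero that they avoid. *)
  pose F := filter_from [set W : set G | @nbhs _ T (0 : G) W]
    (fun W => [set j w | w in W `&` [set w | ~ Ow (j w)]]).
  have FF : ProperFilter F.
    apply: filter_from_proper; last first.
      by move=> W /Wne[w [Ww nO]]; exists (j w); exists w.
    apply: filter_from_filter; first by exists setT; exact: (@filterT _ (@nbhs _ T (0 : G))).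
    move=> A B A0 B0; exists (A `&` B); first exact: (@filterI _ (@nbhs _ T (0 : G))).
    by move=> _ [w [[Aw Bw] nO] <-]; split; exists w.
  have FI (W : set G) : @nbhs _ T (0 : G) W -> F [set j w | w in W `&` [set w | ~ Ow (j w)]].
    by move=> W0; exists W.
  have [y [_ yF]] := cK F FF filterT.
  have y0 : y = 0.
    apply: N0 => W W0 V' V'0.
    have [_ [[w [Ww _] <-] Vw]] := yF _ _ (FI W W0) (nbhs_translate y V'0).
    by exists w.
  have nO : nbhs y Ow by rewrite y0; exact: open_nbhs_nbhs.
  have [_ [[w [_ nw] <-] Owj]] := yF _ _ (FI setT (@filterT _ (@nbhs _ T (0 : G)) _)) nO.
  exact: nw.
move=> A oA; rewrite (@openE T) => x Ax; apply: tT; apply: main.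
have xn : nbhs (x : G) A by exact: open_nbhs_nbhs.
exact: (group_nbhsE (x : G) A).1 xn.
Qed.

End embedding.

(** For each neighbourhood, an ultrafilter contains one of finitely many translates covering the
    group; it is therefore Cauchy. *)
Lemma complete_compact (K : topologicalZmodType) : complete_group K ->
  (forall U, nbhs (0 : K) U -> finitely_covered setT U) -> compact [set: K].
Proof.
move=> cK H; rewrite compact_ultra => F FU _.
have [|x xF] := cK F _; last by exists x.
move=> U U0; have [V V0 VU] := group_baseB (nbhs0_group_base K) U0.
have [s sP] := H V V0.
have [f Ff] : exists f, F [set x | V (x - f)].
  apply: contrapT => nex.
  have aux (t : seq K) : F [set x | forall f, f \in t -> ~ V (x - f)].
    elim: t => [|f t IH]; first by apply: (@filterS _ F _ setT); [|exact: filterT].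
    have [Ff|Ff] := in_ultra_setVsetC [set x | V (x - f)] FU.
      by exfalso; apply: nex; exists f.
    apply: (@filterS _ F _ _ _ _ (@filterI _ F _ _ _ Ff IH)) => x [nf nt] g.
    by rewrite inE => /orP[/eqP ->|/nt].
  have [x xP] := @filter_ex _ F _ _ (aux s).
  by have [f fs Vf] := sP x Logic.I; exact: xP Vf.
exists [set x | V (x - f)] => // x y Vx Vy.
by have := VU _ _ Vx Vy; congr U; zmod.
Qed.

(** * Powers of a topological group *)

Section power.
Context (I : Type) (K : topologicalZmodType).
Local Notation P := (group_power I K).

Lemma power_proj_continuous (i : I) : continuous (fun f : P => f i).
Proof.
move=> f; have /cvg_sup/(_ i)/cvg_image h : f --> f by exact: cvg_id.
apply: cvg_trans (h _) => [|].
  by move=> Q /= [W nbdW <-]; apply: filterS nbdW; exact: preimage_image.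
by rewrite eqEsubset; split=> v // _; exists (cst v).
Qed.

(** Indices are taken in [{classic I}] so that list membership makes sense for an arbitrary type. *)
Lemma power_nbhs0 (U : set P) : nbhs (0 : P) U <->
  exists (s : seq {classic I}) (V : set K), nbhs (0 : K) V /\
    forall f : P, (forall i, i \in s -> V (f i)) -> U f.
Proof.
pose Phi : set_system P := [set U : set P | exists (s : seq {classic I}) (V : set K),
  nbhs (0 : K) V /\ forall f : P, (forall i, i \in s -> V (f i)) -> U f].
split; last first.
  move=> [s [V [V0 VU]]].
  suff h : nbhs (0 : P) [set f : P | forall i, i \in s -> V (f i)].
    by apply: filterS h => f /VU.
  elim: s {VU} => [|i s IH].
    by apply: (@filterS _ (nbhs (0 : P)) _ setT); [|exact: filterT].
  have h := @power_proj_continuous i (0 : P) V V0.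
  apply: (@filterS _ (nbhs (0 : P)) _ _ _ _ (@filterI _ (nbhs (0 : P)) _ _ _ h IH)).
  by move=> f [/= fi fs] k; rewrite inE => /orP[/eqP ->|/fs].
have FF : Filter Phi.
  split.
  - by exists [::], setT; split=> //; exact: filterT.
  - move=> A B [s [V [V0 VA]]] [t [W [W0 WB]]]; exists (s ++ t), (V `&` W).
    split; first exact: filterI.
    move=> f h; split; [apply: VA|apply: WB] => i it.
      by have [] := h i; rewrite ?mem_cat ?it.
    by have [] := h i; rewrite ?mem_cat ?it ?orbT.
  - by move=> A B AB [s [V [V0 VA]]]; exists s, V; split=> // f /VA/AB.
suff : Phi --> (0 : P) by exact.
apply/cvg_sup => i; apply/cvg_image.
  by rewrite eqEsubset; split=> v // _; exists (cst v).
move=> A A0; exists ((fun f : P => f i) @^-1` A).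
  by exists [:: i], A; split=> // f; apply; rewrite inE eqxx.
by rewrite image_preimage// eqEsubset; split=> v // _; exists (cst v).
Qed.

Lemma power_hausdorff : hausdorff_space K -> hausdorff_space P.
Proof.
move=> hK; apply: hausdorff_groupP => x H; apply/funext => i.
apply: (hausdorff_nbhs0 hK) => V V0.
by apply: (H [set f : P | V (f i)]); exact: (@power_proj_continuous i (0 : P) V V0).
Qed.

Lemma power_compact : compact [set: K] -> compact [set: P].
Proof.
move=> cK; rewrite compact_ultra => F FU _.
have lim i : exists l : K, forall V, nbhs l V -> F [set f : P | V (f i)].
  have [l [_ lF]] := cK ((fun f : P => f i) @ F) _ filterT.
  exists l => V Vl; have [//|FV] := in_ultra_setVsetC [set f : P | V (f i)] FU.
  exfalso; have [y [nV Vy]] := lF (~` V) V FV Vl; exact: nV.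
have [l lP] := choice lim; exists (l : P); split=> // W /group_nbhsE/power_nbhs0.
move=> [s [V [V0 VW]]].
have h : F [set f : P | forall i, i \in s -> V (f i - l i)].
  elim: s {VW} => [|i s IH]; first by apply: (@filterS _ F _ setT); [|exact: filterT].
  have Fi := lP i _ (nbhs_translate (l i) V0).
  apply: (@filterS _ F _ _ _ _ (@filterI _ F _ _ _ Fi IH)).
  by move=> f [/= fi fs] k; rewrite inE => /orP[/eqP ->|/fs].
apply: (@filterS _ F _ _ _ _ h) => f fP.
have := VW (f - (l : P)) fP; rewrite /=.
by have -> : (l : P) + (f - (l : P)) = f by rewrite addrC subrK.
Qed.

End power.

Definition power_map (I : Type) (G K : Type) (j : G -> K) (f : group_power I G) :
  group_power I K := fun i => j (f i).

Section power_map.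
Context (I : Type) (G K : topologicalZmodType) (j : G -> K).
Local Notation jI := (@power_map I G K j).

Lemma power_map_embedding : group_embedding j -> group_embedding jI.
Proof.
move=> [jB inj jE]; split.
- by move=> x y; apply/funext => i; exact: jB.
- by move=> x y xy; apply/funext => i; apply: inj; exact: (congr1 (fun f : I -> K => f i) xy).
- move=> U; split.
    move=> /power_nbhs0[s [V [/(jE V).1[V' V'0 V'V] VU]]].
    exists [set f : group_power I K | forall i : {classic I}, i \in s -> V' (f i)].
      by apply/power_nbhs0; exists s, V'.
    by move=> x h; apply: VU => i /h /V'V.
  move=> [V /power_nbhs0[s [V' [V'0 V'V]]] VU]; apply/power_nbhs0.
  exists s, (j @^-1` V'); split; first by apply/jE; exists V'.
  by move=> f h; apply: VU; apply: V'V.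
Qed.

Lemma power_map_dense : group_dense j -> group_dense jI.
Proof.
move=> dj y U /power_nbhs0[s [V [V0 VU]]].
have [g gP] := choice (fun i => dj (y i) V V0).
by exists g; apply: VU => i _; exact: gP.
Qed.

Lemma power_map_range (f : group_power I K) : (forall i, range j (f i)) -> range jI f.
Proof.
move=> H; have ex i : exists g, j g = f i by have [g _ <-] := H i; exists g.
by have [g gP] := choice ex; exists g => //; apply/funext => i; exact: gP.
Qed.

Lemma power_map_sequentially_closed :
  sequentially_closed (range j) -> sequentially_closed (range jI).
Proof.
move=> Sc u x uS ux; apply: power_map_range => i.
apply: (Sc (fun n => u n i)); first by move=> n; have [g _ <-] := uS n; exists (g i).
exact: (cvg_comp u (fun f : group_power I K => f i) ux (@power_proj_continuous I K i x)).
Qed.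

End power_map.

(** * Powers *)

(** The [pi]-part of [k] is divided out in the reals, at the cost of a [pi]-number in the order; the
    part prime to [pi] is inverted modulo the order [q]. *)
Lemma pi_torsion_div (R : realType) pi (r : R) k : (0 < k)%N -> pi_torsion pi r ->
  exists2 s, pi_torsion pi s & r - s *+ k \is a Num.int.
Proof.
move=> k0 [q qpi rq]; have kE := partnC pi k0.
have a0 : (0 < k`_pi)%N by exact: part_gt0.
have b0 : (0 < k`_(negn pi))%N by exact: part_gt0.
have aR : (k`_pi)%:R != 0 :> R by rewrite pnatr_eq0 -lt0n.
case: (egcdnP q b0) => km kn.
have /eqP -> : coprime k`_(negn pi) q.
  by rewrite coprime_sym; apply: (pnat_coprime qpi); exact: part_pnat.
move=> e _; exists (r *+ km / (k`_pi)%:R).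
  exists (k`_pi * q)%N; first by rewrite pnatM qpi part_pnat.
  by rewrite mulrnA -[_ *+ k`_pi]mulr_natr divfK// mulrnAC; exact: rpredMn.
rewrite -{2}kE mulrnA -[_ *+ k`_pi]mulr_natr divfK// -mulrnA e mulrnDr mulr1n.
by rewrite opprD addrCA subrr addr0 mulnC mulrnA rpredN; exact: rpredMn.
Qed.

Lemma torsion_mod1_cong (R : realType) (r s : R) :
  r - s \is a Num.int -> torsion_mod1 s -> torsion_mod1 r.
Proof.
move=> rs [q q0 sq]; exists q => //; rewrite -[r](subrK s) mulrnDl.
by apply: rpredD => //; exact: rpredMn.
Qed.

Section compact_elements.
Context (R : realType) (K : topologicalZmodType).
Hypothesis cK : compact [set: K].
Hypothesis hK : hausdorff_space K.

(** Topological [p]-torsion: by [p_element_nbhs] the multiples by [p ^ n] tend to zero. The form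
    with characters is the one that duality produces. *)
Definition p_element (p : nat) (x : K) :=
  forall chi : K -> R, cchar chi -> pi_torsion p (chi x).

Let Kpc U : nbhs (0 : K) U -> finitely_covered setT U.
Proof. exact: compact_finitely_covered. Qed.

Lemma p_element_nbhs p x : p_element p x -> forall U, nbhs (0 : K) U ->
  exists n, forall b : int, U (x *~ (b * (p ^ n)%N%:Z)).
Proof.
move=> px U U0; have [m [chi [c1 c2]]] := chars_base R Kpc U0.
have ex j : exists n, chi j x *+ (p ^ n)%N \is a Num.int.
  by have [q /p_natP[e ->] h] := px _ (c1 j); exists e.
have [n nP] := choice ex; exists (\max_j n j)%N => b; apply: c2 => j.
apply: near_int_int; first lra.
set M := (\max_j n j)%N; have le : (n j <= M)%N by exact: (leq_bigmax j).
have [cj _] := c1 j; rewrite -[chi j _](subrK (chi j x *~ (b * (p ^ M)%N%:Z))).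
apply: rpredD; first exact: pre_characterMz.
rewrite -(subnK le) expnD PoszM [X in _ *~ X]mulrA [X in _ *~ X]mulrC mulrzA -pmulrn.
exact: rpredMz.
Qed.

Lemma nbhs_torsion (x : K) : (forall U, nbhs (0 : K) U -> exists2 n, (0 < n)%N &
    forall b : int, U (x *~ (b * n%:Z))) ->
  forall chi : K -> R, cchar chi -> torsion_mod1 (chi x).
Proof.
move=> H chi [c1 c2]; have [|V V0 VP] := c2 (1 / 10); first lra.
have [n n0 nP] := H V V0; exists n => //; apply: near_int_all => j.
have := VP _ (nP j%:Z); apply: near_int_cong.
rewrite -rpredN opprB -mulrnA mulnC [in X in _ - X]pmulrn PoszM; exact: pre_characterMz.
Qed.

(** The multiples of [n] form a closed subgroup, the common kernel of the characters trivial on it,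
    and these have order dividing [n]. *)
Lemma torsion_chars_divisible (z : K) :
  (forall chi : K -> R, cchar chi ->
     (exists2 l, (0 < l)%N & forall y, chi y *+ l \is a Num.int) ->
     chi z \is a Num.int) -> divisible_part K z.
Proof.
move=> H n n0; apply: contrapT => nz.
have [|chi [cc chiN chiz]] := @chars_closed R K Kpc _ z
    (multiples_of_subgroup K n) (@multiples_closed K cK hK n).
  by move=> [y _ yx]; apply: nz; exists y.
move/negP: chiz; apply; apply: H => //; exists n => // y.
have h : chi (y *+ n) \is a Num.int by apply: chiN; exists y.
by have := rpredB h (pre_characterMn cc.1 y n); rewrite subKr.
Qed.

Context (S : set K).
Hypothesis sS : subgroup S.
Hypothesis Sc : sequentially_closed S.
Hypothesis Se : essential S.

Section bounded_exponent.
Hypothesis Sp : forall p, prime p ->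
  exists m, forall x, p_element p x -> S (x *+ p ^ m).

(** Divide [x] by [p ^ m] in the divisible part; the result is again a [p]-element, so [Sp] applies
    to it. *)
Let divisible_p_element p x : prime p -> divisible_part K x -> p_element p x -> S x.
Proof.
move=> pp Dx px; have [m mP] := Sp pp.
have pm0 : (0 < p ^ m)%N by rewrite expn_gt0 prime_gt0.
have [y Dy yx] := divisible_part_divisible cK hK pm0 Dx.
rewrite -yx; apply: mP => chi cc; have [q qp xq] := px _ cc.
exists (p ^ m * q)%N; first by rewrite pnatM qp pnatX pnat_id.
have := pre_characterMn cc.1 y (p ^ m)%N; rewrite yx => h.
have -> : chi y *+ (p ^ m * q) = chi x *+ q - (chi x - chi y *+ p ^ m) *+ q.
  by rewrite -mulrnBl subKr mulrnA.
by apply: rpredB => //; exact: rpredMn.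
Qed.

(** [y n] is the component of [x] for the primes at most [n]. Consecutive ones differ by a
    [p]-element if [n.+1] is a prime [p] and are equal otherwise; on a given character they agree
    with [x] modulo 1 once [n] reaches an exponent of its value. *)
Let divisible_torsion x : divisible_part K x ->
  (forall chi : K -> R, cchar chi -> torsion_mod1 (chi x)) -> S x.
Proof.
move=> Dx xt; have sD := divisible_part_subgroup K.
pose pi n : nat_pred := [pred q | (q <= n)%N].
have [y yP] := choice (fun n => torsion_decomposition (pi n) cK sD
  (divisible_part_closed cK hK) Dx xt).
have Sy n : S (y n).
  elim: n => [|n IH].
    have -> : y 0%N = 0; last by case: sS.
    apply: (@chars_separate R K Kpc) => // chi cc; have [_ h _] := yP 0%N.
    have h0 := h _ cc; apply: (pi_torsion_trivial h0).
    have [q /andP[q0 /allP qp] yq] := h0; exists q => //.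
    by apply/pnatP => // r rp _; rewrite !inE -ltnNge prime_gt0.
  have [Dn tn tn'] := yP n; have [Dm tm tm'] := yP n.+1.
  rewrite -[y n.+1](subrK (y n)); apply: (subgroupD sS) => //.
  have zt (chi : K -> R) (cc : cchar chi) : pi_torsion (pi n.+1) (chi (y n.+1 - y n)) /\
      pi_torsion (negn (pi n)) (chi (y n.+1 - y n)).
    split; apply: pi_torsion_cong (pre_characterB cc.1 _ _) _.
      apply: (proj2 (pi_torsion_subgroup R _)); first exact: tm.
      have [q qp h] := tn _ cc; exists q => //; apply: sub_in_pnat qp => r _.
      by rewrite !inE => /leqW.
    have -> : chi (y n.+1) - chi (y n) = (chi x - chi (y n)) - (chi x - chi (y n.+1)) by ring.
    apply: (proj2 (pi_torsion_subgroup R _)); first exact: tn'.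
    have [q qp h] := tm' _ cc; exists q => //; apply: sub_in_pnat qp => r _.
    by rewrite !inE -!ltnNge => /ltnW.
  have [pr|npr] := boolP (prime n.+1).
    apply: (divisible_p_element pr); first exact: (proj2 sD).
    move=> chi cc; have [[q qp zq] [t tp zt']] := zt _ cc.
    have /andP[q0 _] := qp; have /andP[t0 _] := tp.
    exists (gcdn q t); last exact: int_gcd.
    apply/pnatP => [|r rp]; first by rewrite gcdn_gt0 q0.
    rewrite dvdn_gcd => /andP[rq rt]; have := (pnatP _ q0 qp) r rp rq.
    by have := (pnatP _ t0 tp) r rp rt; rewrite !inE; lia.
  have -> : y n.+1 - y n = 0; last by case: sS.
  apply: (@chars_separate R K Kpc) => // chi cc; have [[q qp zq] h] := zt _ cc.
  apply: (@pi_torsion_trivial R (pi n)) => //; exists q => //.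
  have /andP[q0 _] := qp; apply/pnatP => // r rp rq.
  have := (pnatP _ q0 qp) r rp rq; rewrite !inE leq_eqVlt => /orP[/eqP e|//].
  by move: npr; rewrite -e rp.
apply: (chars_cvg Kpc Sc Sy) => chi cc; have [q q0 xq] := xt _ cc; exists q => n qn.
apply: near_int_int; first lra.
have [_ tn tn'] := yP n; rewrite -rpredN opprB.
apply: (@pi_torsion_trivial R (pi n)); last exact: tn'.
apply: (proj2 (pi_torsion_subgroup R _)); last exact: tn.
exists q => //; apply/pnatP => // r rp rq; rewrite !inE.
exact: leq_trans (dvdn_leq q0 rq) qn.
Qed.

(** [y n] is the point with characters [rho n (chi x)]. It exists by duality because [rho n] is
    additive and fixes the integers; its characters have rational values, and it tends to [x]. *)
Lemma divisible_sub : divisible_part K `<=` S.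
Proof.
move=> x Dx; have sD := divisible_part_subgroup K.
have [rho [rhoD rho1 rhoT rhoC]] := rational_approximation R.
have rho0 n : rho n 0 = 0 by apply: (addrI (rho n 0)); rewrite -rhoD !addr0.
have rhoN n r : rho n (- r) = - rho n r.
  by apply: (addrI (rho n r)); rewrite -rhoD !subrr.
have rhoZ n (k : int) : rho n k%:~R = k%:~R.
  have h m : rho n m%:R = m%:R.
    by elim: m => [|m IH]; rewrite ?rho0// -natr1 rhoD IH rho1.
  by case: k => m; rewrite ?NegzE ?mulrNz ?rhoN -!pmulrn h.
have yex n : exists2 y, divisible_part K y &
    forall chi : K -> R, cchar chi -> chi y - rho n (chi x) \is a Num.int.
  apply: (dual_point cK sD (divisible_part_closed cK hK)).
    move=> chi psi; rewrite -[(chi + psi) x]/(chi x + psi x) rhoD subrr; exact: rpred0.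
  by move=> chi cc /(_ x Dx)/intrP[k ->]; rewrite rhoZ; exact: intr_int.
have yex' n : exists y, divisible_part K y /\
    forall chi : K -> R, cchar chi -> chi y - rho n (chi x) \is a Num.int.
  by have [y h1 h2] := yex n; exists y.
have [y yP] := choice yex'.
apply: (chars_cvg (R := R) Kpc Sc (u := y)) => [n|chi cc].
  have [Dy h] := yP n; apply: divisible_torsion => // chi cc.
  by apply: torsion_mod1_cong (h _ cc) _; exact: rhoT.
have [|n0 n0P] := rhoC (chi x) (1 / 8); first lra.
exists n0 => n /n0P le; have [_ h] := yP n.
apply: (@near_int_cong _ _ _ (rho n (chi x) - chi x)).
  by have := h _ cc; congr (_ \is a Num.int); ring.
by exists 0; rewrite subr0.
Qed.

End bounded_exponent.

(* By divisible extension the elements [x n *+ p ^ n] become, modulo the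
   divisible part, the values at singletons of a map [W] on all subsets [J] of
   [nat], continuous along stabilising sequences; Baire's argument on the
   Cantor space then bounds the exponents. *)
Lemma uniform_exponent p : prime p -> divisible_part K `<=` S ->
  exists m, forall x, p_element p x -> S (x *+ p ^ m).
Proof.
move=> pp DS; have p0 := prime_gt0 pp; apply: contrapT => nex.
(* One [n] in the exponent is used by the factor [p ^ n] in the elements to be combined, the other
   covers the exponent [m <= n] given by Baire's argument. *)
have xex n : exists x, p_element p x /\ ~ S (x *+ p ^ (n + n)).
  apply: contrapT => h; apply: nex; exists (n + n)%N => x px.
  by apply: contrapT => nS; apply: h; exists x.
have [x xP] := choice xex; have sT := pi_torsion_subgroup R p.
(* Eventual integrality makes sums over subsets of [nat] finite modulo 1. *)
pose X' : set (nat -> R) := [set u | (forall n, pi_torsion p (u n)) /\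
  exists N, forall n, (N <= n)%N -> u n \is a Num.int].
pose Z0 : set (nat -> R) := [set u | forall n, u n \is a Num.int].
have sX : subgroup X'.
  split.
    by split=> [n|]; [exact: (proj1 sT)|exists 0%N => n _; exact: rpred0].
  move=> u v [u1 [M uM]] [v1 [N vN]]; split.
    by move=> n; apply: (proj2 sT); [exact: u1|exact: v1].
  exists (maxn M N) => n; rewrite geq_max => /andP[/uM ? /vN ?]; exact: rpredB.
have sZ : subgroup Z0.
  split=> [n|u v u0 v0 n]; first exact: rpred0.
  by apply: rpredB; [exact: u0|exact: v0].
have divX (u : nat -> R) k : X' u -> (0 < k)%N -> exists2 v, X' v & Z0 (u - v *+ k).
  move=> [u1 [M uM]] k0.
  have vex n : exists s, [/\ pi_torsion p s, u n - s *+ k \is a Num.int &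
      (u n \is a Num.int -> s = 0)].
    case: (boolP (u n \is a Num.int)) => un.
      by exists 0; split=> //; [exact: (proj1 sT)|rewrite mul0rn subr0].
    by have [s s1 s2] := pi_torsion_div k0 (u1 n); exists s.
  have [v vP] := choice vex; exists v.
    split=> [n|]; first by have [] := vP n.
    exists M => n /uM un; have [_ _ ->//] := vP n; exact: rpred0.
  move=> n; rewrite -[(u - v *+ k) n]/(u n - (v *+ k) n) fctMn.
  by have [] := vP n.
(* A character killed by [l] takes integer values at [x n *+ p ^ n] for [n >= l], so the sequence of
   these values is in [X']. The extension to all characters is controlled only on those of finite
   order, that is, up to the divisible part. *)
pose Q0 : set ((K -> R) * (nat -> R)) := [set z | [/\ cchar z.1,
  exists2 l, (0 < l)%N & forall y, z.1 y *+ l \is a Num.int,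
  forall n, z.2 n - z.1 (x n) *+ p ^ n \is a Num.int & X' z.2]].
have sQ : subgroup Q0.
  split.
    split=> /=; [by case: (cchar_subgroup R K)|exists 1%N => // y; exact: rpred0| |].
      by move=> n; rewrite -[X in X \is a _]/((0 : R) - 0 *+ p ^ n) mul0rn subr0; exact: rpred0.
    by case: sX.
  move=> [a u] [b v] [/= a1 [l l0 al] au uX] [/= b1 [k k0 bk] bv vX]; split=> /=.
  - exact: (proj2 (cchar_subgroup R K)).
  - exists (l * k)%N => [|y]; first by rewrite muln_gt0 l0.
    rewrite -[(a - b) y]/(a y - b y) mulrnBl [in X in _ - X]mulnC !mulrnA.
    by apply: rpredB; exact: rpredMn.
  - move=> n; have := rpredB (au n) (bv n); congr (_ \is a Num.int).
    rewrite -[(u - v) n]/(u n - v n) -[(a - b) (x n)]/(a (x n) - b (x n)) mulrnBl; ring.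
  - exact: (proj2 sX).
have [||f [fX fD fQ]] := @divisible_extension (K -> R) (nat -> R) X' Z0 sX sZ divX Q0 sQ.
- by move=> b u [].
- move=> u [/= _ _ h _] n; have := h n.
  by rewrite -[(0 : K -> R) (x n)]/(0 : R) mul0rn subr0.
have ftors (chi : K -> R) : cchar chi ->
    (exists2 l, (0 < l)%N & forall y, chi y *+ l \is a Num.int) ->
    forall n, f chi n - chi (x n) *+ p ^ n \is a Num.int.
  move=> cc [l l0 cl]; apply: (fQ chi (fun n => chi (x n) *+ p ^ n)); split=> //=.
  - by exists l.
  - by move=> n; rewrite subrr; exact: rpred0.
  split=> [n|]; first by apply: (subgroupMn sT); have [h _] := xP n; exact: h.
  exists l => n ln; have [h _] := xP n; have [q qp xq] := h _ cc.
  have g := int_gcd l0 (cl (x n)) xq.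
  have /p_natP[e eE] : (p : nat_pred).-nat (gcdn l q) by apply: pnat_dvd qp; exact: dvdn_gcdr.
  have en : (e <= n)%N.
    apply: ltnW; apply: leq_trans (ltn_expl e (prime_gt1 pp)) _; rewrite -eE.
    by apply: leq_trans ln; apply: dvdn_leq => //; exact: dvdn_gcdl.
  have -> : (p ^ n = gcdn l q * p ^ (n - e))%N by rewrite eE -expnD subnKC.
  by rewrite mulrnA; exact: rpredMn.
have [nb nbP] := choice (fun chi => proj2 (fX chi)).
pose lamM (J : nat -> bool) M (chi : K -> R) := \sum_(n < M) (if J n then f chi n else 0).
have lamS J chi M : (nb chi <= M)%N -> lamM J M chi - lamM J (nb chi) chi \is a Num.int.
  move=> /subnK <-; elim: (M - nb chi)%N => [|k IH]; first by rewrite subrr; exact: rpred0.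
  rewrite addSn {1}/lamM big_ord_recr /= -/(lamM J (k + nb chi) chi) addrAC.
  apply: rpredD => //; case: (J _); last exact: rpred0.
  by apply: nbP; exact: leq_addl.
(* The terms beyond [nb chi] are integers, so this partial sum represents the infinite sum over
   [J]. *)
pose lam J (chi : K -> R) := lamM J (nb chi) chi.
have lamP J : pre_character (lam J).
  move=> a b; pose M := maxn (nb (a + b)) (maxn (nb a) (nb b)).
  have h1 : lamM J M (a + b) - lam J (a + b) \is a Num.int.
    by apply: lamS; rewrite leq_maxl.
  have h2 : lamM J M a - lam J a \is a Num.int.
    by apply: lamS; rewrite /M; lia.
  have h3 : lamM J M b - lam J b \is a Num.int.
    by apply: lamS; rewrite /M; lia.
  have h4 : lamM J M (a + b) - (lamM J M a + lamM J M b) \is a Num.int.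
    rewrite /lamM -big_split -sumrB; apply: rpred_sum => n _.
    case: (J n) => /=; last by rewrite addr0 subr0; exact: rpred0.
    exact: (fD a b n).
  have -> : lam J (a + b) - (lam J a + lam J b) =
     (lamM J M (a + b) - (lamM J M a + lamM J M b)) - (lamM J M (a + b) - lam J (a + b))
     + ((lamM J M a - lam J a) + (lamM J M b - lam J b)).
    move: (lamM J M (a + b)) (lamM J M a) (lamM J M b) (lam J (a + b)) (lam J a) (lam J b).
    by move=> *; ring.
  by apply: rpredD; [exact: rpredB|exact: rpredD].
have Wex J : exists w, forall chi : K -> R, cchar chi -> chi w - lam J chi \is a Num.int.
  have sKT : subgroup [set: K] by [].
  have [|w _ wP] := dual_point cK sKT closedT (lamP J); last by exists w.
  move=> chi cc ci; apply: rpred_sum => n _; case: (J n); last exact: rpred0.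
  have ct : exists2 l, (0 < l)%N & forall y, chi y *+ l \is a Num.int.
    by exists 1%N => // y; exact: ci.
  rewrite -[f chi n](subrK (chi (x n) *+ p ^ n)); apply: rpredD; first exact: ftors.
  by apply: rpredMn; exact: ci.
have [W WP] := choice Wex.
have Wp J : p_element p (W J).
  move=> chi cc; apply: pi_torsion_cong (WP J _ cc) _.
  apply: (subgroup_sum sT) => n _; case: (J n); last exact: (proj1 sT).
  by have [h _] := fX chi; exact: h.
(* The sets of those [J] with a given exponent [m] cover the Cantor space, and [Wlim] shows that
   they are closed. *)
have WE J : exists m, S (W J *+ p ^ m).
  have [W0|W0] := pselect (W J = 0).
    by exists 0%N; rewrite W0 mul0rn; case: sS.
  have [m [Sm _]] := essential_multiple pp hK (p_element_nbhs (Wp J)) sS Sc Se W0.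
  by exists m.
have Wlim J m : (forall k, exists J', (forall n, (n < k)%N -> J' n = J n) /\
    S (W J' *+ p ^ m)) -> S (W J *+ p ^ m).
  move=> /choice[Jk JkP].
  apply: (chars_cvg (R := R) Kpc Sc (u := fun k => W (Jk k) *+ p ^ m)) => [k|chi cc].
    by have [] := JkP k.
  exists (nb chi) => k ck; apply: near_int_int; first lra.
  have lamE : lam (Jk k) chi = lam J chi.
    apply: eq_bigr => n _; have [-> //] := JkP k.
    exact: leq_trans (ltn_ord n) ck.
  have h1 := pre_characterMn cc.1 (W (Jk k)) (p ^ m)%N.
  have h2 := pre_characterMn cc.1 (W J) (p ^ m)%N.
  have h3 := rpredB (WP (Jk k) _ cc) (WP J _ cc); rewrite lamE in h3.
  have -> : chi (W (Jk k) *+ p ^ m) - chi (W J *+ p ^ m) =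
     (chi (W (Jk k) *+ p ^ m) - chi (W (Jk k)) *+ p ^ m)
     - (chi (W J *+ p ^ m) - chi (W J) *+ p ^ m)
     + (chi (W (Jk k)) - lam J chi - (chi (W J) - lam J chi)) *+ p ^ m.
    have -> : chi (W (Jk k)) - lam J chi - (chi (W J) - lam J chi) =
      chi (W (Jk k)) - chi (W J) by ring.
    rewrite mulrnBl; move: (chi (W (Jk k)) *+ _) (chi (W J) *+ _) (chi (W (Jk k) *+ _)).
    by move: (chi (W J *+ _)) => *; ring.
  by apply: rpredD; [exact: rpredB|exact: rpredMn].
have [[m [[J0 k] good]]|nogood] := pselect (exists m (z : (nat -> bool) * nat),
    forall J', (forall n, (n < z.2)%N -> J' n = z.1 n) -> S (W J' *+ p ^ m)).
  (* Two members of the good cylinder that differ exactly at [n >= m]: the difference of their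
     values under [W] is [x n *+ p ^ n] modulo the divisible part. *)
  pose n := maxn m k; pose J1 t := (t < k)%N && J0 t; pose J2 t := (t == n) || J1 t.
  have J1n : J1 n = false by rewrite /J1 ltnNge leq_maxr.
  have S1 : S (W J1 *+ p ^ m) by apply: good => t /= tk; rewrite /J1 tk.
  have S2 : S (W J2 *+ p ^ m).
    apply: good => t /= tk; rewrite /J2 /J1 tk /=.
    by have -> : (t == n) = false by apply/eqP; rewrite /n; lia.
  have Sd : S (W J2 - W J1 - x n *+ p ^ n).
    apply: DS; apply: torsion_chars_divisible => chi cc ct.
    pose M := maxn (nb chi) n.+1; have nM : (n < M)%N by rewrite /M leq_maxr.
    have h1 : lamM J2 M chi - lam J2 chi \is a Num.int by apply: lamS; rewrite leq_maxl.
    have h2 : lamM J1 M chi - lam J1 chi \is a Num.int by apply: lamS; rewrite leq_maxl.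
    have h3 : lamM J2 M chi - lamM J1 M chi = f chi n.
      rewrite /lamM -sumrB (bigD1 (Ordinal nM))//= J1n /J2 eqxx subr0 big1 ?addr0// => t tn.
      have -> : ((t : nat) == n) = false.
        by apply/eqP => e; move/eqP: tn; apply; exact: ord_inj.
      by rewrite subrr.
    have h4 := ftors _ cc ct n; have h5 := WP J2 _ cc; have h6 := WP J1 _ cc.
    have h7 := pre_characterB cc.1 (W J2 - W J1) (x n *+ p ^ n).
    have h8 := pre_characterB cc.1 (W J2) (W J1).
    have h9 := pre_characterMn cc.1 (x n) (p ^ n)%N.
    have e1 : chi (W J2 - W J1 - x n *+ p ^ n) =
      (chi (W J2 - W J1 - x n *+ p ^ n) - (chi (W J2 - W J1) - chi (x n *+ p ^ n)))
      + (chi (W J2 - W J1) - (chi (W J2) - chi (W J1)))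
      - (chi (x n *+ p ^ n) - chi (x n) *+ p ^ n)
      + ((chi (W J2) - lam J2 chi) - (chi (W J1) - lam J1 chi))
      - ((lamM J2 M chi - lam J2 chi) - (lamM J1 M chi - lam J1 chi))
      + (f chi n - chi (x n) *+ p ^ n).
      rewrite -h3; move: (chi (_ - _ - _)) (chi (W J2 - _)) (chi (x n *+ _)) (chi (W J2))
        (chi (W J1)) (chi (x n) *+ _) (lam J2 chi) (lam J1 chi) (lamM J2 _ _) (lamM J1 _ _).
      by move=> *; ring.
    rewrite e1; apply: rpredD => //; apply: rpredB; last exact: rpredB.
    apply: rpredD; last exact: rpredB.
    by apply: rpredB => //; exact: rpredD.
  have [_] := xP n; apply.
  have mn : (m <= n)%N by rewrite leq_maxl.
  have -> : x n *+ p ^ (n + n) = ((W J2 *+ p ^ m - W J1 *+ p ^ m)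
      - (W J2 - W J1 - x n *+ p ^ n) *+ p ^ m) *+ p ^ (n - m).
    have -> : W J2 *+ p ^ m - W J1 *+ p ^ m - (W J2 - W J1 - x n *+ p ^ n) *+ p ^ m =
        x n *+ p ^ n *+ p ^ m.
      by rewrite -!mulrnBl; congr (_ *+ _); zmod.
    by rewrite -!mulrnA -!expnD subnKC.
  apply: (subgroupMn sS); apply: (proj2 sS); first exact: (proj2 sS).
  exact: subgroupMn.
(* With no good cylinder, each cylinder contains, for each [m], a smaller one on which exponent [m]
   fails; the nested cylinders determine a [J] that has no exponent. *)
have step (mz : nat * ((nat -> bool) * nat)) : exists z' : (nat -> bool) * nat,
    [/\ forall n, (n < mz.2.2)%N -> z'.1 n = mz.2.1 n, (mz.2.2 < z'.2)%N &
     forall J', (forall n, (n < z'.2)%N -> J' n = z'.1 n) -> ~ S (W J' *+ p ^ mz.1)].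
  case: mz => m z /=.
  have [J1 J1z nS] : exists2 J1, (forall n, (n < z.2)%N -> J1 n = z.1 n) & ~ S (W J1 *+ p ^ m).
    apply: contrapT => h; apply: nogood; exists m, z => J' J'z.
    by apply: contrapT => nS; apply: h; exists J'.
  have [k kP] : exists k, forall J', (forall n, (n < k)%N -> J' n = J1 n) ->
      ~ S (W J' *+ p ^ m).
    apply: contrapT => h; apply: nS; apply: Wlim => k; apply: contrapT => h'.
    by apply: h; exists k => J' J'k SJ; apply: h'; exists J'.
  exists (J1, maxn k z.2.+1) => /=; split=> //; first by rewrite leq_maxr.
  by move=> J' J'P; apply: kP => n nk; apply: J'P; rewrite leq_max nk.
have [st stP] := choice step.
pose zs := fix zs m := if m is m'.+1 then st (m, zs m') else st (0%N, (fun=> false, 0%N)).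
have zsbad m J' : (forall n, (n < (zs m).2)%N -> J' n = (zs m).1 n) -> ~ S (W J' *+ p ^ m).
  by case: m => [|m]; [have [_ _ h] := stP (0%N, (fun=> false, 0%N))|
    have [_ _ h] := stP (m.+1, zs m)]; exact: h.
have zsS m : (forall n, (n < (zs m).2)%N -> (zs m.+1).1 n = (zs m).1 n) /\
    ((zs m).2 < (zs m.+1).2)%N.
  by have [h1 h2 _] := stP (m.+1, zs m).
have zslt m : (m < (zs m).2)%N.
  elim: m => [|m IH]; first by have [_ h _] := stP (0%N, (fun=> false, 0%N)).
  by have [_ h] := zsS m; exact: leq_ltn_trans IH h.
have zsagree m m' : (m <= m')%N -> ((zs m).2 <= (zs m').2)%N /\
    forall n, (n < (zs m).2)%N -> (zs m').1 n = (zs m).1 n.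
  move=> /subnK <-; elim: (m' - m)%N => [|k [IH1 IH2]]; first by rewrite add0n.
  have [h1 h2] := zsS (k + m)%N; rewrite addSn; split; first exact: leq_trans IH1 (ltnW h2).
  by move=> n nm; rewrite h1 ?IH2//; exact: leq_trans nm IH1.
have [m Sm] := WE (fun n => (zs n).1 n).
apply: (zsbad m (fun n => (zs n).1 n)) Sm => n nm.
have [mn|/ltnW nm'] := leqP m n; first by have [_ ->] := zsagree _ _ mn.
by have [_ ->] := zsagree _ _ nm'.
Qed.

End compact_elements.

Section power_essential.
Context (R : realType) (K : topologicalZmodType) (S : set K) (I : Type).
Hypothesis cK : compact [set: K].
Hypothesis hK : hausdorff_space K.
Hypothesis sS : subgroup S.
Hypothesis Sc : sequentially_closed S.
Hypothesis Se : essential S.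
Hypothesis DS : divisible_part K `<=` S.
Local Notation P := (group_power I K).

Let power_mulrn (f : P) n i : (f *+ n) i = f i *+ n.
Proof. exact: (@fctMn I K f n i). Qed.

Let cchar_proj (chi : K -> R) i : cchar chi -> cchar (fun f : P => chi (f i)).
Proof.
move=> [c1 c2]; split; first by move=> f g; exact: c1.
move=> e e0; have [V V0 VP] := c2 e e0; exists [set f : P | V (f i)].
  exact: (@power_proj_continuous I K i (0 : P) V V0).
by move=> f; exact: VP.
Qed.

(** Without non-zero divisible elements in [N], the characters of [x0] are torsion, and some
    [p]-component [y] of [x0] is non-zero. Either [y *+ p ^ m] is non-zero, for the uniform exponent
    [m], or [y] has finite order; its last non-zero multiple by a power of [p] then has coordinates
    killed by [p], which lie in [S] because [S] is essential. *)
Lemma power_essential : essential [set f : P | forall i, S (f i)].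
Proof.
move=> N sN clN [x0 Nx0 x00].
have cP := @power_compact I K cK; have hP := @power_hausdorff I K hK.
have [[f [Nf Df f0]]|ND] := pselect (exists f : P, [/\ N f, divisible_part P f & f <> 0]).
  exists f; split=> // i; apply: DS => n n0; have [g gf] := Df n n0.
  by exists (g i); rewrite -gf power_mulrn.
have Ppc U : nbhs (0 : P) U -> finitely_covered setT U by exact: compact_finitely_covered.
have xt : forall chi : P -> R, cchar chi -> torsion_mod1 (chi x0).
  apply: nbhs_torsion => U; rewrite nbhsE => -[A [oA A0] AU]; apply: contrapT => h.
  (* A common point of these sets would be a non-zero divisible element of [N]. *)
  have [n|n|n|f fP] := @compact_decreasing P (fun n => N `&`
      ([set z *+ n`! | z in [set: P]] `&` ~` A)) cP.
  - apply: closedI => //; apply: closedI; first exact: multiples_closed.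
    exact: open_closedC.
  - have [b nb] : exists b : int, ~ U (x0 *~ (b * (n`!)%:Z)).
      apply: contrapT => h'; apply: h; exists n`!; first exact: fact_gt0.
      by move=> b; apply: contrapT => nU; apply: h'; exists b.
    exists (x0 *~ (b * (n`!)%:Z)); split; first exact: subgroupMz.
    split; last by move=> /AU.
    by exists (x0 *~ b) => //; rewrite pmulrn mulrzA.
  - move=> f [Nf [[z _ zf] nA]]; split=> //; split=> //; exists (z *+ n.+1) => //.
    by rewrite -mulrnA -factS.
  have f0 : f = 0.
    apply: contrapT => f0; apply: ND; exists f; split=> //; first by have [] := fP 0%N.
    by apply: multiples_fact => n; have [_ [[z _ <-] _]] := fP n; exists z.
  by have [_ [_ nA]] := fP 0%N; apply: nA; rewrite f0.
have [chi [cc chix]] : exists chi : P -> R, cchar chi /\ ~ (chi x0 \is a Num.int).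
  apply: contrapT => h; apply: x00; apply: (@chars_separate R P Ppc) => // chi cc.
  by apply: contrapT => nc; apply: h; exists chi.
have exq : exists q, (0 < q)%N && (chi x0 *+ q \is a Num.int).
  by have [q q0 xq] := xt _ cc; exists q; rewrite q0.
have [q /andP[q0 xq] qmin] := ex_minnP exq.
have q1 : (1 < q)%N.
  rewrite ltn_neqAle q0 andbT; apply/eqP => e; apply: chix.
  by move: xq; rewrite -e mulr1n.
have pp := pdiv_prime q1; set p := pdiv q in pp.
have [y [Ny yp yp']] := torsion_decomposition p cP sN clN Nx0 xt.
have y0 : y <> 0.
  move=> y0; have [t tp] := yp' _ cc.
  have c0 : chi y \is a Num.int by rewrite y0; exact: pre_character0 cc.1.
  rewrite mulrnBl => h; have xt' : chi x0 *+ t \is a Num.int.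
    by rewrite -[chi x0 *+ t](subrK (chi y *+ t)); apply: rpredD => //; exact: rpredMn.
  have := qmin (gcdn q t); rewrite gcdn_gt0 q0 (int_gcd q0 xq xt') => /(_ isT) le.
  have qt : (q %| t)%N.
    have /eqP <- : gcdn q t == q by rewrite eqn_leq le andbT dvdn_leq// dvdn_gcdl.
    exact: dvdn_gcdr.
  have /andP[t0 _] := tp; have pt : (p %| t)%N := dvdn_trans (pdiv_dvd q) qt.
  by have := (pnatP _ t0 tp) p pp pt; rewrite !inE eqxx.
have ype i : p_element R p (y i).
  by move=> psi /(cchar_proj i)/yp.
have [m mP] := uniform_exponent R cK hK sS Sc Se pp DS.
have [ym0|ym0] := pselect (y *+ p ^ m = 0); last first.
  exists (y *+ p ^ m); split=> //; first exact: subgroupMn.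
  by move=> i; rewrite power_mulrn; exact: mP.
have exk : exists k, y *+ p ^ k == 0 by exists m; apply/eqP.
have [[|k] /eqP yk kmin] := ex_minnP exk; first by case: y0.
have zp : y *+ p ^ k *+ p = 0 by rewrite -mulrnA -expnSr.
exists (y *+ p ^ k); split; first exact: subgroupMn.
  move=> i; set z := (y *+ p ^ k) i.
  have zp0 : z *+ p = 0 by rewrite -power_mulrn zp.
  have [->|z0] := pselect (z = 0); first by case: sS.
  have zt U : nbhs (0 : K) U -> exists n, forall b : int, U (z *~ (b * (p ^ n)%N%:Z)).
    move=> /nbhs_singleton U0; exists 1%N => b.
    by rewrite mulrC mulrzA -pmulrn expn1 zp0 mul0rz.
  have [[|l] [Sl l0]] := essential_multiple pp hK zt sS Sc Se z0; first exact: Sl.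
  by exfalso; apply: l0; rewrite expnS mulrnA zp0 mul0rn.
by move=> e; have := kmin k; rewrite e eqxx => /(_ isT); rewrite ltnn.
Qed.

End power_essential.

Theorem theoremA (G Gt : topologicalZmodType) (i : {additive G -> Gt})
    (Gt_completion : is_completion i)
    (G_minimal : minimal_group G)
    (G_seq_complete : sequentially_complete i) :
  [<-> (forall I : Type, minimal_group (group_power I G));
       minimal_group (group_power nat G);
       zero_component Gt `<=` range i] /\
  (zero_component Gt `<=` range i ->
     i @` zero_component G = zero_component Gt /\
     compact (zero_component G)).
Proof.
pose R := Rdefinitions.R : realType.
have [ei di] := completion_embedding Gt_completion.
have [hK cpl inj oE _] := Gt_completion.
have Kpc := dense_finitely_covered ei di (minimal_precompact R G_minimal).
have cK := complete_compact cpl Kpc.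
have sS := embedding_range_subgroup ei.
have Se := minimal_essential ei G_minimal hK di.
have Sc : sequentially_closed (range i) := G_seq_complete.
have DE : zero_component Gt = divisible_part Gt.
  rewrite eqEsubset; split; first exact: (zero_component_divisible cK hK R).
  exact: divisible_part_component.
split.
  tfae.
  - exact.
  - move=> Gw; rewrite DE; apply: (@divisible_sub R Gt cK hK (range i) sS Sc) => p pp.
    apply: contrapT => nex.
    have xex n : exists x : Gt, p_element R p x /\ ~ range i (x *+ p ^ n).
      apply: contrapT => h; apply: nex; exists n => x px.
      by apply: contrapT => nS; apply: h; exists x.
    (* The bad elements form one point of the countable power. A single exponent [m] brings it into
       the power of [G], and coordinate [m] contradicts the choice of [x m]. *)
    have [x xP] := choice xex; pose y : group_power nat Gt := x.
    have eI := @power_map_embedding nat G Gt i ei.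
    have hP := @power_hausdorff nat Gt hK.
    have Ie := minimal_essential eI Gw hP (@power_map_dense nat G Gt i di).
    have y0 : y <> 0.
      move=> y0; have [_ nS] := xP 0%N; apply: nS.
      have -> : x 0%N = 0 by exact: (congr1 (fun f : nat -> Gt => f 0%N) y0).
      by rewrite mul0rn; case: sS.
    have yt U : nbhs (0 : group_power nat Gt) U ->
        exists n, forall b : int, U (y *~ (b * (p ^ n)%N%:Z)).
      move=> /power_nbhs0[s [V [V0 VU]]].
      have [n nP] : exists n, forall k : {classic nat}, k \in s ->
          forall b : int, V (x k *~ (b * (p ^ n)%N%:Z)).
        elim: s {VU} => [|k s [n nP]]; first by exists 0%N.
        have [px _] := xP k; have [n' n'P] := p_element_nbhs cK px V0.
        have pmul (l m : nat) (b : int) : (l <= m)%N ->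
            b * (p ^ m)%N%:Z = b * (p ^ (m - l))%N%:Z * (p ^ l)%N%:Z.
          by move=> lm; rewrite -mulrA -PoszM -expnD subnK.
        exists (maxn n n') => l; rewrite inE => /orP[/eqP -> b|ls b].
          by rewrite (pmul n')// leq_maxr.
        by rewrite (pmul n) ?leq_maxl//; exact: nP.
      exists n => b; apply: VU => k ks.
      by rewrite [X in V X](@fctMz nat Gt y); exact: nP.
    have [m [[g _ gE] _]] := essential_multiple pp hP yt (embedding_range_subgroup eI)
      (@power_map_sequentially_closed nat G Gt i Sc) Ie y0.
    have [_ nS] := xP m; apply: nS; exists (g m) => //.
    have /(congr1 (fun f : nat -> Gt => f m)) := gE.
    by rewrite [RHS](@fctMn nat Gt y).
  - move=> cS I; have DS : divisible_part Gt `<=` range i by rewrite -DE.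
    have eI := @power_map_embedding I G Gt i ei.
    apply: (essential_minimal eI (@power_compact I Gt cK) (@power_hausdorff I Gt hK)).
    move=> N sN clN Nx; have [y [Ny Sy y0]] := power_essential R cK hK sS Sc Se DS sN clN Nx.
    by exists y; split=> //; exact: power_map_range.
move=> cS; have i0 : i 0 = 0 by exact: raddf0.
have cti : continuous i.
  move=> x W /group_nbhsE W0; apply/group_nbhsE.
  apply: filterS (embedding_nbhs ei W0) => z /=; by rewrite raddfD.
have imE : i @` zero_component G = zero_component Gt.
  rewrite eqEsubset; split.
    apply: connected_component_max => //.
      by exists 0 => //; exact: connected_component_refl.
    apply: connected_continuous_connected; first exact: component_connected.
    exact: continuous_subspaceT.
  (* The preimage of the component is connected: the component lies in the range, so [i] carries a
     clopen subset of the preimage to a clopen subset of the component. *)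
  move=> y cy; have [g _ gy] := cS y cy; exists g => //.
  have : (i @^-1` zero_component Gt) g by rewrite /= gy.
  apply: connected_component_max => //.
    by rewrite /= i0; exact: connected_component_refl.
  move=> B [b Bb] [U oU BU] [C cC BC].
  move: oU; rewrite oE => -[U' oU' U'U].
  have [C' oC' C'C] : exists2 C', open C' & i @^-1` C' = ~` C.
    by have := closed_openC cC; rewrite oE => -[C' oC' e]; exists C'.
  have imB : i @` B = zero_component Gt `&` U'.
    rewrite eqEsubset; split.
      by move=> t [z Bz zt]; rewrite -zt; move: Bz; rewrite BU -U'U => -[].
    move=> z [cz Uz]; have [h _ hz] := cS z cz; exists h => //.
    by rewrite BU -U'U; split; rewrite /= hz.
  have imB' : i @` B = zero_component Gt `&` ~` C'.
    rewrite eqEsubset; split.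
      move=> t [z Bz zt]; rewrite -zt; move: Bz; rewrite BC => -[cz Cz]; split=> // C'z.
      by have : (i @^-1` C') z by []; rewrite C'C; apply.
    move=> z [cz Cz]; have [h _ hz] := cS z cz; exists h => //.
    rewrite BC; split; first by rewrite /= hz.
    by apply: contrapT => nC; apply: Cz; rewrite -hz; have : (~` C) h by []; rewrite -C'C.
  have iBE : i @` B = zero_component Gt.
    apply: (@component_connected Gt [set: Gt] 0).
    - by exists (i b), b.
    - by exists U'.
    - by exists (~` C') => //; exact: open_closedC.
  rewrite eqEsubset; split; first by rewrite BU => z [].
  by move=> z /=; rewrite -iBE => -[w Bw /inj <-].
(* Compactness is pulled back: a cluster point of the image filter lies in the compact component of
   [Gt], hence comes from [G]. *)
split=> // F FF FC.
have iF : ProperFilter (i @ F) by exact: fmap_proper_filter.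
have cD : compact (zero_component Gt).
  apply: (subclosed_compact _ cK) => //; rewrite DE; exact: divisible_part_closed.
have iFC : (i @ F) (zero_component Gt).
  have h : F (i @^-1` zero_component Gt) by apply: filterS FC => z cz; rewrite /= -imE; exists z.
  exact: h.
have [y [cy yF]] := cD (i @ F) iF iFC.
move: cy yF; rewrite -imE => -[g cg <-] gF; exists g; split=> // A B FA Bg.
have /group_nbhsE Bg0 := Bg; have [_ _ jE] := ei; have [V V0 VB] := (jE _).1 Bg0.
have FA' : (i @ F) (i @` A).
  have h : F (i @^-1` (i @` A)) by apply: filterS FA => z Az; exists z.
  exact: h.
have [_ [[z Az <-] Vz]] := gF _ _ FA' (nbhs_translate (i g) V0).
exists z; split=> //; have /= := VB (z - g); rewrite raddfB [g + _]addrC subrK; exact.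
Qed.
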